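(* Let $\alpha\in(0,1]$, $p\in(1,\infty)$, let $\kappa,\kappa_0,\mathcal K$, $(h_n)_{n\in\mathbb N}$ and $(I_n)_{n\in\mathbb N}$ be as in the context (standing setting, Chernoff conditions and extension conditions), and let $\mathcal H,\rho,\mathcal L$ satisfy the architecture conditions of the context. (1) For every $\alpha'\in[0,\alpha)$, $\kappa'\in\mathcal K$ with $\kappa'\ll\kappa$, $T\ge0$, $n\in\mathbb N$ and $\varepsilon>0$, there exists $\Phi_n\in\mathcal{CN}^{\mathcal H,\rho,\mathcal L}_{C_{\kappa_0},C^\alpha_\kappa}$ with $$\|I(\pi_n^t)f-\Phi(\pi_n^t)f\|_{\alpha',\kappa'}\le(1+\|f\|_{\alpha,\kappa})^{p^{k_n^t}}\varepsilon\qquad\text{for all }t\in[0,T]\text{ and }f\in C^\alpha_\kappa .$$ (2) Let $(S(t))_{t\ge0}$ be the semigroup on $C_\kappa$ given by $S(t)f:=\lim_{n\to\infty}I(\pi_n^t)f$. Then, for every $r,T\ge0$, $\alpha'\in[0,\alpha)$, $\kappa'\in\mathcal K$ with $\kappa'\ll\kappa$ and $\varepsilon>0$, there exist $n\in\mathbb N$ and $\Phi_n\in\mathcal{CN}^{\mathcal H,\rho,\mathcal L}_{C_{\kappa_0},C^\alpha_\kappa}$ with $$\sup_{f\in B_{C^\alpha_\kappa}(r)}\ \sup_{t\in[0,T]}\|S(t)f-\Phi(\pi_n^t)f\|_{\alpha',\kappa'}<\varepsilon .$$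
   Context: **Function spaces.** $|\cdot|$ is the Euclidean norm on $\mathbb R^d$. For a bounded continuous function $\kappa:\mathbb R^d\to(0,\infty)$, $C_\kappa$ is the space of continuous $f:\mathbb R^d\to\mathbb R$ with $\|f\|_\kappa:=\sup_x|f(x)|\kappa(x)<\infty$, ordered pointwise. Put $\bar\kappa(x,y):=\frac{2\kappa(x)\kappa(y)}{\kappa(x)+\kappa(y)}$. For $\alpha\in[0,1]$ let $$\|f\|_{\alpha,\kappa}:=\max\Big\{\sup_x|f(x)|\kappa(x),\ \sup_{x\ne y}\frac{|f(x)-f(y)|}{|x-y|^\alpha}\bar\kappa(x,y)\Big\}$$ and let $C^\alpha_\kappa$ be the space of all $f:\mathbb R^d\to\mathbb R$ with $\|f\|_{\alpha,\kappa}<\infty$ (for $\alpha=0$, $f$ is also required to be continuous, so that $C^0_\kappa=C_\kappa$ as sets); $B_{C^\alpha_\kappa}(r):=\{f\in C^\alpha_\kappa:\|f\|_{\alpha,\kappa}\le r\}$. The little space $c^\alpha_\kappa\subset C^\alpha_\kappa$ consists of all $f\in C^\alpha_\kappa$ with $\lim_{|x|\to\infty}|f(x)|\kappa(x)=0$ and $\lim_{\delta\to0}\sup_{x\ne y,|x-y|<\delta}\frac{|f(x)-f(y)|}{|x-y|^\alpha}\bar\kappa(x,y)=0$. For bounded continuous $\kappa',\kappa:\mathbb R^d\to(0,\infty)$, $\kappa'\lesssim\kappa$ means $\kappa'\le c\kappa$ for some constant $c\ge0$, and $\kappa'\ll\kappa$ means $\lim_{|x|\to\infty}\kappa'(x)/\kappa(x)=0$.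 $\mathrm{Lip}_b(r)$ is the set of $r$-Lipschitz $f:\mathbb R^d\to\mathbb R$ with $\|f\|_\infty\le r$; $C_b^\infty$ is the space of bounded smooth functions on $\mathbb R^d$ with all derivatives bounded; $(\tau_xf)(y):=f(x+y)$; $B_{C_\kappa}(r):=\{f\in C_\kappa:\|f\|_\kappa\le r\}$; $B_{\mathbb R^d}(\delta):=\{x:|x|\le\delta\}$; $\|f\|_{\infty,K}:=\sup_{x\in K}|f(x)|$. **Standing setting.** $\kappa,\kappa_0:\mathbb R^d\to(0,\infty)$ are bounded continuous with $\kappa_0\ll\kappa$ and $\sup_{x}\sup_{|y|\le1}\kappa(x)/\kappa(x-y)<\infty$; $(h_n)\subset(0,\infty)$ with $h_n\to0$; $I_n:C_\kappa\to C_\kappa$, $n\in\mathbb N$. $C_\kappa$ carries the mixed topology (strongest locally convex topology coinciding on $\|\cdot\|_\kappa$-bounded sets with uniform convergence on compacts); $f_n\to f$ in it iff $\sup_n\|f_n\|_\kappa<\infty$ and $\|f-f_n\|_{\infty,K}\to0$ for all compact $K\subset\mathbb R^d$. For $t\ge0$, $k_n^t:=\max\{k\in\mathbb N_0:kh_n\le t\}$, $I(\pi_n^t)f:=I_n^{k_n^t}f$ and $\Phi(\pi_n^t)f:=\Phi_n^{k_n^t}f$ ($k_n^t$-fold compositions). $I'(0)f:=\lim_{n\to\infty}\frac{I_nf-f}{h_n}$ whenever this limit exists in $C_\kappa$ (mixed topology). **Chernoff conditions** (assumed throughout): (i) each $I_n$ is convex ($I_n(\lambda f+(1-\lambda)g)\le\lambda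 I_nf+(1-\lambda)I_ng$ for $\lambda\in[0,1]$) and monotone ($f\le g\Rightarrow I_nf\le I_ng$) with $I_n0=0$; (ii) there is $\omega\ge0$ with $\|I_nf-I_ng\|_\kappa\le e^{\omega h_n}\|f-g\|_\kappa$ for all $f,g\in C_\kappa$, $n\in\mathbb N$; (iii) for all $\varepsilon>0$, $r,T\ge0$ and compact $K\subset\mathbb R^d$ there are $c\ge0$ and compact $K'\subset\mathbb R^d$ with $\|I(\pi_n^t)f-I(\pi_n^t)g\|_{\infty,K}\le c\|f-g\|_{\infty,K'}+\varepsilon$ for all $t\in[0,T]$, $n\in\mathbb N$, $f,g\in B_{C_\kappa}(r)$; (iv) for every $\varepsilon>0$ there are $\delta>0$, $n_0\in\mathbb N$ with $I_n(\tau_xf)\le\tau_xI_nf+\frac{r\varepsilon h_n}{\kappa}$ for all $r\ge0$, $f\in\mathrm{Lip}_b(r)$, $x\in B_{\mathbb R^d}(\delta)$, $n\ge n_0$; (v) $I_n:\mathrm{Lip}_b(r)\to\mathrm{Lip}_b(e^{\omega h_n}r)$ for all $r\ge0$, $n\in\mathbb N$; (vi) $I'(0)f\in C_\kappa$ exists for all $f\in C_b^\infty$. It is known (prior work) that under the Chernoff conditions the limit $S(t)f:=\lim_{n\to\infty}I(\pi_n^t)f$ exists in the mixed topology for all $t\ge0$, $f\in C_\kappa$ and defines a strongly continuous convex monotone semigroup on $C_\kappa$. **Extension conditions.** The $I_n$ can be extended to operators $I_n:C_{\kappa_0}\to C_{\kappa_0}$, and there is a set $\mathcal K$ of bounded continuous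 functions $\kappa':\mathbb R^d\to(0,\infty)$ with $\kappa_0\lesssim\kappa'\lesssim\kappa$ such that $\kappa\in\mathcal K$ and: (i) for all $\kappa_1,\kappa_2\in\mathcal K$ with $\kappa_1\ll\kappa_2$ there is $\kappa_3\in\mathcal K$ with $\kappa_1\ll\kappa_3\ll\kappa_2$; (ii) $\|I_nf\|_{\alpha',\kappa'}\le e^{\omega h_n}\|f\|_{\alpha',\kappa'}$ for all $\alpha'\in(0,\alpha]$, $\kappa'\in\mathcal K$, $n\in\mathbb N$, $f\in C^{\alpha'}_{\kappa'}$; (iii) for all $\alpha'\in[0,\alpha)$, $\kappa'\in\mathcal K$ with $\kappa'\ll\kappa$ and $n\in\mathbb N$ there is $c\ge0$ with $\|I_nf-I_ng\|_{\alpha',\kappa'}\le c\|f-g\|_{\alpha',\kappa'}$ for all $f,g\in C^{\alpha'}_{\kappa'}$. **Chernoff-neural operators.** Let $\mathcal H$ be a set of maps $h:C_{\kappa_0}\to\mathbb R$, $\rho\in C(\mathbb R)$ and $\mathcal L\subset C^\alpha_\kappa$. $\mathcal{CN}^{\mathcal H,\rho,\mathcal L}_{C_{\kappa_0},C^\alpha_\kappa}$ is the set of all maps $\Phi:C_{\kappa_0}\to C^\alpha_\kappa$, $f\mapsto\sum_{m=1}^My_m\rho(h_m(f))$ with $M\in\mathbb N$, $h_1,\dots,h_M\in\mathcal H$, $y_1,\dots,y_M\in\mathcal L$. **Architecture conditions.** (i) $\mathcal H$ is a vector space, contains all constant maps and separates points of $C_{\kappa_0}$. For all $0\le\alpha'<\alpha''\le\alpha$,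 $\kappa',\kappa''\in\mathcal K$ with $\kappa'\ll\kappa''$ and $h\in\mathcal H$, the map $h:(C^{\alpha''}_{\kappa''},\|\cdot\|_{\alpha',\kappa'})\to\mathbb R$ is continuous and $\sup_{f\in C^{\alpha''}_{\kappa''}}\frac{1+|h(f)|}{1+\|f\|_{\alpha'',\kappa''}}<\infty$. (ii) $\rho\in C(\mathbb R)$ is non-polynomial with $\lim_{|x|\to\infty}\frac{|\rho(x)|}{(1+|x|)^p}=0$. (iii) $\mathcal L\subset C^\alpha_\kappa$ is a dense linear subspace of $c^{\alpha'}_{\kappa'}$ for all $0\le\alpha'<\alpha$ and $\kappa'\in\mathcal K$ with $\kappa'\ll\kappa$. *)

(* Defs.v *)
From HB Require Import structures.
From mathcomp Require Import all_boot all_order all_algebra.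
From mathcomp Require Import all_classical all_reals all_analysis.
Import Order.TTheory GRing.Theory Num.Theory numFieldNormedType.Exports.

Set Implicit Arguments.
Unset Strict Implicit.
Unset Printing Implicit Defensive.

Local Open Scope classical_set_scope.
Local Open Scope ring_scope.

(* The norm [`|x|] that the library puts on ['rV[R]_d] is the sup norm; it
   induces the same topology, but Lipschitz and Hoelder constants, balls and
   moduli below are all taken with respect to [enorm]. *)
Definition enorm (R : realType) (d : nat) (x : 'rV[R]_d) : R :=
  Num.sqrt (\sum_(i < d) x ord0 i ^+ 2).

(* The filter "N x --> +oo"; [x @[x --> infty_along enorm]] is the limit as
   |x| tends to infinity. *)
Definition infty_along (R : realType) (T : Type) (N : T -> R) : set_system T :=
  [set A | exists r : R, forall x, r < N x -> A x].

Global Instance infty_along_filter (R : realType) (T : Type) (N : T -> R) :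
  Filter (infty_along N).
Proof.
split.
- by exists 0.
- move=> A B [a Aa] [b Bb]; exists (Num.max a b) => x.
  by rewrite gt_max => /andP[ax bx]; split; [exact: Aa|exact: Bb].
- by move=> A B AB [a Aa]; exists a => x /Aa /AB.
Qed.

Definition weight (R : realType) (d : nat) (kappa : 'rV[R]_d -> R) : Prop :=
  [/\ continuous kappa, forall x, 0 < kappa x &
      exists c : R, forall x, kappa x <= c].

Definition weight_lesssim (R : realType) (d : nat)
    (kappa' kappa : 'rV[R]_d -> R) : Prop :=
  exists2 c : R, 0 <= c & forall x, kappa' x <= c * kappa x.

Definition weight_ll (R : realType) (d : nat)
    (kappa' kappa : 'rV[R]_d -> R) : Prop :=
  (kappa' x / kappa x) @[x --> infty_along (@enorm R d)] --> (0 : R).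

(* All norms take values in the extended reals, so that they make sense for
   arbitrary functions and finiteness is a separate condition. *)
Definition wnorm (R : realType) (d : nat) (kappa f : 'rV[R]_d -> R) : \bar R :=
  ereal_sup (range (fun x => (`|f x| * kappa x)%:E)).

Arguments wnorm {R d} kappa%_R f%_R.

Definition Ck (R : realType) (d : nat) (kappa : 'rV[R]_d -> R) :
    set ('rV[R]_d -> R) :=
  [set f | continuous f /\ (wnorm kappa f < +oo)%E].

Definition Ck_ball (R : realType) (d : nat) (kappa : 'rV[R]_d -> R) (r : R) :
    set ('rV[R]_d -> R) :=
  [set f | Ck kappa f /\ (wnorm kappa f <= r%:E)%E].

Definition kbar (R : realType) (d : nat) (kappa : 'rV[R]_d -> R)
    (x y : 'rV[R]_d) : R :=
  2 * kappa x * kappa y / (kappa x + kappa y).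

Definition holder_quotient (R : realType) (d : nat) (alpha : R)
    (kappa f : 'rV[R]_d -> R) (x y : 'rV[R]_d) : R :=
  `|f x - f y| / enorm (x - y) `^ alpha * kbar kappa x y.

Definition hnorm (R : realType) (d : nat) (alpha : R)
    (kappa f : 'rV[R]_d -> R) : \bar R :=
  maxe (wnorm kappa f)
       (ereal_sup [set (holder_quotient alpha kappa f z.1 z.2)%:E
                  | z in [set z | z.1 != z.2]]).

Arguments hnorm {R d} alpha%_R kappa%_R f%_R.

Definition Ca (R : realType) (d : nat) (alpha : R) (kappa : 'rV[R]_d -> R) :
    set ('rV[R]_d -> R) :=
  [set f | (hnorm alpha kappa f < +oo)%E /\ (alpha = 0 -> continuous f)].

Definition Ca_ball (R : realType) (d : nat) (alpha : R)
    (kappa : 'rV[R]_d -> R) (r : R) : set ('rV[R]_d -> R) :=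
  [set f | Ca alpha kappa f /\ (hnorm alpha kappa f <= r%:E)%E].

Definition holder_modulus (R : realType) (d : nat) (alpha : R)
    (kappa f : 'rV[R]_d -> R) (delta : R) : \bar R :=
  ereal_sup [set (holder_quotient alpha kappa f z.1 z.2)%:E
            | z in [set z | z.1 != z.2 /\ enorm (z.1 - z.2) < delta]].

Definition little_ca (R : realType) (d : nat) (alpha : R)
    (kappa : 'rV[R]_d -> R) : set ('rV[R]_d -> R) :=
  [set f | [/\ Ca alpha kappa f,
      (`|f x| * kappa x) @[x --> infty_along (@enorm R d)] --> (0 : R) &
      holder_modulus alpha kappa f delta @[delta --> 0^'+] --> 0%E]].

Definition Lip_b (R : realType) (d : nat) (r : R) : set ('rV[R]_d -> R) :=
  [set f | (forall x y, `|f x - f y| <= r * enorm (x - y)) /\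
           (forall x, `|f x| <= r)].

Fixpoint iter_partial (R : realType) (d : nat) (s : seq 'I_d)
    (f : 'rV[R]_d -> R) : 'rV[R]_d -> R :=
  if s is i :: s' then fun x => 'D_(delta_mx ord0 i) (iter_partial s' f) x
  else f.

Definition Cb_smooth (R : realType) (d : nat) : set ('rV[R]_d -> R) :=
  [set f | forall s : seq 'I_d,
    [/\ continuous (iter_partial s f),
        forall x i, derivable (iter_partial s f) x (delta_mx ord0 i) &
        exists c : R, forall x, `|iter_partial s f x| <= c]].

Definition translate (R : realType) (d : nat) (x : 'rV[R]_d)
    (f : 'rV[R]_d -> R) : 'rV[R]_d -> R :=
  fun y => f (x + y).

(* The maximum with 0 only matters for K = set0, where the supremum of a set of
   nonnegative reals is 0 rather than -oo. *)
Definition supnorm_on (R : realType) (d : nat) (K : set 'rV[R]_d)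
    (f : 'rV[R]_d -> R) : \bar R :=
  maxe 0%E (ereal_sup [set (`|f x|)%:E | x in K]).

Arguments supnorm_on {R d} K f%_R.

(* Sequential convergence in the mixed topology of C_kappa. *)
Definition mixed_cvg (R : realType) (d : nat) (kappa : 'rV[R]_d -> R)
    (u : nat -> 'rV[R]_d -> R) (f : 'rV[R]_d -> R) : Prop :=
  [/\ forall n, Ck kappa (u n), Ck kappa f,
      (ereal_sup (range (fun n => wnorm kappa (u n))) < +oo)%E &
      forall K : set 'rV[R]_d, compact K ->
        supnorm_on K (f \- u n) @[n --> \oo] --> 0%E].

Definition ksteps (R : realType) (h t : R) : nat := Num.truncn (t / h).

Lemma ksteps_max (R : realType) (h t : R) : 0 < h -> 0 <= t ->
  forall k : nat, (k%:R * h <= t) = (k <= ksteps h t)%N.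
Proof.
move=> h0 t0 k; rewrite /ksteps truncn_ge_nat ?divr_ge0 ?(ltW h0) //.
by rewrite ler_pdivlMr.
Qed.

(* Operators on a function space are total maps on all functions
   ['rV[R]_d -> R]; only their values on the stated domain are constrained or
   used. *)
Definition steps (R : realType) (d : nat) (h : nat -> R)
    (A : ('rV[R]_d -> R) -> ('rV[R]_d -> R)) (n : nat) (t : R)
    (f : 'rV[R]_d -> R) : 'rV[R]_d -> R :=
  iter (ksteps (h n) t) A f.

Record standing_setting (R : realType) (d : nat)
    (kappa kappa0 : 'rV[R]_d -> R) (h : nat -> R)
    (I : nat -> ('rV[R]_d -> R) -> ('rV[R]_d -> R)) : Prop :=
  StandingSetting {
    ss_kappa : weight kappa;
    ss_kappa0 : weight kappa0;
    ss_ll : weight_ll kappa0 kappa;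
    ss_shift : exists c : R, forall x y : 'rV[R]_d, enorm y <= 1 ->
      kappa x / kappa (x - y) <= c;
    ss_h_gt0 : forall n, 0 < h n;
    ss_h_cvg0 : h n @[n --> \oo] --> (0 : R);
    ss_maps : forall n f, Ck kappa f -> Ck kappa (I n f)
  }.

Record chernoff_conditions (R : realType) (d : nat) (kappa : 'rV[R]_d -> R)
    (omega : R) (h : nat -> R)
    (I : nat -> ('rV[R]_d -> R) -> ('rV[R]_d -> R)) : Prop :=
  ChernoffConditions {
    ch_convex : forall n f g (l : R), Ck kappa f -> Ck kappa g ->
      0 <= l -> l <= 1 -> forall x,
      I n (fun y => l * f y + (1 - l) * g y) x <=
        l * I n f x + (1 - l) * I n g x;
    ch_monotone : forall n f g, Ck kappa f -> Ck kappa g ->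
      (forall x, f x <= g x) -> forall x, I n f x <= I n g x;
    ch_zero : forall n x, I n (fun=> 0) x = 0;
    ch_omega : 0 <= omega;
    ch_lipschitz : forall n f g, Ck kappa f -> Ck kappa g ->
      (wnorm kappa (I n f \- I n g) <=
        (expR (omega * h n))%:E * wnorm kappa (f \- g))%E;
    ch_local : forall (eps r T : R) (K : set 'rV[R]_d),
      0 < eps -> 0 <= r -> 0 <= T -> compact K ->
      exists (c : R) (K' : set 'rV[R]_d),
        [/\ 0 <= c, compact K' &
          forall (t : R) n f g, 0 <= t <= T ->
            Ck_ball kappa r f -> Ck_ball kappa r g ->
            (supnorm_on K (steps h (I n) n t f \- steps h (I n) n t g) <=
              c%:E * supnorm_on K' (f \- g) + eps%:E)%E];
    ch_translation : forall eps : R, 0 < eps ->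
      exists (delta : R) (n0 : nat), 0 < delta /\
        forall (r : R) f (x : 'rV[R]_d) n, 0 <= r -> Lip_b r f ->
          enorm x <= delta -> (n0 <= n)%N ->
          forall y, I n (translate x f) y <=
            translate x (I n f) y + r * eps * h n / kappa y;
    ch_lip : forall (r : R) n f, 0 <= r -> Lip_b r f ->
      Lip_b (expR (omega * h n) * r) (I n f);
    ch_generator : forall f, Cb_smooth f ->
      exists g, mixed_cvg kappa (fun n x => (I n f x - f x) / h n) g
  }.

Record extension_conditions (R : realType) (d : nat) (alpha : R)
    (kappa kappa0 : 'rV[R]_d -> R) (KK : set ('rV[R]_d -> R))
    (omega : R) (h : nat -> R)
    (I : nat -> ('rV[R]_d -> R) -> ('rV[R]_d -> R)) : Prop :=
  ExtensionConditions {
    ext_maps : forall n f, Ck kappa0 f -> Ck kappa0 (I n f);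
    ext_weights : forall kappa', KK kappa' ->
      [/\ weight kappa', weight_lesssim kappa0 kappa' &
          weight_lesssim kappa' kappa];
    ext_kappa : KK kappa;
    ext_dense : forall kappa1 kappa2, KK kappa1 -> KK kappa2 ->
      weight_ll kappa1 kappa2 ->
      exists kappa3, [/\ KK kappa3, weight_ll kappa1 kappa3 &
                         weight_ll kappa3 kappa2];
    ext_growth : forall (alpha' : R) kappa' n f,
      0 < alpha' -> alpha' <= alpha -> KK kappa' -> Ca alpha' kappa' f ->
      (hnorm alpha' kappa' (I n f) <=
        (expR (omega * h n))%:E * hnorm alpha' kappa' f)%E;
    ext_lipschitz : forall (alpha' : R) kappa' n,
      0 <= alpha' -> alpha' < alpha -> KK kappa' -> weight_ll kappa' kappa ->
      exists2 c : R, 0 <= c &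
        forall f g, Ca alpha' kappa' f -> Ca alpha' kappa' g ->
          (hnorm alpha' kappa' (I n f \- I n g) <=
            c%:E * hnorm alpha' kappa' (f \- g))%E
  }.

Definition chernoff_neural (R : realType) (d : nat) (alpha : R)
    (kappa kappa0 : 'rV[R]_d -> R) (H : set (('rV[R]_d -> R) -> R))
    (rho : R -> R) (L : set ('rV[R]_d -> R)) :
    set (('rV[R]_d -> R) -> ('rV[R]_d -> R)) :=
  [set Phi |
    (forall f, Ck kappa0 f -> Ca alpha kappa (Phi f)) /\
    exists (M : nat) (hm : 'I_M -> ('rV[R]_d -> R) -> R)
           (ym : 'I_M -> 'rV[R]_d -> R),
      [/\ (0 < M)%N, forall m, H (hm m), forall m, L (ym m) &
          forall f, Ck kappa0 f ->
            forall x, Phi f x = \sum_(m < M) ym m x * rho (hm m f)]].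

Record architecture_conditions (R : realType) (d : nat) (alpha p : R)
    (kappa kappa0 : 'rV[R]_d -> R) (KK : set ('rV[R]_d -> R))
    (H : set (('rV[R]_d -> R) -> R)) (rho : R -> R)
    (L : set ('rV[R]_d -> R)) : Prop :=
  ArchitectureConditions {
    ar_add : forall h1 h2, H h1 -> H h2 -> H (fun f => h1 f + h2 f);
    ar_scale : forall (a : R) h1, H h1 -> H (fun f => a * h1 f);
    ar_const : forall a : R, H (fun=> a);
    ar_separates : forall f g, Ck kappa0 f -> Ck kappa0 g -> f <> g ->
      exists2 h1, H h1 & h1 f <> h1 g;
    ar_continuous : forall (alpha' alpha'' : R) kappa' kappa'' h1,
      0 <= alpha' -> alpha' < alpha'' -> alpha'' <= alpha ->
      KK kappa' -> KK kappa'' -> weight_ll kappa' kappa'' -> H h1 ->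
      forall f, Ca alpha'' kappa'' f -> forall eps : R, 0 < eps ->
      exists2 delta : R, 0 < delta &
        forall g, Ca alpha'' kappa'' g ->
          (hnorm alpha' kappa' (g \- f) < delta%:E)%E ->
          `|h1 g - h1 f| < eps;
    ar_growth : forall (alpha' alpha'' : R) kappa' kappa'' h1,
      0 <= alpha' -> alpha' < alpha'' -> alpha'' <= alpha ->
      KK kappa' -> KK kappa'' -> weight_ll kappa' kappa'' -> H h1 ->
      (ereal_sup [set ((1 + `|h1 f|) / (1 + fine (hnorm alpha'' kappa'' f)))%:E
                 | f in Ca alpha'' kappa''] < +oo)%E;
    ar_rho_continuous : continuous rho;
    ar_rho_nonpoly : ~ exists q : {poly R}, forall x, rho x = q.[x];
    ar_rho_growth :
      (`|rho x| / (1 + `|x|) `^ p) @[x --> infty_along (fun x : R => `|x|)]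
        --> (0 : R);
    ar_L_sub : L `<=` Ca alpha kappa;
    ar_L_subspace : forall (alpha' : R) kappa',
      0 <= alpha' -> alpha' < alpha -> KK kappa' -> weight_ll kappa' kappa ->
      [/\ L `<=` little_ca alpha' kappa', L (fun=> 0),
          forall f g, L f -> L g -> L (f \+ g) &
          forall (a : R) f, L f -> L (fun x => a * f x)];
    ar_L_dense : forall (alpha' : R) kappa',
      0 <= alpha' -> alpha' < alpha -> KK kappa' -> weight_ll kappa' kappa ->
      forall f, little_ca alpha' kappa' f -> forall eps : R, 0 < eps ->
      exists2 y, L y & (hnorm alpha' kappa' (f \- y) < eps%:E)%E
  }.

(* Main.v *)
Require Import Defs.
From HB Require Import structures.
From mathcomp Require Import all_boot all_order all_algebra.
From mathcomp Require Import all_classical all_reals all_analysis.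
From mathcomp Require Import measurable_realfun ring lra.
Import Order.TTheory GRing.Theory Num.Theory numFieldNormedType.Exports.

Set Implicit Arguments.
Unset Strict Implicit.
Unset Printing Implicit Defensive.

Local Open Scope classical_set_scope.
Local Open Scope ring_scope.

(** All estimates live on the scale of weighted Hoelder spaces.  Going from a
    pair (alpha, kappa) to a pair (a, k) with [a < alpha] and [k] negligible
    against [kappa] at infinity gains compactness.  Balls of the stronger space
    are compact for pointwise convergence ([compact_hle]).  A function that is
    bounded in the stronger norm and uniformly small on a large ball is small in
    the weaker norm ([hle_interpolate]), so on balls of the stronger space the
    topology of pointwise convergence is finer than the weaker norm
    ([ptws_near_hle]).  Both halves of the theorem are compactness arguments on
    such balls.

    One step of the scheme.  Fix a pair (b, kb) between (a, k) and
    (alpha, kappa).  The functions [cos \o h] with [h] in the space of features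
    span an algebra, since a product of cosines is a sum of cosines.  Bernstein
    polynomials in finitely many elements [(1 + sin \o h) / 2] then give
    partitions of unity [w_j] in this algebra which, up to small mass, live on
    cells of small diameter ([fuzzy_partition]).  With [f_j] in the j-th cell and
    [y_j] in the output space close to [I_n f_j], the operator
    [f |-> \sum_j w_j f *: y_j] approximates [I_n] on a ball.  It also has to be
    controlled off the ball, and it will be iterated, so its norm growth must not
    depend on its accuracy.  Both needs are met by taking for [f_j] an almost
    minimizer of the stronger norm on its cell, and for [y_j] approximations
    whose stronger norm is at most 1 plus a fixed multiple of that of [I_n f_j]
    ([regularization], [approx_by_L]).  The network then grows linearly with a
    constant that is independent of the accuracy, and off a large ball linear
    growth is absorbed by [e * (1 + N f) `^ p] because [1 < p]
    ([one_step_partition]).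

    From the cosine to the activation.  Replacing [cos] by [rho] is a question on
    the line: whether [cos] is a limit of combinations of [rho (a x + b)] for the
    norm with weight [(1 + |x|) `^ - p] ([wdense_cos]).  Repeated averaged
    differences of [rho] produce in the closed span a continuous function [G]
    that decays like [(1 + x ^+ 2) ^- 2].  It may be chosen with [G 0 != 0],
    unless all differences of [rho] of some order vanish, and then [rho] would be
    a polynomial ([decaying_ridge_limit], [fdiff0_poly]).  By uniqueness of the
    Fourier transform, that of [G] does not vanish at some frequency [a != 0]
    ([orthogonal_zero]); convolving [G] with the cosine and the sine of this
    frequency ([wdense_convolution]) and combining the results gives [cos].

    Iteration.  The error of the composed networks propagates through the
    Lipschitz constant of [I_n] and the growth bound of order [p], which after
    [m] steps has become a bound of order [p ^+ m] ([iterated_network],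
    [scheme_approximation]).

    The semigroup.  The scheme converges at each time and each function,
    uniformly on compact sets of points.  It is moreover asymptotically
    equicontinuous on the compact set of all pairs of a time in [[0, T]] and a
    function in a ball ([scheme_equicontinuous]): in the function by the local
    continuity that is assumed, and in time because on compact sets the function
    may be replaced by a trigonometric polynomial, which each step moves by at
    most a multiple of its length ([smooth_data_approx],
    [smooth_time_regularity]).  Hence the convergence is uniform in time and
    function ([scheme_uniform_cvg]).  As the scheme and its limit stay in a ball
    of the stronger space, [hle_interpolate] turns this into convergence in the
    weaker norm, and the approximation of the scheme applies at one fixed [n]
    ([semigroup_approximation]). *)

(** * Ridge functions and the trigonometric algebra *)

Section TrigLipschitz.
Context {R : realType}.

Lemma sin_lipschitz (a b : R) : `|sin a - sin b| <= `|a - b|.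
Proof.
wlog ab : a b / b <= a.
  by move=> W; case: (leP b a) => [/W//|/ltW /W]; rewrite distrC (distrC b).
have [c _ ->] := @MVT_segment _ sin cos b a ab
  (fun x _ => is_derive_sin x) (continuous_subspaceT (@continuous_sin R)).
by rewrite normrM ler_piMl// cos_max.
Qed.

Lemma cos_lipschitz (a b : R) : `|cos a - cos b| <= `|a - b|.
Proof.
by rewrite -!(sinDpihalf); apply: (le_trans (sin_lipschitz _ _)); rewrite opprD addrACA subrr addr0.
Qed.

End TrigLipschitz.

Inductive ridge_span {R : realType} {X : Type} (phi : R -> R)
    (H : set (X -> R)) : (X -> R) -> Prop :=
| ridge_zero : ridge_span phi H (fun=> 0)
| ridge_step a h w : H h -> ridge_span phi H w ->
    ridge_span phi H (fun x => a * phi (h x) + w x).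

Record feature_space {R : realType} {X : Type} (H : set (X -> R)) : Prop :=
  FeatureSpace {
    fs_add : forall h1 h2, H h1 -> H h2 -> H (fun x => h1 x + h2 x);
    fs_scale : forall a h, H h -> H (fun x => a * h x);
    fs_const : forall a, H (fun=> a) }.

Section RidgeSpan.
Context {R : realType} {X : Type}.
Implicit Types (H : set (X -> R)) (phi : R -> R) (w : X -> R).

Lemma ridge_add phi H w1 w2 : ridge_span phi H w1 -> ridge_span phi H w2 ->
  ridge_span phi H (fun x => w1 x + w2 x).
Proof.
move=> r1 r2; elim: r1 => [|a h w Hh _ IH].
  by under eq_fun do rewrite add0r.
under eq_fun do rewrite -addrA.
exact: (@ridge_step _ _ phi H a h (fun x => w x + w2 x)).
Qed.

Lemma ridge_scale phi H c w : ridge_span phi H w ->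
  ridge_span phi H (fun x => c * w x).
Proof.
elim=> [|a h {}w Hh _ IH].
  by under eq_fun do rewrite mulr0; exact: ridge_zero.
under eq_fun do rewrite mulrDr mulrA.
exact: (@ridge_step _ _ phi H (c * a) h (fun x => c * w x)).
Qed.

Lemma ridge_gen phi H h : H h -> ridge_span phi H (fun x => phi (h x)).
Proof.
move=> Hh; have := ridge_step 1 Hh (ridge_zero phi H).
by under eq_fun do rewrite mul1r addr0.
Qed.

Lemma ridge_sum phi H (J : finType) (w : J -> X -> R) :
  (forall j, ridge_span phi H (w j)) ->
  ridge_span phi H (fun x => \sum_j w j x).
Proof.
move=> Hw; elim: (index_enum J) => [|j s IH].
  by under eq_fun do rewrite big_nil; exact: ridge_zero.
under eq_fun do rewrite big_cons.
exact: ridge_add.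
Qed.

Variable H : set (X -> R).
Hypothesis HH : feature_space H.
Local Notation trig := (ridge_span cos H).

Lemma trig_cst c : trig (fun=> c).
Proof.
have := ridge_scale c (ridge_gen cos (fs_const HH 0)).
by under eq_fun do rewrite cos0 mulr1.
Qed.

Lemma trig_sin h : H h -> trig (fun x => sin (h x)).
Proof.
move=> Hh; have := ridge_gen cos (fs_add HH Hh (fs_const HH (- (pi / 2)))).
by under eq_fun do rewrite cosBpihalf.
Qed.

(** The product of two cosines is half the sum of the cosines of the sum and of
    the difference, and the space of features is closed under both. *)
Lemma trig_mul w1 w2 : trig w1 -> trig w2 -> trig (fun x => w1 x * w2 x).
Proof.
move=> + t2; elim=> [|a h w Hh _ IH].
  by under eq_fun do rewrite mul0r; exact: ridge_zero.
under eq_fun do rewrite mulrDl -mulrA.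
apply: ridge_add IH; apply: ridge_scale.
elim: t2 => [|b k {}w Hk _ IH].
  by under eq_fun do rewrite mulr0; exact: ridge_zero.
under eq_fun do rewrite mulrDr.
apply: ridge_add IH.
have hk : H (fun x => h x + k x) by exact: fs_add.
have hk' : H (fun x => h x + -1 * k x).
  by apply: fs_add => //; exact: fs_scale.
have := ridge_scale (b / 2) (ridge_add (ridge_gen cos hk) (ridge_gen cos hk')).
rewrite (_ : (fun x => b / 2 * _) = (fun x => cos (h x) * (b * cos (k x))))//.
by apply/funext => x; rewrite mulN1r cosB cosD; lra.
Qed.

End RidgeSpan.

(** * Bernstein partitions of unity *)

Section Bernstein.
Context {R : realType}.
Implicit Types (s : R) (N j : nat).

(** The probability that a binomial variable with parameters [N] and [s] equals
    [j], by conditioning on the last trial. *)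
Fixpoint bern N j s : R :=
  if N is N'.+1
  then s * (if j is j'.+1 then bern N' j' s else 0) + (1 - s) * bern N' j s
  else (j == 0)%:R.

Lemma bern_ge0 N j s : 0 <= s <= 1 -> 0 <= bern N j s.
Proof.
move=> /andP[s0 s1]; elim: N j => [|N IH] j /=; first by case: j.
by rewrite addr_ge0// mulr_ge0// ?subr_ge0//; case: j.
Qed.

Lemma bern_gt N j s : (N < j)%N -> bern N j s = 0.
Proof.
elim: N j => [|N IH] [|j] //= Nj; rewrite IH// IH ?mulr0 ?addr0//.
exact: ltnW.
Qed.

(** Conditioning on the last trial, for the expectation of [phi]. *)
Lemma bern_step N s (phi : nat -> R) :
  \sum_(j < N.+2) bern N.+1 j s * phi j =
  s * (\sum_(j < N.+1) bern N j s * phi j.+1) +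
  (1 - s) * (\sum_(j < N.+1) bern N j s * phi j).
Proof.
transitivity (\sum_(j < N.+2) (s * (if j : nat is j'.+1 then bern N j' s else 0) * phi j)
   + \sum_(j < N.+2) ((1 - s) * bern N j s * phi j)).
  by rewrite -big_split/=; apply: eq_bigr => j _; rewrite mulrDl.
congr (_ + _).
  rewrite big_ord_recl/= mulr0 mul0r add0r mulr_sumr.
  by apply: eq_bigr => j _; rewrite /= mulrA.
rewrite big_ord_recr/= bern_gt// mulr0 mul0r addr0 mulr_sumr.
by apply: eq_bigr => j _; rewrite mulrA.
Qed.

Lemma bern_sum N s : \sum_(j < N.+1) bern N j s = 1.
Proof.
elim: N => [|N IH]; first by rewrite big_ord_recr big_ord0/= add0r.
have := bern_step N s (fun=> 1).
under eq_bigr do rewrite mulr1; move=> ->.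
by under eq_bigr do rewrite mulr1; rewrite IH; lra.
Qed.

(** The variance of a binomial variable.  In the recursion on [N] the cross
    terms with the first moment cancel. *)
Lemma bern_variance N s :
  \sum_(j < N.+1) bern N j s * (j%:R - N%:R * s) ^+ 2 = N%:R * (s * (1 - s)).
Proof.
elim: N => [|N IH].
  by rewrite big_ord_recr big_ord0/= add0r !mul0r subr0 expr2 !mulr0.
have /= -> := bern_step N s (fun j => (j%:R - N.+1%:R * s) ^+ 2).
have -> : N.+1%:R = N%:R + 1 :> R by rewrite -natr1.
have E1 : \sum_(j < N.+1) bern N j s * (j.+1%:R - (N%:R + 1) * s) ^+ 2 =
   \sum_(j < N.+1) bern N j s * (j%:R - N%:R * s) ^+ 2
   + 2 * (1 - s) * (\sum_(j < N.+1) bern N j s * (j%:R - N%:R * s))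
   + (1 - s) ^+ 2 * (\sum_(j < N.+1) bern N j s).
  rewrite !mulr_sumr -!big_split/=; apply: eq_bigr => j _.
  by rewrite -natr1; ring.
have E2 : \sum_(j < N.+1) bern N j s * (j%:R - (N%:R + 1) * s) ^+ 2 =
   \sum_(j < N.+1) bern N j s * (j%:R - N%:R * s) ^+ 2
   - 2 * s * (\sum_(j < N.+1) bern N j s * (j%:R - N%:R * s))
   + s ^+ 2 * (\sum_(j < N.+1) bern N j s).
  rewrite !mulr_sumr -sumrN -!big_split/=; apply: eq_bigr => j _.
  by ring.
by rewrite E1 E2 IH bern_sum; ring.
Qed.

(** Chebyshev's inequality, uniformly in [s]. *)
Lemma bern_concentration (delta eta : R) : 0 < delta -> 0 < eta ->
  exists N, forall s, 0 <= s <= 1 ->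
    \sum_(j < N.+1 | delta <= `|j%:R / N%:R - s|) bern N j s <= eta.
Proof.
move=> d0 e0; have d20 : 0 < delta ^+ 2 by rewrite exprn_gt0.
have [N N0 NP] : exists2 N : nat, 0 < N%:R :> R &
    1 <= N%:R * (delta ^+ 2 * eta).
  exists (Num.truncn (1 / (delta ^+ 2 * eta))).+1; first by rewrite ltr0n.
  rewrite -ler_pdivrMr ?mulr_gt0//; apply/ltW.
  exact: truncnS_gt.
exists N => s s01; move/andP: (s01) => [s0 s1].
have k0 : 0 < (N%:R * delta) ^+ 2 by rewrite exprn_gt0// mulr_gt0.
rewrite -(ler_pM2l k0) mulr_sumr.
apply: (@le_trans _ _ (\sum_(j < N.+1) bern N j s * (j%:R - N%:R * s) ^+ 2)).
  rewrite big_mkcond/=; apply: ler_sum => j _; case: ifPn => [dj|_]; last first.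
    by apply: mulr_ge0; [exact: bern_ge0|exact: sqr_ge0].
  rewrite mulrC ler_wpM2l ?bern_ge0//.
  rewrite -[leRHS]real_normK ?num_real// ler_pXn2r ?nnegrE// ?mulr_ge0 ?(ltW d0)//.
  have -> : j%:R - N%:R * s = N%:R * (j%:R / N%:R - s).
    by rewrite mulrBr mulrCA divff ?gt_eqF// mulr1.
  by rewrite normrM gtr0_norm// ler_wpM2l.
rewrite bern_variance.
have : N%:R * (s * (1 - s)) <= N%:R * 1 :> R by rewrite ler_pM2l//; nra.
move/le_trans; apply; rewrite mulr1 exprMn.
have : N%:R * 1 <= N%:R * (N%:R * (delta ^+ 2 * eta)) by rewrite ler_pM2l.
by rewrite mulr1 => /le_trans; apply; rewrite le_eqVlt; apply/orP; left; apply/eqP; ring.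
Qed.

End Bernstein.

Section TrigPartition.
Context {R : realType} {X : Type}.
Variable H : set (X -> R).
Hypothesis HH : feature_space H.
Local Notation trig := (ridge_span cos H).

Lemma trig_bern N j s : trig s -> trig (fun x => bern N j (s x)).
Proof.
move=> ts; have ts' : trig (fun x => 1 - s x).
  apply: ridge_add; first exact: trig_cst.
  by under eq_fun do rewrite -mulN1r; exact: ridge_scale.
elim: N j => [|N IH] j /=; first exact: trig_cst.
apply: ridge_add; apply: trig_mul => //.
by case: j => [|j]; [exact: trig_cst|exact: IH].
Qed.

(** Products of one-dimensional Bernstein partitions, by induction on the number
    [k] of coordinates.  The label [lab j] of an index is the grid point around
    which its weight concentrates. *)
Lemma trig_partition (s : nat -> X -> R) k (delta eta : R) :
  (forall i, trig (s i)) -> (forall i x, 0 <= s i x <= 1) ->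
  0 < delta -> 0 < eta ->
  exists (J : finType) (w : J -> X -> R) (lab : J -> nat -> R),
    [/\ forall j, trig (w j), forall j x, 0 <= w j x,
        forall x, \sum_j w j x = 1 &
        forall x, \sum_(j | ~~ [forall i : 'I_k, `|lab j i - s i x| < delta])
          w j x <= eta].
Proof.
move=> ts s01 d0; elim: k eta => [|k IH] eta e0.
  exists unit, (fun _ _ => 1), (fun _ _ => 0); split=> //.
  - by move=> _; exact: trig_cst.
  - by move=> x; rewrite big_const card_unit/= addr0.
  - move=> x; rewrite big_pred0 ?(ltW e0)// => -[].
    by apply/negbTE; rewrite negbK; apply/forallP => -[].
have e20 : 0 < eta / 2 by rewrite divr_gt0.
have [J [w [lab [tw w0 w1 wf]]]] := IH _ e20.
have [N NP] := bern_concentration d0 e20.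
exists (J * 'I_N.+1)%type, (fun (jj : J * 'I_N.+1) x => w jj.1 x * bern N jj.2 (s k x)),
  (fun (jj : J * 'I_N.+1) i => if (i < k)%N then lab jj.1 i else jj.2%:R / N%:R); split.
- by move=> jj; apply: trig_mul => //; exact: trig_bern.
- by move=> jj x; rewrite mulr_ge0// bern_ge0.
- move=> x; rewrite -(pair_bigA _ (fun j i => w j x * bern N (nat_of_ord i) (s k x)))/=.
  by under eq_bigr do rewrite -mulr_sumr bern_sum mulr1.
move=> x; rewrite big_mkcond/=.
pose F1 j := if ~~ [forall i : 'I_k, `|lab j i - s i x| < delta] then w j x else 0.
pose F2 (j : 'I_N.+1) := if delta <= `|j%:R / N%:R - s k x| then bern N j (s k x) else 0.
apply: (@le_trans _ _ (\sum_(jj : J * 'I_N.+1)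
    (F1 jj.1 * bern N jj.2 (s k x) + w jj.1 x * F2 jj.2))).
  apply: ler_sum => -[j i] _ /=.
  have b0 : 0 <= bern N i (s k x) by exact: bern_ge0.
  have r0 : 0 <= F1 j * bern N i (s k x) + w j x * F2 i.
    by rewrite addr_ge0// mulr_ge0// /F1 /F2; case: ifP.
  case: ifPn => // /forallPn/= [l]; case: ifPn => lk.
    rewrite -leNgt => dl; rewrite [F1 j]/F1 ifT.
      by rewrite lerDl mulr_ge0// /F2; case: ifP.
    by apply/forallPn; exists (Ordinal lk); rewrite -leNgt.
  have -> : nat_of_ord l = k.
    by apply/eqP; rewrite eqn_leq -ltnS ltn_ord leqNgt lk.
  by rewrite -leNgt => dl; rewrite [F2 i]/F2 ifT// lerDr mulr_ge0// /F1; case: ifP.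
rewrite big_split/=.
rewrite -(pair_bigA _ (fun j i => F1 j * bern N (nat_of_ord i) (s k x)))/=.
rewrite -(pair_bigA _ (fun j i => w j x * F2 i))/=.
under eq_bigr do rewrite -mulr_sumr bern_sum mulr1.
under [X in _ + X]eq_bigr do rewrite -mulr_sumr.
rewrite -mulr_suml w1 mul1r -!big_mkcond/=.
by apply: (le_trans (lerD (wf x) (NP _ (s01 k x)))); rewrite -splitr.
Qed.

End TrigPartition.

(** * Partitions of unity on compact sets *)

Section SmallCells.
Context {R : realType} {X : topologicalType}.
Variables (H : set (X -> R)) (A : set X) (U : X -> X -> Prop).
Hypothesis HH : feature_space H.
Hypothesis cptA : compact A.
Hypothesis Hcont : forall h, H h -> forall x, A x -> forall e : R, 0 < e ->
  \forall y \near x, A y -> `|h y - h x| < e.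
Hypothesis Hsep : forall x y, A x -> A y -> x <> y ->
  exists2 h, H h & h x <> h y.
Hypothesis Udiag : forall x, A x ->
  \forall y \near x & z \near x, A y -> A z -> U y z.

(** Finer and finer tests: more functions and a smaller tolerance. *)
Let refine : set_system (seq (X -> R) * R) :=
  [set S | exists (l0 : seq (X -> R)) (d0 : R),
    [/\ (forall h, List.In h l0 -> H h), 0 < d0 &
      forall l d, List.incl l0 l -> 0 < d <= d0 -> S (l, d)]].

Local Instance refine_filter : Filter refine.
Proof.
split.
- by exists [::], 1; split.
- move=> P Q [l1 [d1 [H1 d10 P1]]] [l2 [d2 [H2 d20 Q2]]].
  exists (l1 ++ l2), (Num.min d1 d2); split.
  + by move=> h /(List.in_app_or _ _ _)[/H1|/H2].
  + by rewrite lt_min d10.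
  + move=> l d ll /andP[d0]; rewrite le_min => /andP[dd1 dd2]; split.
      by apply: P1; rewrite ?d0// => h hl; apply: ll; apply/List.in_or_app; left.
    by apply: Q2; rewrite ?d0// => h hl; apply: ll; apply/List.in_or_app; right.
- move=> P Q PQ [l [d [Hl d0 Pl]]]; exists l, d; split=> // l' d' ll dd.
  by apply: PQ; exact: Pl.
Qed.

(** On a compact set, finitely many bounded tests [sin \o h] determine points up
    to the neighbourhood [U] of the diagonal.  A covering argument on [A `*` A]:
    off the diagonal a separating function, scaled into the range where [sin] is
    injective, still separates a neighbourhood. *)
Lemma separating_tests : exists (l : seq (X -> R)) (d : R),
  [/\ forall h, List.In h l -> H h, 0 < d &
    forall x y, A x -> A y ->
      (forall h, List.In h l -> `|sin (h x) - sin (h y)| < d) -> U x y].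
Proof.
pose P (i : seq (X -> R) * R) (z : X * X) := A z.1 -> A z.2 ->
  (forall h, List.In h i.1 -> `|sin (h z.1) - sin (h z.2)| < i.2) -> U z.1 z.2.
have /compact_near_coveringP ncA : compact (A `*` A) by exact: compact_setX.
have : \near refine, (A `*` A) `<=` P refine.
  apply: ncA => -[x y] [/= Ax Ay].
  have [xy|xy] := pselect (x = y).
    subst y; have [[V W] /= [Vx Wx] VW] := Udiag Ax.
    exists (V `*` W, setT) => /=; first by split; [exists (V, W)|exact: filterT].
    by move=> [[y z] i] /= [[Vy Wz] _] Ay' Az' _; exact: (VW (y, z)).
  have [h0 Hh0 hxy0] := Hsep Ax Ay xy.
  pose M := 1 + `|h0 x| + `|h0 y|; have M0 : 0 < M by rewrite /M !ltr_wpDr.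
  pose h z := M^-1 * h0 z.
  have Hh : H h by exact: fs_scale.
  have hle z : `|h0 z| <= M -> h z \in `[- (pi / 2), pi / 2]%R.
    move=> hM; rewrite in_itv/= -ler_norml /h normrM gtr0_norm ?invr_gt0//.
    rewrite mulrC ler_pdivrMr//; apply: (le_trans hM).
    rewrite ler_peMl ?(ltW M0)// ler_pdivlMr// mul1r.
    exact: pi_ge2.
  have sxy : sin (h x) != sin (h y).
    apply/eqP => /sin_inj E; apply: hxy0.
    have : h x = h y.
      apply: E; rewrite ?hle// /M.
        by rewrite -addrA addrCA lerDl addr_ge0.
      by rewrite addrC lerDl addr_ge0.
    by move/(mulfI (invr_neq0 (lt0r_neq0 M0))).
  pose e := `|sin (h x) - sin (h y)| / 3.
  have e0 : 0 < e by rewrite divr_gt0// normr_gt0 subr_eq0.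
  have := Hcont Hh Ax e0; have := Hcont Hh Ay e0 => hy hx.
  exists ([set x' | A x' -> `|h x' - h x| < e] `*` [set y' | A y' -> `|h y' - h y| < e],
    [set i | List.In h i.1 /\ i.2 <= e]) => /=.
    split; first by exists ([set x' | A x' -> `|h x' - h x| < e], [set y' | A y' -> `|h y' - h y| < e]).
    exists [:: h], e; split=> // [k [<-|[]]//|l d ll /andP[d0 de]]; split=> //=.
    by apply: ll; left.
  move=> [[x' y'] [l d]] /= [[hx' hy'] [hl de]] Ax' Ay' /(_ _ hl) /= sd.
  exfalso; have := hx' Ax'; have := hy' Ay' => hy1 hx1.
  have := sin_lipschitz (h x') (h x); have := sin_lipschitz (h y') (h y) => sy sx.
  have E : sin (h x) - sin (h y) = (sin (h x') - sin (h y')) - (sin (h x') - sin (h x))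
    + (sin (h y') - sin (h y)) by ring.
  have : `|sin (h x) - sin (h y)| <= `|sin (h x') - sin (h y')| + `|sin (h x') - sin (h x)| + `|sin (h y') - sin (h y)|.
    by rewrite E; apply: (le_trans (ler_normD _ _)); rewrite lerD2r; exact: ler_normB.
  have : `|sin (h x) - sin (h y)| = 3 * e by rewrite /e; field.
  lra.
case=> l [d [Hl d0 lP]]; exists l, d; split=> // x y Ax Ay.
by have := lP l d (@List.incl_refl _ l); rewrite d0 lexx => /(_ isT (x, y)); apply.
Qed.

(** A partition of unity in the trigonometric algebra whose weights are carried,
    up to total mass [eta], by cells that are small in the sense of [U]: apply
    [trig_partition] to the finitely many tests that detect [U]. *)
Lemma fuzzy_partition (eta : R) : 0 < eta ->
  exists (J : finType) (w : J -> X -> R) (C : J -> set X),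
    [/\ [/\ forall j, ridge_span cos H (w j), forall j x, 0 <= w j x &
            forall x, \sum_j w j x = 1],
        forall j, C j `<=` A,
        forall j x y, C j x -> C j y -> U x y &
        forall x, A x -> \sum_(j | ~~ `[< C j x >]) w j x <= eta].
Proof.
move=> e0; have [l [d [Hl d0 lU]]] := separating_tests.
pose h i := nth (fun=> 0 : R) l i.
have Hh i : H (h i).
  rewrite /h; have := fs_const HH 0; elim: l Hl i {lU h} => [|g l IH] Hl [|i] //= H0.
    by apply: Hl; left.
  by apply: IH => // k kl; apply: Hl; right.
pose s i x : R := 1 / 2 + 1 / 2 * sin (h i x).
have ts i : ridge_span cos H (s i).
  by apply: ridge_add; [exact: trig_cst|apply: ridge_scale; exact: trig_sin].
have s01 i x : 0 <= s i x <= 1.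
  by have := sin_le1 (h i x); have := sin_geN1 (h i x); rewrite /s => ? ?; lra.
have d40 : 0 < d / 4 by lra.
have [J [w [lab [tw w0 w1 wf]]]] := trig_partition HH (size l) ts s01 d40 e0.
exists J, w, (fun j => [set x | A x /\ forall i : 'I_(size l), `|lab j i - s i x| < d / 4]).
split=> //; first by move=> j x [].
  move=> j x y [Ax jx] [Ay jy]; apply: lU => // g.
  move=> gl; have [i il <-] : exists2 i, (i < size l)%N & h i = g.
    rewrite /h; elim: l gl {Hl h Hh s ts s01 w lab tw w0 w1 wf jx jy} => //= k l IH [->|/IH[i il <-]].
      by exists 0%N.
    by exists i.+1.
  have := jx (Ordinal il); have := jy (Ordinal il); rewrite /= /s => sy sx.
  have -> : sin (h i x) - sin (h i y) =
    2 * ((lab j i - (1 / 2 + 1 / 2 * sin (h i y))) - (lab j i - (1 / 2 + 1 / 2 * sin (h i x)))).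
    by field.
  rewrite normrM gtr0_norm//; have := ler_normB (lab j i - (1 / 2 + 1 / 2 * sin (h i y))) (lab j i - (1 / 2 + 1 / 2 * sin (h i x))).
  lra.
move=> x Ax; apply: le_trans (wf x); rewrite le_eqVlt; apply/orP; left; apply/eqP.
apply: eq_bigl => j; congr (~~ _); apply/asboolP/forallP => [[]//|]; split=> //.
Qed.

End SmallCells.

(** The Stone-Weierstrass theorem with a bound on the whole space: averages of
    values of [f] on [A] against a partition of unity never exceed [m]. *)
Lemma trig_approx {R : realType} {X : topologicalType} (H : set (X -> R))
    (A : set X) (f : X -> R) (m e : R) :
  feature_space H -> compact A ->
  (forall h, H h -> forall x, A x -> forall e : R, 0 < e ->
     \forall y \near x, A y -> `|h y - h x| < e) ->
  (forall x y, A x -> A y -> x <> y -> exists2 h, H h & h x <> h y) ->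
  continuous f -> 0 <= m -> (forall x, A x -> `|f x| <= m) -> 0 < e ->
  exists2 g, ridge_span cos H g &
    (forall x, `|g x| <= m) /\ (forall x, A x -> `|f x - g x| <= e).
Proof.
move=> HH cA Hc Hs cf m0 fm e0.
have e20 : 0 < e / 2 by rewrite divr_gt0.
have m1 : 0 < 2 * m + 1 by rewrite ltr_wpDl// mulr_ge0.
have eta0 : 0 < e / 2 / (2 * m + 1) by rewrite divr_gt0.
pose U x y := `|f x - f y| <= e / 2.
have Ud x : A x -> \forall y \near x & z \near x, A y -> A z -> U y z.
  move=> Ax; have e40 : 0 < e / 2 / 2 by rewrite divr_gt0.
  have /cvgrPdist_le/(_ _ e40) cx := cf x.
  exists ([set y | `|f x - f y| <= e / 2 / 2], [set y | `|f x - f y| <= e / 2 / 2]) => //=.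
  move=> [y z] /= [xy xz] _ _; rewrite /U; apply: (le_trans (ler_distD (f x) _ _)).
  by rewrite distrC [leRHS]splitr lerD.
have [J [w [C [[tw w0 w1] CA CU Cm]]]] := fuzzy_partition HH cA Hc Hs Ud eta0.
have : forall j, exists c, `|c| <= m /\ forall x, C j x -> `|f x - c| <= e / 2.
  move=> j; have [[x Cx]|nC] := pselect (exists x, C j x).
    by exists (f x); split; [exact/fm/(CA j)|move=> y Cy; exact: CU Cy Cx].
  by exists 0; rewrite normr0; split=> // x Cx; exfalso; apply: nC; exists x.
move=> /choice[c cP]; exists (fun x => \sum_j c j * w j x).
  by apply: ridge_sum => j; exact: ridge_scale.
split=> x.
  apply: (le_trans (ler_norm_sum _ _ _)); rewrite -[m]mulr1 -(w1 x) mulr_sumr.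
  apply: ler_sum => j _; rewrite normrM (ger0_norm (w0 _ _)) ler_wpM2r//.
  by have [] := cP j.
move=> Ax; rewrite -[f x]mulr1 -(w1 x) mulr_sumr -sumrB.
apply: (le_trans (ler_norm_sum _ _ _)).
apply: (@le_trans _ _ (\sum_j (e / 2 * w j x +
    2 * m * (if ~~ `[< C j x >] then w j x else 0)))).
  apply: ler_sum => j _; rewrite -mulrBl normrM (ger0_norm (w0 _ _)).
  have [cm cC] := cP j; case: asboolP => /= Cj.
    by rewrite mulr0 addr0 ler_wpM2r// cC.
  apply: (@le_trans _ _ (2 * m * w j x)); last by rewrite lerDr mulr_ge0// ltW.
  rewrite ler_wpM2r//; apply: (le_trans (ler_normB _ _)).
  by rewrite mulr_natl mulr2n lerD// fm.
rewrite big_split/= -!mulr_sumr w1 mulr1 -big_mkcond/= [leRHS]splitr lerD2l.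
apply: (le_trans (ler_wpM2l _ (Cm x Ax))); first by rewrite mulr_ge0.
rewrite mulrA ler_pdivrMr// mulrC ler_wpM2l ?(ltW e20)//.
by rewrite lerDl.
Qed.

(** * Averages of continuous functions *)

Section Averages.
Context {R : realType}.
Implicit Types (f P : R -> R) (a b : R).
Local Notation mu := (@lebesgue_measure R).

Lemma continuous_integrable f a b : continuous f ->
  mu.-integrable `[a, b] (EFin \o f).
Proof.
move=> cf; apply: continuous_compact_integrable; first exact: segment_compact.
exact: continuous_subspaceT.
Qed.

(** Below, averages are evaluated through antiderivatives, so that changes of
    variables reduce to the chain rule. *)
Lemma antiderivative_exists f a : continuous f ->
  exists P, forall x : R, a < x -> is_derive x 1 P (f x).
Proof.
move=> cf; exists (fun x => \int[mu]_(t in `[a, x]) f t)%R => x ax.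
have xx : x < x + 1 by rewrite ltrDl.
have [d e] := continuous_FTC1_closed xx (continuous_integrable _ _ cf) ax (cf x).
by apply: DeriveDef; [exact: d|rewrite -derive1E].
Qed.

Lemma antiderivative_MVT f P a b : a <= b ->
  (forall x : R, a <= x <= b -> is_derive x 1 P (f x)) ->
  exists2 c, a <= c <= b & P b - P a = f c * (b - a).
Proof.
move=> ab dP; have [||c cab ->] := @MVT_segment _ P f a b ab.
- by move=> x; rewrite in_itv/= => /andP[/ltW xa /ltW xb]; apply: dP; rewrite xa.
- apply: derivable_within_continuous => x; rewrite in_itv/= => xab.
  by case: (dP _ xab).
- by exists c => //; move: cab; rewrite in_itv.
Qed.

Lemma integral_antiderivative f P a b : a < b -> continuous f ->
  (forall x : R, a <= x <= b -> is_derive x 1 P (f x)) ->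
  (\int[mu]_(t in `[a, b]) f t)%R = P b - P a.
Proof.
move=> ab cf dP; rewrite /Rintegral (@continuous_FTC2 _ f P)//.
- exact: continuous_subspaceT.
- have cP x : a <= x <= b -> {for x, continuous P}.
    move=> /dP dx; apply: differentiable_continuous.
    by apply/derivable1_diffP; case: dx.
  split.
  + move=> x; rewrite in_itv/= => /andP[/ltW xa /ltW xb].
    by have := dP x; rewrite xa xb => /(_ isT)[].
  + by apply: cvg_at_right_filter; apply: cP; rewrite lexx ltW.
  + by apply: cvg_at_left_filter; apply: cP; rewrite lexx ltW.
- move=> x; rewrite in_itv/= => /andP[/ltW xa /ltW xb].
  by have := dP x; rewrite xa xb derive1E => /(_ isT)[].
Qed.

Definition avg f : R := (\int[mu]_(s in `[0, 1]) f s)%R.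

Lemma avgE f P : continuous f -> (forall x : R, 0 <= x <= 1 -> is_derive x 1 P (f x)) ->
  avg f = P 1 - P 0.
Proof. by move=> cf dP; exact: integral_antiderivative. Qed.

Lemma avg_mean f : continuous f -> exists2 s, 0 <= s <= 1 & avg f = f s.
Proof.
move=> cf; have [P dP] := antiderivative_exists (-1) cf.
have dP' (x : R) : 0 <= x <= 1 -> is_derive x 1 P (f x).
  by move=> /andP[x0 _]; apply: dP; lra.
have [s s01 E] := antiderivative_MVT ler01 dP'.
by exists s => //; rewrite (avgE cf dP') E subr0 mulr1.
Qed.

Lemma avg_le f (M : R) : continuous f -> (forall s, 0 <= s <= 1 -> `|f s| <= M) ->
  `|avg f| <= M.
Proof. by move=> /avg_mean[s s01 ->]; exact. Qed.

Lemma avgB f g : continuous f -> continuous g ->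
  avg (fun s => f s - g s) = avg f - avg g.
Proof.
by move=> cf cg; rewrite /avg RintegralB//; exact: continuous_integrable.
Qed.

(** The substitution [u = b + s x] in the average. *)
Lemma avg_line f P (b x : R) : continuous f ->
  (forall u : R, b - `|x| <= u <= b + `|x| -> is_derive u 1 P (f u)) ->
  x * avg (fun s => f (b + s * x)) = P (b + x) - P b.
Proof.
move=> cf dP; have [->|x0] := eqVneq x 0.
  by rewrite mul0r addr0 subrr.
have caff : continuous (fun s : R => b + s * x).
  by move=> s; apply: cvgD; [exact: cvg_cst|apply: cvgMl; exact: cvg_id].
have -> : avg (fun s => f (b + s * x)) =
    x^-1 * P (b + 1 * x) - x^-1 * P (b + 0 * x); last first.
  by rewrite mul1r mul0r addr0 -mulrBr mulrA mulfV// mul1r.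
apply: (@avgE _ (fun s => x^-1 * P (b + s * x))).
  by move=> s; apply: (@continuous_comp _ _ _ (fun s : R => b + s * x) f); [exact: caff|exact: cf].
move=> s /andP[s0 s1].
have du : is_derive (b + s * x) 1 P (f (b + s * x)).
  have : `|s * x| <= `|x| by rewrite normrM ger0_norm// ler_piMl.
  by rewrite ler_norml => /andP[? ?]; apply: dP; rewrite !lerD2l; apply/andP.
have da : is_derive s 1 (fun s : R => b + s * x) x.
  have := is_deriveD (is_derive_cst b s 1) (is_deriveM (is_derive_id s 1) (is_derive_cst x s 1)).
  by move=> /is_derive_eq; apply; rewrite scaler0 add0r add0r /GRing.scale /= mulr1.
have dc := @is_derive1_comp _ P (fun s : R => b + s * x) s _ _ du da.
have := is_deriveZ x^-1 dc; move=> /is_derive_eq; apply.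
by rewrite /GRing.scale/= mulrCA mulVf// mulr1.
Qed.

(** Riemann sums, with an error controlled by the oscillation at the scale of the
    grid only. *)
Lemma avg_riemann f n (e : R) : continuous f ->
  (forall s s', 0 <= s <= 1 -> 0 <= s' <= 1 -> `|s - s'| <= n.+1%:R^-1 ->
     `|f s - f s'| <= e) ->
  `|avg f - n.+1%:R^-1 * \sum_(i < n.+1) f (i%:R / n.+1%:R)| <= e.
Proof.
move=> cf osc; have [P dP] := antiderivative_exists (-1) cf.
have dP' (x : R) : 0 <= x -> is_derive x 1 P (f x) by move=> x0; apply: dP; lra.
have n0 : 0 < n.+1%:R^-1 :> R by rewrite invr_gt0.
have dP'' (x : R) : 0 <= x <= 1 -> is_derive x 1 P (f x).
  by move=> /andP[x0 _]; exact: dP'.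
rewrite (avgE cf dP'').
have -> : P 1 - P 0 = \sum_(i < n.+1) (P (i.+1%:R / n.+1%:R) - P (i%:R / n.+1%:R)).
  rewrite -(big_mkord xpredT (fun i => P (i.+1%:R / n.+1%:R) - P (i%:R / n.+1%:R))).
  rewrite telescope_sumr// divff ?pnatr_eq0// mul0r//.
rewrite mulr_sumr -sumrB.
have -> : e = \sum_(i < n.+1) n.+1%:R^-1 * e.
  by rewrite sumr_const card_ord -[RHS]mulr_natl mulrA divff ?pnatr_eq0// mul1r.
apply: (le_trans (ler_norm_sum _ _ _)); apply: ler_sum => i _.
have i0 : 0 <= i%:R / n.+1%:R :> R by rewrite divr_ge0.
have iS : i.+1%:R / n.+1%:R - i%:R / n.+1%:R = n.+1%:R^-1 :> R.
  by rewrite -mulrBl -natr1 addrAC subrr add0r mul1r.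
have i1 : i.+1%:R / n.+1%:R <= 1 :> R.
  by rewrite ler_pdivrMr// mul1r ler_nat.
have [||c /andP[ca cb] ->] := @antiderivative_MVT f P (i%:R / n.+1%:R) (i.+1%:R / n.+1%:R).
- by rewrite -subr_ge0 iS ltW.
- by move=> x /andP[ax _]; apply: dP'; exact: le_trans ax.
rewrite iS mulrC -mulrBr normrM gtr0_norm// ler_pM2l//.
move: i0 iS i1 n0 ca cb; set u := i%:R / _; set v := i.+1%:R / _; set m := _^-1.
move=> u0 vu v1 m0 uc cv; apply: osc; [apply/andP; split; lra|apply/andP; split; lra|].
by change (`|c - u| <= m); rewrite ger0_norm; lra.
Qed.

End Averages.

(** * Continuity and compactness *)

Lemma mul_frac_le {R : realType} (c e : R) : 0 <= c -> 0 <= e ->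
  c * (e / (c + 1)) <= e.
Proof.
move=> c0 e0; rewrite mulrA ler_pdivrMr ?ltr_wpDl// mulrC ler_wpM2l//.
by rewrite lerDl.
Qed.

Lemma lipschitz_continuous {R : realType} {V : normedModType R} (f : V -> R) (m : R) :
  0 <= m -> (forall x y, `|f x - f y| <= m * `|x - y|) -> continuous f.
Proof.
move=> m0 fm x; apply/cvgrPdist_le => e e0.
have m1 : 0 < m + 1 by rewrite ltr_wpDl.
apply/nbhs_ballP; exists (e / (m + 1)); first by rewrite /= divr_gt0.
move=> y; rewrite -ball_normE /= => /ltW xy; apply: (le_trans (fm _ _)).
by apply: le_trans (mul_frac_le m0 (ltW e0)); rewrite ler_wpM2l.
Qed.

Lemma compact_bound {R : realType} {V : topologicalType} (K : set V)
    (f : V -> R) : compact K -> continuous f ->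
  exists2 B, 0 <= B & forall x, K x -> `|f x| <= B.
Proof.
move=> cK cf; have : bounded_set (f @` K).
  by apply: compact_bounded; apply: continuous_compact => //; exact: continuous_subspaceT.
move=> [B [_ /(_ (B + 1))]]; rewrite ltrDl ltr01 => /(_ isT) BP.
exists `|B + 1| => // x Kx; apply: le_trans (ler_norm _).
by apply: BP; exists x.
Qed.

(** Heine's theorem, with one of the two points allowed outside of [K]. *)
Lemma compact_uniform {R : realType} {V : normedModType R} (K : set V)
    (f : V -> R) (e : R) : compact K -> continuous f -> 0 < e ->
  exists2 d, 0 < d & forall x y, K x -> `|x - y| <= d -> `|f x - f y| <= e.
Proof.
move=> /compact_near_coveringP ncK cf e0.
have : \forall d \near (0 : R)^'+, K `<=`
   (fun x => forall y, `|x - y| <= d -> `|f x - f y| <= e).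
  apply: ncK => x Kx.
  have e20 : 0 < e / 2 by rewrite divr_gt0.
  have /cvgrPdist_le/(_ _ e20)/nbhs_ballP[r /= r0 rP] := cf x.
  have r20 : 0 < r / 2 by rewrite divr_gt0.
  exists (ball x (r / 2), [set d | 0 < d < r / 2]) => /=.
    split; first exact: nbhsx_ballx.
    exists (r / 2) => //= d /=; rewrite sub0r normrN => + d0.
    by rewrite gtr0_norm// d0.
  move=> [z d] /= [xz /andP[d0 dr]] y zy.
  have fz : `|f x - f z| <= e / 2 by apply: rP; apply: le_ball xz; lra.
  have fy : `|f x - f y| <= e / 2.
    apply: rP; move: xz; rewrite -!ball_normE /= => xz.
    by apply: (le_lt_trans (ler_distD z _ _)); lra.
  by apply: (le_trans (ler_distD (f x) _ _)); rewrite (distrC (f z)); lra.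
move=> [r /= r0 rP].
exists (r / 2); first by rewrite divr_gt0.
move=> x y Kx; apply: (rP (r / 2)) => //; last by rewrite divr_gt0.
by rewrite /ball/= sub0r normrN gtr0_norm ?divr_gt0//; lra.
Qed.

(** * Weighted approximation by one-dimensional ridge functions *)

Section Weighted1D.
Context {R : realType}.
Variables (rho : R -> R) (p : R).
Hypothesis p1 : 1 < p.

Definition aff : set (R -> R) := [set f | exists a b, f = fun x => a * x + b].

Lemma aff_feature : feature_space aff.
Proof.
split.
- move=> _ _ [a [b ->]] [c [d ->]]; exists (a + c), (b + d).
  by apply/funext => x; ring.
- move=> k _ [a [b ->]]; exists (k * a), (k * b); apply/funext => x; ring.
- by move=> a; exists 0, a; apply/funext => x; ring.
Qed.

Definition wt (x : R) : R := (1 + `|x|) `^ p.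

Let p0 : 0 <= p. Proof. by rewrite ltW// (lt_trans _ p1). Qed.

Lemma wt_geD1 x : 1 + `|x| <= wt x.
Proof. by rewrite le1r_powR ?lerDl// ltW. Qed.

Lemma wt_ge1 x : 1 <= wt x.
Proof. by apply: le_trans (wt_geD1 x); rewrite lerDl. Qed.

Lemma wt_ge0 x : 0 <= wt x. Proof. exact: powR_ge0. Qed.

Lemma wt_le (K x y : R) : 0 <= K -> 1 + `|y| <= K * (1 + `|x|) ->
  wt y <= K `^ p * wt x.
Proof.
move=> K0 h; rewrite -powRM ?addr_ge0//.
by apply: ge0_ler_powR => //; rewrite nnegrE ?mulr_ge0 ?addr_ge0.
Qed.

(** The closure of the ridge functions for the weighted supremum norm. *)
Definition wdense (g : R -> R) := forall e, 0 < e ->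
  exists2 w, ridge_span rho aff w & forall x, `|g x - w x| <= e * wt x.

Lemma wdense_ridge w : ridge_span rho aff w -> wdense w.
Proof.
by move=> rw e e0; exists w => // x; rewrite subrr normr0 mulr_ge0 ?wt_ge0// ltW.
Qed.

Lemma wdense_lim g : (forall e, 0 < e -> exists2 g', wdense g' &
  forall x, `|g x - g' x| <= e * wt x) -> wdense g.
Proof.
move=> H e e0; have e20 : 0 < e / 2 by rewrite divr_gt0.
have [g' /(_ _ e20)[w rw g'w] gg'] := H _ e20.
exists w => // x; apply: (le_trans (ler_distD (g' x) _ _)).
by rewrite [e]splitr mulrDl lerD.
Qed.

Lemma wdense_add g1 g2 : wdense g1 -> wdense g2 -> wdense (fun x => g1 x + g2 x).
Proof.
move=> H1 H2 e e0; have e20 : 0 < e / 2 by rewrite divr_gt0.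
have [w1 r1 g1w] := H1 _ e20; have [w2 r2 g2w] := H2 _ e20.
exists (fun x => w1 x + w2 x); first exact: ridge_add.
move=> x; rewrite opprD addrACA [e]splitr mulrDl.
by apply: (le_trans (ler_normD _ _)); rewrite lerD.
Qed.

Lemma wdense_scale c g : wdense g -> wdense (fun x => c * g x).
Proof.
move=> H e e0; have c0 : 0 < 1 + `|c| by rewrite ltr_pwDl.
have e20 : 0 < e / (1 + `|c|) by rewrite divr_gt0.
have [w r gw] := H _ e20; exists (fun x => c * w x); first exact: ridge_scale.
move=> x; rewrite -mulrBr normrM.
apply: (le_trans (ler_wpM2l (normr_ge0 c) (gw x))); rewrite mulrA ler_wpM2r ?wt_ge0//.
by rewrite mulrC -mulrA ler_piMr ?(ltW e0)// ler_pdivrMl// mulr1 lerDr.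
Qed.

Lemma wdense_sum n (g : nat -> R -> R) : (forall i, wdense (g i)) ->
  wdense (fun x => \sum_(i < n) g i x).
Proof.
move=> H; elim: n => [|n IH].
  by under eq_fun do rewrite big_ord0; apply: wdense_ridge; exact: ridge_zero.
by under eq_fun do rewrite big_ord_recr/=; exact: wdense_add.
Qed.

Lemma wdense_affine a b g : wdense g -> wdense (fun x => g (a * x + b)).
Proof.
move=> H e e0; pose K := 1 + `|a| + `|b|.
have K0 : 0 < K by rewrite /K !ltr_wpDr.
have Kp : 0 < K `^ p by exact: powR_gt0.
have eK : 0 < e / K `^ p by rewrite divr_gt0.
have [w r gw] := H _ eK; exists (fun x => w (a * x + b)).
  elim: r {gw} => [|c h {}w [a' [b' ->]] _ IH]; first exact: ridge_zero.
  apply: (@ridge_step _ _ rho aff c (fun x => a' * (a * x + b) + b')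
     (fun x => w (a * x + b))) => //.
  by exists (a' * a), (a' * b + b'); apply/funext => x; ring.
move=> x; apply: (le_trans (gw _)); rewrite -mulrA ler_wpM2l ?(ltW e0)//.
rewrite ler_pdivrMl//; apply: wt_le; first exact: ltW.
have := ler_normD (a * x) b; rewrite normrM /K => h.
have := normr_ge0 a; have := normr_ge0 b; have := normr_ge0 x => x0 b0 a0.
by nra.
Qed.

(** A closed linear span contains averages: they are limits of Riemann sums. *)
Lemma wdense_avg (k : R -> R -> R) :
  (forall s, wdense (k s)) -> (forall x, continuous (k^~ x)) ->
  (forall e, 0 < e -> exists2 d, 0 < d & forall s s', 0 <= s <= 1 ->
     0 <= s' <= 1 -> `|s - s'| <= d -> forall x, `|k s x - k s' x| <= e * wt x) ->
  wdense (fun x => avg (k^~ x)).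
Proof.
move=> kV kc ke; apply: wdense_lim => e e0; have [d d0 dP] := ke e e0.
pose n := Num.truncn (d^-1).
have nd : n.+1%:R^-1 <= d.
  by rewrite -[d]invrK lef_pV2 ?posrE ?invr_gt0//; exact/ltW/truncnS_gt.
exists (fun x => n.+1%:R^-1 * \sum_(i < n.+1) k (i%:R / n.+1%:R) x).
  by apply: wdense_scale; apply: (@wdense_sum n.+1 (fun i => k (i%:R / n.+1%:R))) => i; exact: kV.
move=> x; apply: avg_riemann => // s s' s01 s01' ss.
by apply: dP => //; exact: le_trans ss nd.
Qed.

(** Functions of a pair (x, b) all of whose restrictions to lines [b + c * x] lie
    in the closed span, with the regularity that lets averages over lines stay
    there.  The growth condition with an arbitrarily small factor makes values at
    large [x] negligible against the weight. *)
Record tame (g : R -> R -> R) : Prop := Tame {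
  tame_uc : forall X e, 0 < e -> exists2 d, 0 < d & forall x x' b b',
    `|x| <= X -> `|x'| <= X -> `|b| <= X -> `|b'| <= X ->
    `|x - x'| <= d -> `|b - b'| <= d -> `|g x b - g x' b'| <= e;
  tame_growth : forall e, 0 < e -> exists2 C, 0 <= C &
    forall x b, `|g x b| <= e * wt (`|x| + `|b|) + C;
  tame_lines : forall b c, wdense (fun x => g x (b + c * x)) }.

Lemma tame_continuous g x : tame g -> continuous (g x).
Proof.
move=> [uc _ _] b; apply/cvgrPdist_le => e e0.
have [d d0 dP] := uc (`|x| + `|b| + 1) _ e0.
apply/nbhs_ballP; pose d' := Num.min d 1; exists d'; first by rewrite /= lt_min d0 ltr01.
move=> b'; rewrite /ball/= /d' lt_min => /andP[/ltW bd /ltW b1].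
apply: dP; rewrite ?subrr ?normr0 ?(ltW d0)//.
- by rewrite -addrA lerDl addr_ge0.
- by rewrite -addrA lerDl addr_ge0.
- by rewrite addrAC addrC lerDl addr_ge0.
- have -> : b' = b - (b - b') by ring.
  by apply: (le_trans (ler_normB _ _)); rewrite -[_ + 1]addrA -[leLHS]add0r lerD// lerD.
Qed.

Lemma wt_shift (A b x y : R) : 0 <= A -> `|y| <= A + `|b| + A * `|x| ->
  wt (`|x| + `|y|) <= (1 + A) `^ p * wt (`|x| + `|b|).
Proof.
move=> A0 yP; apply: wt_le; first by rewrite addr_ge0.
rewrite (ger0_norm (addr_ge0 (normr_ge0 x) (normr_ge0 y))).
rewrite (ger0_norm (addr_ge0 (normr_ge0 x) (normr_ge0 b))).
have := mulr_ge0 A0 (normr_ge0 b); lra.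
Qed.

(** For large [x] the growth condition is enough; for bounded [x] the lines
    stay in a bounded region, where the function is uniformly continuous. *)
Lemma tame_line_modulus g b c e : tame g -> 0 < e ->
  exists2 d, 0 < d & forall s s', 0 <= s <= 1 -> 0 <= s' <= 1 ->
    `|s - s'| <= d -> forall x,
    `|g x (b + (c + s) * x) - g x (b + (c + s') * x)| <= e * wt x.
Proof.
move=> [uc gr _] e0; pose A := 1 + `|b| + `|c|.
have A0 : 0 <= A by rewrite /A !addr_ge0.
have lineP s x : 0 <= s <= 1 -> `|b + (c + s) * x| <= A + `|0 : R| + A * `|x|.
  move=> /andP[s0 s1]; rewrite normr0 addr0.
  apply: (le_trans (ler_normD _ _)); apply: lerD.
    by rewrite /A addrAC lerDr addr_ge0.
  rewrite normrM ler_wpM2r//; apply: (le_trans (ler_normD _ _)).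
  by rewrite (ger0_norm s0) /A; have := normr_ge0 b; lra.
have Kp : 0 < (1 + A) `^ p by rewrite powR_gt0// ltr_pwDl.
have e1 : 0 < e / 4 / (1 + A) `^ p by rewrite !divr_gt0.
have [C C0 gC] := gr _ e1.
have gB s x : 0 <= s <= 1 -> `|g x (b + (c + s) * x)| <= e / 4 * wt x + C.
  move=> s01; apply: (le_trans (gC _ _)); rewrite lerD2r.
  rewrite -mulrA ler_wpM2l ?divr_ge0 ?(ltW e0)//.
  rewrite ler_pdivrMl//; have := wt_shift A0 (lineP s x s01).
  rewrite normr0 addr0 => /le_trans; apply.
  by rewrite /wt normr_id.
pose X := 4 * C / e.
have X0 : 0 <= X by rewrite /X divr_ge0 ?mulr_ge0 ?(ltW e0)//.
pose X' := (1 + A) * (1 + X).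
have [d0 d00 dP] := uc X' _ e0.
exists (d0 / (1 + X)); first by rewrite divr_gt0// ltr_pwDl.
move=> s s' s01 s01' ss x; have [xX|/ltW xX] := leP `|x| X.
  have x1 : `|x| <= X' by rewrite /X'; have := mulr_ge0 A0 X0; lra.
  have lX s1 : 0 <= s1 <= 1 -> `|b + (c + s1) * x| <= X'.
    move=> s1P; apply: (le_trans (lineP _ x s1P)).
    by rewrite normr0 addr0 /X' -[X in X + _]mulr1 -mulrDr ler_pM ?addr_ge0// ?lerDr// lerD2l.
  apply: (@le_trans _ _ e); last by rewrite ler_peMr ?wt_ge1// ltW.
  apply: dP => //; rewrite ?subrr ?normr0 ?(ltW d00) ?lX//.
  have -> : b + (c + s) * x - (b + (c + s') * x) = (s - s') * x by ring.
  rewrite normrM; move: ss; rewrite ler_pdivlMr ?ltr_pwDl// => ss.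
  apply: le_trans ss; rewrite ler_wpM2l//.
  by rewrite (le_trans xX)// lerDr.
have CW : C <= e / 4 * wt x.
  have : e / 4 * X <= e / 4 * wt x.
    rewrite ler_wpM2l ?divr_ge0 ?(ltW e0)//; apply: (le_trans xX).
    by apply: le_trans (wt_geD1 x); rewrite lerDr.
  apply: le_trans; rewrite /X le_eqVlt; apply/orP; left; apply/eqP; field.
  exact: lt0r_neq0.
apply: (le_trans (ler_normB _ _)).
have := gB _ x s01; have := gB _ x s01'; lra.
Qed.

(** A difference in [b], averaged over shears [b |-> b + s * x].  At [x = 0] it
    is the plain difference, while for large [x] the average is an integral over
    a long segment, so that the difference leaves only the two ends. *)
Definition sheared_diff (tau : R) (g : R -> R -> R) (x b : R) : R :=
  avg (fun s => g x (b + tau + s * x) - g x (b + s * x)).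

Lemma continuous_line (f : R -> R) (b x : R) : continuous f ->
  continuous (fun s : R => f (b + s * x)).
Proof.
move=> cf s; apply: (@continuous_comp _ _ _ (fun s : R => b + s * x) f); last exact: cf.
by apply: cvgD; [exact: cvg_cst|apply: cvgMl; exact: cvg_id].
Qed.

Lemma tame_sheared_diff tau g : tame g -> tame (sheared_diff tau g).
Proof.
move=> tg; have cg x b : continuous (fun s : R => g x (b + s * x)).
  exact/continuous_line/tame_continuous.
have cd x b : continuous (fun s : R => g x (b + tau + s * x) - g x (b + s * x)).
  by move=> s; apply: cvgB; exact: cg.
split.
- move=> X e e0; have e20 : 0 < e / 2 by rewrite divr_gt0.
  have [d d0 dP] := tame_uc tg (X + X + `|tau|) e20.
  exists (d / 2); first by rewrite divr_gt0.
  move=> x x' b b' xX xX' bX bX' xx bb.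
  rewrite /sheared_diff -avgB//; apply: avg_le.
    by move=> s; apply: cvgB; exact: cd.
  move=> s /andP[s0 s1].
  have sx : `|s * x| <= `|x| by rewrite normrM ger0_norm// ler_piMl.
  have sx' : `|s * x'| <= `|x'| by rewrite normrM ger0_norm// ler_piMl.
  have sxx : `|s * x - s * x'| <= d / 2.
    by rewrite -mulrBr normrM ger0_norm//; apply: le_trans xx; rewrite ler_piMl.
  have t0 := normr_ge0 tau.
  have bs : `|b + s * x - (b' + s * x')| <= d.
    rewrite opprD addrACA; apply: (le_trans (ler_normD _ _)); lra.
  have xX0 : 0 <= X by exact: le_trans xX.
  have D1 : `|g x (b + tau + s * x) - g x' (b' + tau + s * x')| <= e / 2.
    apply: dP; try lra.
    + by apply: (le_trans (ler_normD _ _)); have := ler_normD b tau; lra.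
    + by apply: (le_trans (ler_normD _ _)); have := ler_normD b' tau; lra.
    + by rewrite (_ : _ - _ = b + s * x - (b' + s * x'))//; ring.
  have D2 : `|g x (b + s * x) - g x' (b' + s * x')| <= e / 2.
    apply: dP; try lra.
    + by apply: (le_trans (ler_normD _ _)); lra.
    + by apply: (le_trans (ler_normD _ _)); lra.
  rewrite (_ : _ + _ = (g x (b + tau + s * x) - g x' (b' + tau + s * x')) -
     (g x (b + s * x) - g x' (b' + s * x'))); last by ring.
  by apply: (le_trans (ler_normB _ _)); lra.
- move=> e e0; pose A := 1 + `|tau|.
  have A0 : 0 <= A by rewrite /A addr_ge0.
  have Kp : 0 < (1 + A) `^ p by rewrite powR_gt0// ltr_pwDl.
  have e1 : 0 < e / 2 / (1 + A) `^ p by rewrite !divr_gt0.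
  have [C C0 gC] := tame_growth tg e1.
  exists (2 * C); first by rewrite mulr_ge0.
  move=> x b; apply: avg_le => // s /andP[s0 s1].
  have sx : `|s * x| <= `|x| by rewrite normrM ger0_norm// ler_piMl.
  have B y : `|y| <= A + `|b| + A * `|x| ->
      `|g x y| <= e / 2 * wt (`|x| + `|b|) + C.
    move=> yP; apply: (le_trans (gC _ _)); rewrite lerD2r.
    rewrite -mulrA ler_wpM2l ?divr_ge0 ?(ltW e0)//.
    by rewrite ler_pdivrMl//; exact: wt_shift.
  have t0 := normr_ge0 tau; have x0 := normr_ge0 x; have b0 := normr_ge0 b.
  have B1 : `|g x (b + tau + s * x)| <= e / 2 * wt (`|x| + `|b|) + C.
    apply: B; apply: (le_trans (ler_normD _ _)); have := ler_normD b tau.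
    by rewrite /A; nra.
  have B2 : `|g x (b + s * x)| <= e / 2 * wt (`|x| + `|b|) + C.
    by apply: B; apply: (le_trans (ler_normD _ _)); rewrite /A; nra.
  by apply: (le_trans (ler_normB _ _)); lra.
- move=> b c; apply: (@wdense_avg (fun s x => g x (b + c * x + tau + s * x) - g x (b + c * x + s * x))).
  + move=> s.
    have -> : (fun x => g x (b + c * x + tau + s * x) - g x (b + c * x + s * x)) =
       (fun x => g x ((b + tau) + (c + s) * x) + -1 * g x (b + (c + s) * x)).
      by apply/funext => x; rewrite mulN1r; congr (g x _ - g x _); ring.
    by apply: wdense_add; [|apply: wdense_scale]; exact: tame_lines.
  + by move=> x; exact: cd.
  move=> e e0; have e20 : 0 < e / 2 by rewrite divr_gt0.
  have [d1 d10 P1] := tame_line_modulus (b + tau) c tg e20.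
  have [d2 d20 P2] := tame_line_modulus b c tg e20.
  exists (Num.min d1 d2); first by rewrite lt_min d10.
  move=> s s' s01 s01'; rewrite le_min => /andP[sd1 sd2] x.
  have := P1 _ _ s01 s01' sd1 x; have := P2 _ _ s01 s01' sd2 x.
  have E s1 : b + c * x + tau + s1 * x = (b + tau) + (c + s1) * x by ring.
  have E' s1 : b + c * x + s1 * x = b + (c + s1) * x by ring.
  rewrite !E !E'.
  set u1 := g x _; set u2 := g x _; set u3 := g x _; set u4 := g x _ => h1 h2.
  rewrite (_ : _ - _ = (u3 - u4) - (u1 - u2)); last by ring.
  by apply: (le_trans (ler_normB _ _)); lra.
Qed.

End Weighted1D.

Section Decay.
Context {R : realType}.
Variables (rho : R -> R) (p : R).
Hypothesis p1 : 1 < p.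
Local Notation tame := (tame rho p).
Local Notation wt := (wt p).
(** Multiplied by [x], the average is the integral of a difference, which
    telescopes to two integrals over intervals of length [|tau|]: one factor
    [1 / |x|] is gained. *)
Lemma sheared_diff_decay tau g n C : tame g -> 0 <= C ->
  (forall x b, `|g x b| * Num.max 1 `|x| ^+ n <= C * wt (`|x| + `|b|)) ->
  exists2 C', 0 <= C' & forall x b,
    `|sheared_diff tau g x b| * Num.max 1 `|x| ^+ n.+1 <= C' * wt (`|x| + `|b|).
Proof.
move=> tg C0 gC; pose A := 1 + `|tau|.
have A0 : 0 <= A by rewrite /A addr_ge0.
have t0 := normr_ge0 tau.
have [D D0 DE] : exists2 D, 0 <= D & D = (1 + A) `^ p * C.
  by eexists; last by []; rewrite mulr_ge0// powR_ge0.
exists (2 * A * D); first by apply: mulr_ge0 => //; apply: mulr_ge0.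
move=> x b; set m := Num.max 1 `|x|; set W := wt _.
have W0 : 0 <= W by exact: (wt_ge0 p).
have m1 : 1 <= m by rewrite /m le_max lexx.
have m0 : 0 < m ^+ n by rewrite exprn_gt0// (lt_le_trans ltr01).
have B y : `|y| <= A + `|b| + A * `|x| -> `|g x y| <= D * W / m ^+ n.
  move=> yP; rewrite ler_pdivlMr//; apply: (le_trans (gC _ _)).
  by rewrite DE [_ * C]mulrC -mulrA ler_wpM2l//; exact: (wt_shift p1).
have DW0 : 0 <= D * W / m ^+ n by apply: divr_ge0; [exact: mulr_ge0|exact: ltW].
have x0 := normr_ge0 x; have b0 := normr_ge0 b.
have cg c : continuous (fun s : R => g x (c + s * x)).
  exact/continuous_line/(tame_continuous tg).
have H1 : `|sheared_diff tau g x b| <= 2 * (D * W / m ^+ n).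
  apply: avg_le => [s|s /andP[s0 s1]].
    by apply: cvgB; exact: cg.
  have sx : `|s * x| <= `|x| by rewrite normrM ger0_norm// ler_piMl.
  apply: (le_trans (ler_normB _ _)); rewrite mulr_natl mulr2n lerD//; apply: B.
    by apply: (le_trans (ler_normD _ _)); have := ler_normD b tau; rewrite /A; nra.
  by apply: (le_trans (ler_normD _ _)); rewrite /A; nra.
have H2 : `|x| * `|sheared_diff tau g x b| <= 2 * `|tau| * (D * W / m ^+ n).
  rewrite -normrM /sheared_diff avgB//.
  have [P dP] := antiderivative_exists (- (`|b| + `|x| + `|tau| + 1)) (@tame_continuous _ _ _ g x tg).
  have dP' (u : R) : - (`|b| + `|x| + `|tau|) <= u -> is_derive u 1 P (g x u).
    by move=> hu; apply: dP; lra.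
  have tn := ler_norm (- tau); have tp := ler_norm tau; rewrite normrN in tn.
  have bn := ler_norm (- b); have bp := ler_norm b; rewrite normrN in bn.
  have xn := ler_norm (- x); have xp := ler_norm x; rewrite normrN in xn.
  have L c : `|c| <= `|b| + `|tau| ->
      x * avg (fun s => g x (c + s * x)) = P (c + x) - P c.
    move=> cb; apply: avg_line; first exact: (tame_continuous tg).
    move=> u /andP[hu _]; apply: dP'; move: cb; rewrite ler_norml => /andP[? ?].
    lra.
  rewrite mulrBr L ?ler_normD// L ?lerDl//.
  have AP u : `|u| <= `|b| + `|x| + `|tau| -> `|u| <= A + `|b| + A * `|x|.
    by move/le_trans; apply; rewrite /A; have := mulr_ge0 t0 x0; lra.
  have Q c : `|c| <= `|b| + `|x| -> `|P (c + tau) - P c| <= `|tau| * (D * W / m ^+ n).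
    move=> cb; have cn := ler_norm (- c); have cp := ler_norm c; rewrite normrN in cn.
    have [t00|t00] := leP 0 tau.
      have [||u /andP[u1 u2] ->] := @antiderivative_MVT _ (g x) P c (c + tau).
      + by rewrite lerDl.
      + by move=> u /andP[hu _]; apply: dP'; lra.
      rewrite normrM [c + tau - c]addrC addKr mulrC ler_wpM2l//; apply: B.
      by apply: AP; rewrite ler_norml; apply/andP; split; lra.
    have [||u /andP[u1 u2] E] := @antiderivative_MVT _ (g x) P (c + tau) c.
    + by rewrite gerDl ltW.
    + move=> u /andP[hu _]; apply: dP'; lra.
    rewrite distrC E normrM (_ : c - _ = - tau); last by ring.
    rewrite normrN mulrC ler_wpM2l//; apply: B.
    by apply: AP; rewrite ler_norml; apply/andP; split; lra.
  rewrite (_ : _ - _ - _ = (P (b + x + tau) - P (b + x)) - (P (b + tau) - P b)); last first.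
    rewrite (_ : b + tau + x = b + x + tau); ring.
  apply: (le_trans (ler_normB _ _)).
  have := Q (b + x) (ler_normD _ _); have := Q b; rewrite lerDl => /(_ x0).
  lra.
rewrite exprS mulrA -ler_pdivlMr//.
rewrite (_ : 2 * A * D * W / m ^+ n = 2 * A * (D * W / m ^+ n)); last by rewrite !mulrA.
have tQ := mulr_ge0 t0 DW0.
have [x1|/ltW x1] := leP 1 `|x|.
  have mE : m = `|x| by rewrite /m max_r.
  by rewrite [X in _ * X]mE mulrC; apply: (le_trans H2); rewrite /A; lra.
have mE : m = 1 by rewrite /m max_l.
by rewrite [X in _ * X]mE mulr1; apply: (le_trans H1); rewrite /A; lra.
Qed.
End Decay.

(** * Vanishing finite differences *)

Section Frechet.
Context {R : realType}.
Implicit Types (f : R -> R) (tau b : R).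

Definition fdiff tau f b := f (b + tau) - f b.

(** Newton's forward difference formula. *)
Lemma fdiff_newton tau f b (N : nat) (k : nat) : (k < N)%N ->
  f (b + k%:R * tau) = \sum_(i < N) 'C(k, i)%:R * iter i (fdiff tau) f b.
Proof.
elim: k f N => [|k IH] f N kN.
  case: N kN => // N _; rewrite mul0r addr0 big_ord_recl big1 ?addr0 ?bin0 ?mul1r//.
  by move=> i _; rewrite bin0n mul0r.
case: N kN => // N kN.
have -> : b + k.+1%:R * tau = (b + k%:R * tau) + tau by rewrite -natr1; ring.
rewrite -[f _](subrK (f (b + k%:R * tau))) -/(fdiff tau f (b + k%:R * tau)).
rewrite (IH (fdiff tau f) N)// (IH f N.+1)//; last exact: ltnW.
rewrite !big_ord_recl !bin0 /= addrCA; congr (_ + _).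
rewrite -big_split/=; apply: eq_bigr => i _.
have -> : iter i (fdiff tau) (fdiff tau f) b = iter i.+1 (fdiff tau) f b.
  by rewrite iterSr.
by rewrite /bump/= add1n binS natrD mulrDl addrC.
Qed.

Lemma bin_poly (i : nat) : exists q : {poly R}, forall k : nat, q.[k%:R] = 'C(k, i)%:R.
Proof.
elim: i => [|i [q qP]].
  by exists 1 => k; rewrite hornerC bin0.
exists (i.+1%:R^-1 *: (q * ('X - i%:R%:P))) => k.
rewrite hornerZ hornerM qP hornerXsubC.
have i0 : i.+1%:R != 0 :> R by rewrite pnatr_eq0.
apply: (mulfI i0); rewrite mulrA mulfV// mul1r -natrM mul_bin_left natrM mulrC.
have [ik|ki] := leqP i k; first by rewrite natrB.
by rewrite bin_small// !mulr0.
Qed.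

Lemma fdiff0_grid tau f b N : (forall c, iter N (fdiff tau) f c = 0) ->
  exists q : {poly R}, forall k : nat, f (b + k%:R * tau) = q.[k%:R].
Proof.
move=> f0; have [beta betaP] := choice bin_poly.
exists (\sum_(i < N) iter i (fdiff tau) f b *: beta i) => k.
rewrite (@fdiff_newton tau f b (k.+1 + N)); last by rewrite ltn_addr.
rewrite horner_sum addnC big_split_ord/= [X in _ + X]big1 ?addr0.
  by apply: eq_bigr => i _; rewrite hornerZ betaP mulrC.
move=> i _; suff -> : iter (N + i) (fdiff tau) f b = 0 by rewrite mulr0.
rewrite addnC iterD; elim: (nat_of_ord i) b => [|j IH] c /=; first exact: f0.
by rewrite {1}/fdiff !IH subrr.
Qed.

Lemma poly_eq_nat (p q : {poly R}) : (forall k : nat, p.[k%:R] = q.[k%:R]) -> p = q.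
Proof.
move=> pq; apply/eqP; rewrite -subr_eq0; apply/negPn/negP => d0.
have := @max_poly_roots _ (p - q) [seq (k%:R : R) | k <- iota 0 (size (p - q))] d0.
rewrite size_map size_iota ltnn => roots; suff : false by []; apply: roots.
  by apply/allP => _ /mapP[k _ ->]; rewrite rootE !hornerE pq subrr.
by rewrite map_inj_uniq ?iota_uniq// => i j /eqP; rewrite eqr_nat => /eqP.
Qed.

(** Frechet's theorem.  Newton's formula gives a polynomial on each rational
    grid.  These polynomials agree on the natural numbers, so they are all the
    same, and the grids are dense. *)
Lemma fdiff0_poly f N : continuous f ->
  (forall tau b, iter N (fdiff tau) f b = 0) ->
  exists q : {poly R}, forall x, f x = q.[x].
Proof.
move=> cf f0; have [q qP] := fdiff0_grid 0 (f0 1).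
exists q => x; have fq (k : nat) : f k%:R = q.[k%:R].
  by have := qP k; rewrite add0r mulr1.
have grid (B m k : nat) : f (- B%:R + k%:R * m.+1%:R^-1) = q.[- B%:R + k%:R * m.+1%:R^-1].
  have [q1 q1P] := fdiff0_grid (- B%:R) (f0 m.+1%:R^-1).
  have m0 : m.+1%:R != 0 :> R by rewrite pnatr_eq0.
  have -> : q = q1 \Po (m.+1%:R *: ('X + B%:R%:P)).
    apply: poly_eq_nat => j; rewrite horner_comp !hornerE -fq.
    rewrite -natrD -natrM -q1P natrM mulrAC mulfV// mul1r natrD.
    by congr f; ring.
  rewrite q1P horner_comp !hornerE; congr (_.[_]).
  by rewrite addrAC addNr add0r mulrCA mulfV// mulr1.
apply/eqP; rewrite -subr_eq0 -normr_le0; apply/ler_addgt0Pr => e e0; rewrite add0r.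
have cg : continuous (fun x => f x - q.[x]).
  by move=> y; apply: cvgB; [exact: cf|exact: continuous_horner].
have /cvgrPdist_le/(_ _ e0)/nbhs_ballP[r /= r0 rP] := cg x.
pose m := Num.truncn (r^-1); pose B := Num.truncn `|x|.
pose k := Num.truncn ((x + B.+1%:R) * m.+1%:R).
pose y : R := - B.+1%:R + k%:R * m.+1%:R^-1.
have m0 : 0 < m.+1%:R :> R by rewrite ltr0n.
have xB : 0 <= x + B.+1%:R.
  have := ler_norm (- x); rewrite normrN; have := truncnS_gt `|x|.
  by rewrite -/B; lra.
have /andP[k1 k2] := truncn_itv (mulr_ge0 xB (ltW m0)).
have y1 : y <= x by rewrite /y addrC lerBlDr ler_pdivrMr.
have y2 : x - y < r.
  have mr : m.+1%:R^-1 < r.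
    by rewrite -[r]invrK ltf_pV2 ?posrE ?invr_gt0//; exact: truncnS_gt.
  apply: lt_trans mr; rewrite /y opprD opprK addrA.
  rewrite -(ltr_pM2r m0) mulrBl mulfVK ?gt_eqF// mulVf ?gt_eqF//.
  by move: k2; rewrite -[X in _ < X -> _]natr1 -/k; lra.
have := rP y; rewrite /ball/= ger0_norm ?subr_ge0// => /(_ y2).
by rewrite /y grid subrr subr0.
Qed.

End Frechet.

(** * A rapidly decaying function in the closed ridge span *)

Section DecayingRidge.
Context {R : realType}.
Variables (rho : R -> R) (p : R).
Hypothesis p1 : 1 < p.
Hypothesis crho : continuous rho.
Hypothesis grho : forall e, 0 < e -> exists2 C, 0 <= C &
  forall x, `|rho x| <= e * wt p x + C.
Hypothesis nprho : ~ exists q : {poly R}, forall x, rho x = q.[x].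

(** The starting point is the activation as a function of [b] alone. *)
Lemma tame_activation : tame rho p (fun _ b => rho b).
Proof.
split.
- move=> X e e0.
  have [d d0 dP] := compact_uniform (@segment_compact R (- X) X) crho e0.
  exists d => // x x' b b' _ _ bX _ _ bb; apply: dP => //=.
  by rewrite in_itv/= -ler_norml.
- move=> e e0; have [C C0 CP] := grho e0; exists C => // x b.
  apply: (le_trans (CP b)); rewrite lerD2r ler_wpM2l ?(ltW e0)//.
  rewrite -[leRHS]mul1r -(congr1 (@^~ p) (@powR1 R)); apply: wt_le => //.
  by rewrite mul1r lerD2l (ger0_norm (addr_ge0 (normr_ge0 x) (normr_ge0 b))) lerDr.
- move=> b c; apply: wdense_ridge; apply: ridge_gen.
  by exists c, b; apply/funext => x; rewrite addrC.
Qed.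

Let u tau N := iter N (sheared_diff tau) (fun _ b => rho b).

Let tame_u tau N : tame rho p (u tau N).
Proof. by elim: N => [|N IH]; [exact: tame_activation|exact: tame_sheared_diff]. Qed.

Let u_decay tau N : exists2 C, 0 <= C & forall x b,
  `|u tau N x b| * Num.max 1 `|x| ^+ N <= C * wt p (`|x| + `|b|).
Proof.
elim: N => [|N [C C0 IH]]; last exact: sheared_diff_decay IH.
have [C C0 CP] := tame_growth tame_activation ltr01.
exists (1 + C); first by rewrite addr_ge0.
move=> x b; rewrite expr0 mulr1 mulrDl; apply: (le_trans (CP x b)).
by rewrite lerD2l ler_peMr// wt_ge1.
Qed.

(** On the axis [x = 0] the shears are trivial. *)
Let u_at0 tau N b : u tau N 0 b = iter N (fdiff tau) rho b.
Proof.
elim: N b => [//|N IH] b; rewrite iterS {1}/fdiff -!IH.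
rewrite /u iterS -/(u tau N) /sheared_diff.
under eq_fun do rewrite mulr0 !addr0.
by have [s _ ->] := avg_mean (@cst_continuous R R (u tau N 0 (b + tau) - u tau N 0 b)).
Qed.

(** Apply [sheared_diff] more than [p + 4] times: the growth of order [p] is
    consumed, and four powers of decay remain.  At [x = 0] the result is an
    iterated difference of [rho], which is nonzero for some step and point
    because [rho] is not a polynomial. *)
Lemma decaying_ridge_limit : exists (G : R -> R) (C : R),
  [/\ wdense rho p G, continuous G, G 0 != 0, 0 <= C &
      forall x, `|G x| <= C * ((1 + x ^+ 2)^-1) ^+ 2].
Proof.
pose K := (Num.truncn p).+1; pose N := (K + 4)%N.
have [[tau [b ub]]|n0] := pselect (exists tau b, iter N (fdiff tau) rho b != 0);
    last first.
  exfalso; apply: nprho; apply: (fdiff0_poly (N := N)) => // tau b.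
  by apply: contrapT => /eqP ub; apply: n0; exists tau, b.
have [C C0 uC] := u_decay tau N.
exists (fun x => u tau N x b), (4 * (C * ((2 * (1 + `|b|)) `^ p))).
have cu : continuous (fun x => u tau N x b).
  move=> x; apply/cvgrPdist_le => e e0.
  have [d d0 dP] := tame_uc (tame_u tau N) (`|x| + `|b| + 1) e0.
  apply/nbhs_ballP; exists (Num.min d 1); first by rewrite /= lt_min d0 ltr01.
  move=> x'; rewrite /ball/= lt_min => /andP[/ltW xd /ltW x1].
  apply: dP; rewrite ?subrr ?normr0 ?(ltW d0)//.
  - by rewrite -addrA lerDl addr_ge0.
  - have -> : x' = x - (x - x') by ring.
    apply: (le_trans (ler_normB _ _)); rewrite -[leRHS]addrA lerD2l.
    by apply: (le_trans x1); rewrite lerDr.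
  - by rewrite addrAC lerDr addr_ge0.
  - by rewrite addrAC lerDr addr_ge0.
split => //.
- have := tame_lines (tame_u tau N) b 0.
  by under eq_fun do rewrite mul0r addr0.
- by rewrite u_at0.
- by rewrite !mulr_ge0 ?powR_ge0.
move=> x; set m := Num.max 1 `|x|.
have m1 : 1 <= m by rewrite /m le_max lexx.
have xm : `|x| <= m by rewrite /m le_max lexx orbT.
have m0 : 0 < m by rewrite (lt_le_trans ltr01).
have q0 : 0 < 1 + x ^+ 2 by rewrite ltr_pwDl// sqr_ge0.
rewrite exprVn ler_pdivlMr ?exprn_gt0// [leLHS]mulrC.
have H1 : (1 + x ^+ 2) ^+ 2 <= 4 * m ^+ 4.
  have : 1 + x ^+ 2 <= 2 * m ^+ 2.
    have : x ^+ 2 <= m ^+ 2 by rewrite -real_normK ?num_real// ler_pXn2r ?nnegrE// ltW.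
    have : 1 <= m ^+ 2 by rewrite exprn_ege1.
    lra.
  move=> H; apply: (@le_trans _ _ ((2 * m ^+ 2) ^+ 2)).
    by rewrite ler_pXn2r ?nnegrE ?(ltW q0)// mulr_ge0 ?exprn_ge0// ltW.
  by rewrite exprMn -exprM -natrX.
have H2 : wt p (`|x| + `|b|) <= (2 * (1 + `|b|)) `^ p * m ^+ K.
  rewrite -powR_mulrn ?(ltW m0)//.
  apply: (@le_trans _ _ ((2 * (1 + `|b|)) `^ p * m `^ p)); last first.
    rewrite ler_wpM2l ?powR_ge0// ler_powR//.
    exact/ltW/truncnS_gt.
  rewrite -powRM ?(ltW m0) ?mulr_ge0 ?addr_ge0//.
  apply: ge0_ler_powR; rewrite ?nnegrE ?mulr_ge0 ?addr_ge0 ?(ltW m0) ?(ltW (lt_trans ltr01 p1))//.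
  rewrite (ger0_norm (addr_ge0 (normr_ge0 x) (normr_ge0 b))).
  have := mulr_ge0 (normr_ge0 b) (ltW m0).
  have : `|b| <= `|b| * m by rewrite ler_peMr.
  lra.
have H3 : `|u tau N x b| * m ^+ 4 <= C * (2 * (1 + `|b|)) `^ p.
  rewrite -(ler_pM2r (exprn_gt0 K m0)) -mulrA -exprD addnC -mulrA.
  by apply: (le_trans (uC x b)); rewrite ler_wpM2l.
apply: (@le_trans _ _ (4 * m ^+ 4 * `|u tau N x b|)); first by rewrite ler_wpM2r.
by rewrite -mulrA ler_pM2l// mulrC.
Qed.

End DecayingRidge.

(** * Integrals over the line against rapidly decaying functions *)

Section LineIntegrals.
Context {R : realType}.
Local Notation mu := (@lebesgue_measure R).

(** An integrable weight, multiples of which dominate all integrands below. *)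
Definition cauchy_weight (x : R) : R := (1 + x ^+ 2)^-1.
Local Notation q := cauchy_weight.

Definition line_int (f : R -> R) : R := (\int[mu]_x f x)%R.

Lemma cauchy_weight_gt0 x : 0 < q x.
Proof. by rewrite invr_gt0 ltr_pwDl// sqr_ge0. Qed.

Lemma cauchy_weight_le1 x : q x <= 1.
Proof. by rewrite invf_le1 ?lerDl ?sqr_ge0// ltr_pwDl// sqr_ge0. Qed.

Lemma cauchy_weight_ge0 x : 0 <= q x. Proof. exact/ltW/cauchy_weight_gt0. Qed.

Lemma cauchy_square_le (G : R -> R) (C : R) : 0 <= C ->
  (forall x, `|G x| <= C * q x ^+ 2) -> forall x, `|G x| <= C * q x.
Proof.
move=> C0 GC x; apply: (le_trans (GC x)); rewrite expr2 ler_wpM2l//.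
by rewrite ler_piMr ?cauchy_weight_le1 ?cauchy_weight_ge0.
Qed.

Lemma cauchy_square_bounded (G : R -> R) (C : R) : 0 <= C ->
  (forall x, `|G x| <= C * q x ^+ 2) -> forall x, `|G x| <= C.
Proof.
move=> C0 GC x; apply: (le_trans (cauchy_square_le C0 GC x)).
by rewrite ler_piMr ?cauchy_weight_le1.
Qed.

Lemma integrable_cauchy_weight : mu.-integrable setT (EFin \o q).
Proof.
have cq : continuous q by exact: continuous_oneDsqrV.
apply/integrableP; split.
  by apply/measurable_EFinP; exact: continuous_measurable_fun.
under eq_integral do rewrite /= ger0_norm ?(ltW (cauchy_weight_gt0 _))//.
rewrite ge0_symfun_integralT//; last first.
- by move=> x; rewrite /= /q sqrrN.
- by move=> x; rewrite ltW// cauchy_weight_gt0.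
have := integral0y_oneDsqr R; rewrite set_itvcy => ->.
by rewrite -EFinM ltry.
Qed.

Lemma integrable_dominated (f : R -> R) (K : R) : continuous f ->
  (forall x, `|f x| <= K * q x) -> mu.-integrable setT (EFin \o f).
Proof.
move=> cf fq; have Ki := integrableZl measurableT K integrable_cauchy_weight.
apply: (le_integrable measurableT _ _ Ki).
  by apply/measurable_EFinP; exact: continuous_measurable_fun.
move=> x _; rewrite -EFinM !abse_EFin lee_fin; apply: (le_trans (fq x)).
exact: ler_norm.
Qed.

Lemma line_int_bound (f : R -> R) (K : R) : mu.-integrable setT (EFin \o f) ->
  (forall x, `|f x| <= K * q x) -> `|line_int f| <= K * line_int q.
Proof.
move=> fi fq; apply: (le_trans (le_normr_Rintegral measurableT fi)).
rewrite -RintegralZl//; last exact: integrable_cauchy_weight.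
apply: le_Rintegral => //.
- by have := integrable_norm fi; apply: eq_integrable.
- by have := integrableZl measurableT K integrable_cauchy_weight; apply: eq_integrable.
Qed.

Lemma line_int_cauchy_ge0 : 0 <= line_int q.
Proof. by apply: Rintegral_ge0 => x _; rewrite ltW// cauchy_weight_gt0. Qed.

Lemma line_int_gt0 (f : R -> R) : continuous f -> (forall x, 0 <= f x) ->
  mu.-integrable setT (EFin \o f) -> f 0 != 0 -> 0 < line_int f.
Proof.
move=> cf f0 fi fn0.
have fp : 0 < f 0 by rewrite lt_neqAle eq_sym fn0 f0.
have f20 : 0 < f 0 / 2 by rewrite divr_gt0.
have /cvgrPdist_le/(_ _ f20)/nbhs_ballP[r /= r0 rP] := cf 0.
have r20 : 0 < r / 2 by rewrite divr_gt0.
apply: (@lt_le_trans _ _ (\int[mu]_(x in `[0, r / 2]) (f 0 / 2))%R).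
  rewrite Rintegral_cst//= lebesgue_measure_itv/= lte_fin r20/= subr0.
  by rewrite mulr_gt0.
apply: (@le_trans _ _ (\int[mu]_(x in `[0, r / 2]) f x)%R).
  apply: le_Rintegral => //.
  - exact: (continuous_integrable _ _ (@cst_continuous R R (f 0 / 2))).
  - exact: continuous_integrable.
  move=> x /=; rewrite in_itv/= => /andP[x0 xr].
  have : `|f 0 - f x| <= f 0 / 2.
    by apply: rP; rewrite /ball/= sub0r normrN ger0_norm//; lra.
  by move=> /(le_trans (ler_norm _)); lra.
rewrite /line_int /Rintegral fine_le//.
- by apply: integrable_fin_num => //; exact: continuous_integrable.
- exact: integrable_fin_num.
- apply: ge0_subset_integral => //.
  + by apply/measurable_EFinP; exact: continuous_measurable_fun.
  + by move=> x _; rewrite lee_fin.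
Qed.

End LineIntegrals.

(** * The cosine as a limit of ridge functions *)

Section CosineDensity.
Context {R : realType}.
Local Notation mu := (@lebesgue_measure R).
Local Notation q := (@cauchy_weight R).
Variables (G : R -> R) (C : R).
Hypothesis cG : continuous G.
Hypothesis C0 : 0 <= C.
Hypothesis GC : forall x, `|G x| <= C * q x ^+ 2.

Let q0 x : 0 <= q x. Proof. exact: cauchy_weight_ge0. Qed.
Let GC1 := cauchy_square_le C0 GC.
Let GC0 := cauchy_square_bounded C0 GC.

Lemma integrable_mul_bounded (f : R -> R) (M : R) : continuous f ->
  (forall x, `|f x| <= M) -> mu.-integrable setT (EFin \o (fun x => G x * f x)).
Proof.
move=> cf fM; apply: (@integrable_dominated _ _ (C * M)).
  by move=> x; apply: cvgM; [exact: cG|exact: cf].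
move=> x; rewrite normrM mulrAC; apply: ler_pM => //.
Qed.

Definition cos_transform (a : R) : R := line_int (fun u => G u * cos (a * u)).
Definition sin_transform (a : R) : R := line_int (fun u => G u * sin (a * u)).

Let cmul (a : R) : continuous (fun x : R => a * x).
Proof. by move=> x; apply: cvgMr; exact: cvg_id. Qed.

Lemma continuous_cosM a : continuous (fun u : R => cos (a * u)).
Proof.
by move=> x; apply: (@continuous_comp _ _ _ (fun x : R => a * x) cos);
  [exact: cmul|exact: continuous_cos].
Qed.

Lemma continuous_sinM a : continuous (fun u : R => sin (a * u)).
Proof.
by move=> x; apply: (@continuous_comp _ _ _ (fun x : R => a * x) sin);
  [exact: cmul|exact: continuous_sin].
Qed.

Let icos a : mu.-integrable setT (EFin \o (fun u => G u * cos (a * u))).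
Proof.
apply: (@integrable_mul_bounded _ 1); first exact: continuous_cosM.
by move=> x; exact: cos_max.
Qed.

Let isin a : mu.-integrable setT (EFin \o (fun u => G u * sin (a * u))).
Proof.
apply: (@integrable_mul_bounded _ 1); first exact: continuous_sinM.
by move=> x; exact: sin_max.
Qed.

Lemma line_int_lin (f g : R -> R) (a b : R) :
  mu.-integrable setT (EFin \o f) -> mu.-integrable setT (EFin \o g) ->
  line_int (fun x => a * f x + b * g x) = a * line_int f + b * line_int g.
Proof.
move=> fi gi; rewrite /line_int RintegralD//.
- by rewrite !RintegralZl.
- by have := integrableZl measurableT a fi; apply: eq_integrable.
- by have := integrableZl measurableT b gi; apply: eq_integrable.
Qed.

Section Uniqueness.
Hypothesis cos0 : forall a, a != 0 -> cos_transform a = 0.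
Hypothesis sin0 : forall a, a != 0 -> sin_transform a = 0.

(** The transform at the frequency 0 is the limit of those at small frequencies. *)
Let cos_transform0 a : cos_transform a = 0.
Proof.
have [->|/cos0//] := eqVneq a 0.
apply/eqP; rewrite -normr_le0; apply/ler_addgt0Pr => e e0; rewrite add0r.
pose K := C * line_int q + 1.
have K0 : 0 < K by rewrite /K ltr_wpDl// mulr_ge0// line_int_cauchy_ge0.
have eK : 0 < e / K by rewrite divr_gt0.
rewrite -[cos_transform 0]subr0 -[X in _ - X](cos0 (lt0r_neq0 eK)).
rewrite /cos_transform /line_int -RintegralB//.
apply: (@le_trans _ _ (C * (e / K) * line_int q)); last first.
  rewrite mulrAC mulrA ler_pdivrMr// mulrC ler_wpM2l ?(ltW e0)//.
  by rewrite lerDl.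
apply: line_int_bound.
  by have := integrableB measurableT (icos 0) (icos (e / K)); apply: eq_integrable => // u _; rewrite /= EFinB.
move=> x; rewrite -mulrBr normrM.
apply: (@le_trans _ _ (C * q x ^+ 2 * (e / K * `|x|))).
  apply: ler_pM => //; apply: (le_trans (cos_lipschitz _ _)).
  by rewrite mul0r sub0r normrN normrM gtr0_norm.
have qx : q x * `|x| <= 1.
  rewrite /q mulrC ler_pdivrMr ?mul1r; last by rewrite ltr_pwDl// sqr_ge0.
  rewrite -[x ^+ 2]real_normK ?num_real//.
  have := sqr_ge0 (`|x| - 2^-1); rewrite !expr2; lra.
rewrite (_ : _ * _ = (C * (e / K) * q x) * (q x * `|x|)); last by ring.
by rewrite ler_piMr//; apply: mulr_ge0 => //; apply: mulr_ge0 => //; exact: ltW.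
Qed.

Let sin_transform0 a : sin_transform a = 0.
Proof.
have [->|/sin0//] := eqVneq a 0.
rewrite /sin_transform /line_int.
under eq_Rintegral do rewrite mul0r trigo.sin0 mulr0.
by rewrite /Rintegral integral0.
Qed.

Lemma orthogonal_trig (T : R -> R) : ridge_span cos aff T ->
  [/\ continuous T, exists M, forall x, `|T x| <= M &
      line_int (fun u => G u * T u) = 0].
Proof.
elim=> [|c h w [a [b hE]] _ [cw [M wM] w0]].
  split; [exact: cst_continuous|by exists 0 => x; rewrite normr0|].
  rewrite /line_int; under eq_Rintegral do rewrite mulr0.
  by rewrite /Rintegral integral0.
have cosE u : cos (h u) = cos b * cos (a * u) + - sin b * sin (a * u).
  by rewrite hE cosD; ring.
have iw := integrable_mul_bounded cw wM.
have ch : continuous (fun u => cos (h u)).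
  rewrite (_ : (fun _ => _) = (fun u => cos b * cos (a * u) + - sin b * sin (a * u))).
    move=> x; apply: cvgD; apply: cvgMr; [exact: continuous_cosM|exact: continuous_sinM].
  exact/funext.
have ich : mu.-integrable setT (EFin \o (fun u => G u * cos (h u))).
  by apply: (@integrable_mul_bounded _ 1) => // x; exact: cos_max.
split.
- by move=> x; apply: cvgD; [apply: cvgMr; exact: ch|exact: cw].
- exists (`|c| + M) => x; apply: (le_trans (ler_normD _ _)); rewrite lerD//.
  by rewrite normrM ler_piMr// cos_max.
have E : (fun u => G u * (c * cos (h u) + w u)) =
    (fun u => c * (G u * cos (h u)) + 1 * (G u * w u)).
  by apply/funext => u; ring.
rewrite E line_int_lin// w0 mulr0 addr0.
have E' : (fun u => G u * cos (h u)) =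
    (fun u => cos b * (G u * cos (a * u)) + - sin b * (G u * sin (a * u))).
  by apply/funext => u; rewrite cosE; ring.
rewrite E' line_int_lin//.
have -> : line_int (fun u => G u * cos (a * u)) = 0 by exact: cos_transform0.
have -> : line_int (fun u => G u * sin (a * u)) = 0 by exact: sin_transform0.
by rewrite !mulr0 addr0 mulr0.
Qed.

(** Uniqueness of the Fourier transform: [G] is orthogonal to trigonometric
    polynomials, which approximate [G] itself on a large interval with a uniform
    bound outside, so [G] is orthogonal to itself. *)
Lemma orthogonal_zero : G 0 = 0.
Proof.
apply: contrapT => /eqP G00.
have cG2 : continuous (fun x => G x * G x) by move=> x; apply: cvgM; exact: cG.
have iG2 := integrable_mul_bounded cG GC0.
have : 0 < line_int (fun x => G x * G x).
  apply: line_int_gt0 => //; last by rewrite mulf_neq0.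
  by move=> x; rewrite -expr2 sqr_ge0.
apply/negP; rewrite -leNgt; apply/ler_addgt0Pr => e e0; rewrite add0r.
pose Iq := line_int q; have Iq0 : 0 <= Iq := line_int_cauchy_ge0.
pose K := C * (1 + 2 * C) * Iq + 1.
have D0 : 0 <= C * (1 + 2 * C) by rewrite mulr_ge0// addr_ge0// mulr_ge0.
have K0 : 0 < K by rewrite /K ltr_wpDl// mulr_ge0.
have eK : 0 < e / K by rewrite divr_gt0.
pose B := 1 + (e / K)^-1.
have B1 : 1 <= B by rewrite lerDl invr_ge0 ltW.
have [g rg [gC gG]] : exists2 g, ridge_span cos aff g &
    (forall x, `|g x| <= C) /\ (forall x, `[- B, B]%classic x -> `|G x - g x| <= e / K).
  apply: trig_approx => //.
  - exact: aff_feature.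
  - exact: segment_compact.
  - move=> h [a [b ->]] x _ e' e'0.
    have /cvgrPdist_lt/(_ _ e'0) : {for x, continuous (fun x : R => a * x + b)}.
      by apply: cvgD; [exact: cmul|exact: cvg_cst].
    by apply: filterS => y; rewrite distrC.
  - move=> x y _ _ xy; exists (fun x => 1 * x + 0); first by exists 1, 0.
    by rewrite !mul1r !addr0.
have [cg _ g0] := orthogonal_trig rg.
have ig := integrable_mul_bounded cg gC.
rewrite -[X in X <= _]subr0 -[X in _ - X]g0 /line_int -RintegralB//.
apply: (le_trans (ler_norm _)).
apply: (@le_trans _ _ (C * (1 + 2 * C) * (e / K) * Iq)); last first.
  rewrite mulrAC mulrA ler_pdivrMr// mulrC ler_wpM2l ?(ltW e0)//.
  by rewrite lerDl.
apply: line_int_bound.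
  by have := integrableB measurableT iG2 ig; apply: eq_integrable => // u _; rewrite /= EFinB.
move=> x; rewrite -mulrBr normrM.
have Gg : q x * `|G x - g x| <= (1 + 2 * C) * (e / K).
  have qx1 := cauchy_weight_le1 x.
  have [xB|xB] := leP `|x| B.
    apply: (@le_trans _ _ (1 * (e / K))).
      by apply: ler_pM => //; apply: gG; rewrite /= in_itv/= -ler_norml.
    by rewrite ler_pM2r// lerDl mulr_ge0.
  have qB : q x <= e / K.
    rewrite /q -[e / K]invrK lef_pV2 ?posrE ?invr_gt0//; last by rewrite ltr_pwDl// sqr_ge0.
    apply: (@le_trans _ _ `|x|).
      by apply: le_trans (ltW xB); rewrite lerDr.
    rewrite -[x ^+ 2]real_normK ?num_real//.
    have := sqr_ge0 (`|x| - 2^-1); rewrite !expr2; lra.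
  apply: (@le_trans _ _ (e / K * (2 * C))).
    apply: ler_pM => //; apply: (le_trans (ler_normB _ _)).
    by rewrite mulr_natl mulr2n lerD.
  by rewrite mulrC ler_pM2r// lerDr.
apply: (@le_trans _ _ (C * q x * (q x * `|G x - g x|))).
  by rewrite mulrA ler_wpM2r// -mulrA -expr2.
rewrite (_ : _ * (e / K) * q x = C * q x * ((1 + 2 * C) * (e / K))); last by ring.
by rewrite ler_wpM2l// mulr_ge0.
Qed.

End Uniqueness.

End CosineDensity.

Section Convolution.
Context {R : realType}.
Local Notation mu := (@lebesgue_measure R).
Local Notation q := (@cauchy_weight R).
Variables (rho : R -> R) (p : R) (G : R -> R) (C : R).
Hypothesis p1 : 1 < p.
Hypothesis dG : wdense rho p G.
Hypothesis cG : continuous G.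
Hypothesis C0 : 0 <= C.
Hypothesis GC : forall x, `|G x| <= C * q x ^+ 2.

Let q0 x : 0 <= q x. Proof. exact: cauchy_weight_ge0. Qed.
Let GC1 := cauchy_square_le C0 GC.
Let GC0 := cauchy_square_bounded C0 GC.

Variables (psi : R -> R) (L : R).
Hypothesis L0 : 0 <= L.
Hypothesis psiL : forall s t, `|psi s - psi t| <= L * `|s - t|.
Hypothesis psi1 : forall s, `|psi s| <= 1.

Let cpsi : continuous psi. Proof. exact: lipschitz_continuous L0 psiL. Qed.

(** The convolution over a bounded window, written as an average of translates
    of [G]. *)
Lemma wdense_window B : 0 < B ->
  wdense rho p (fun x => 2 * B * avg (fun s => G (x - B + s * (2 * B)) * psi (- B + s * (2 * B)))).
Proof.
move=> B0; apply: wdense_scale => //.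
have B20 : 0 < 2 * B by rewrite mulr_gt0.
apply: (@wdense_avg _ _ _ (fun s x => G (x - B + s * (2 * B)) * psi (- B + s * (2 * B)))).
- move=> s; have := wdense_scale (psi (- B + s * (2 * B))) (wdense_affine p1 1 (- B + s * (2 * B)) dG).
  by under eq_fun do rewrite mulrC mul1r addrA.
- move=> x s; have h1 := @continuous_line R G (x - B) (2 * B) cG.
  have h2 := @continuous_line R psi (- B) (2 * B) cpsi.
  exact: (cvgM (h1 s) (h2 s)).
move=> e e0; pose X := 2 * C / e.
have X0 : 0 <= X by rewrite divr_ge0 ?mulr_ge0// ltW.
have e20 : 0 < e / 2 by rewrite divr_gt0.
have [d d0 dP] := compact_uniform (@segment_compact R (- (X + B)) (X + B)) cG e20.
pose K := C * L + 1.
have K0 : 0 < K by rewrite ltr_wpDl// mulr_ge0.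
exists (Num.min d (e / 2 / K) / (2 * B)).
  by rewrite divr_gt0// lt_min d0 divr_gt0.
move=> s s' /andP[s0 s1] _; rewrite ler_pdivlMr// le_min => /andP[sd sK] x.
have ss : - B + s * (2 * B) - (- B + s' * (2 * B)) = (s - s') * (2 * B) by ring.
have [xX|/ltW xX] := leP `|x| X; last first.
  apply: (@le_trans _ _ (2 * C)).
    apply: (le_trans (ler_normB _ _)); rewrite (_ : 2 * C = C * 1 + C * 1); last by ring.
    by apply: lerD; rewrite normrM; apply: ler_pM.
  have -> : 2 * C = e * X by rewrite /X mulrCA divff ?mulr1// gt_eqF.
  rewrite ler_wpM2l ?(ltW e0)//; apply: (le_trans xX).
  by apply: le_trans (wt_geD1 p1 x); rewrite lerDr.
apply: (@le_trans _ _ e); last by rewrite ler_peMr ?wt_ge1// ltW.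
set g := G _; set g' := G _; set r := psi _; set r' := psi _.
have -> : g * r - g' * r' = (g - g') * r + g' * (r - r') by ring.
apply: (le_trans (ler_normD _ _)); rewrite [e]splitr; apply: lerD; rewrite normrM.
  rewrite -[e / 2]mulr1; apply: ler_pM => //; last exact: psi1.
  apply: dP.
    rewrite /= in_itv/= -ler_norml -addrA.
    apply: (le_trans (ler_normD _ _)); rewrite lerD//.
    by rewrite ler_norml; apply/andP; split; nra.
  rewrite (_ : _ - _ = (s - s') * (2 * B)); last by ring.
  by rewrite normrM (gtr0_norm B20).
apply: (@le_trans _ _ (C * (L * (e / 2 / K)))).
  apply: ler_pM => //; first exact: GC0.
  apply: (le_trans (psiL _ _)); rewrite ler_wpM2l//.
  by rewrite ss normrM (gtr0_norm B20).
rewrite mulrA mulrA ler_pdivrMr// mulrC ler_wpM2l ?(ltW e20)//.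
by rewrite lerDl.
Qed.

(** The integral outside the window of radius [B] around [x] is small in the
    weighted norm: for [`|x| <= B / 2] because it is taken far from 0, where [G]
    is small, and for larger [`|x|] because the weight is at least [B / 2]. *)
Lemma wdense_convolution : wdense rho p (fun x => line_int (fun u => G u * psi (u - x))).
Proof.
apply: wdense_lim => // e e0.
pose Iq := line_int q; have Iq0 : 0 <= Iq := line_int_cauchy_ge0.
pose K := C * Iq + 1.
have K0 : 0 < K by rewrite ltr_wpDl// mulr_ge0.
pose B := 2 + 2 * (K / e).
have Ke : 0 < K / e by rewrite divr_gt0.
have B0 : 0 < B by rewrite /B; lra.
exists (fun x => 2 * B * avg (fun s => G (x - B + s * (2 * B)) * psi (- B + s * (2 * B)))).
  exact: wdense_window.
move=> x; pose f u := G u * psi (u - x).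
have cf : continuous f.
  move=> u; apply: cvgM; first exact: cG.
  apply: (@continuous_comp _ _ _ (fun u : R => u - x) psi); last exact: cpsi.
  by apply: cvgB; [exact: cvg_id|exact: cvg_cst].
have fq u : `|f u| <= C * q u.
  by rewrite normrM -[C * q u]mulr1; apply: ler_pM.
have fi := integrable_dominated cf fq.
have xB : x - B < x + B by lra.
have mD : measurable (`[x - B, x + B]%classic : set R) by exact: measurable_itv.
have -> : 2 * B * avg (fun s => G (x - B + s * (2 * B)) * psi (- B + s * (2 * B)))
    = line_int (f \_ `[x - B, x + B]).
  rewrite /line_int -Rintegral_mkcond.
  have [P dP] := antiderivative_exists (x - B - 2 * B - 1) cf.
  have dP' (u : R) : x - B - 2 * B <= u -> is_derive u 1 P (f u).
    by move=> hu; apply: dP; lra.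
  have -> : (\int[mu]_(t in `[x - B, x + B]) f t)%R = P (x + B) - P (x - B).
    by apply: integral_antiderivative => // u /andP[hu _]; apply: dP'; lra.
  have -> : (fun s => G (x - B + s * (2 * B)) * psi (- B + s * (2 * B))) =
      (fun s => f (x - B + s * (2 * B))).
    by apply/funext => s; rewrite /f; congr (_ * psi _); ring.
  have -> : P (x + B) = P (x - B + 2 * B) by congr P; ring.
  apply: avg_line => // u /andP[hu _]; apply: dP'; move: hu.
  by rewrite gtr0_norm// mulr_gt0.
have fDi : mu.-integrable setT (EFin \o (f \_ `[x - B, x + B])).
  rewrite -restrict_EFin.
  exact: (proj1 (integrable_mkcond (mu := mu) (EFin \o f) mD)
    (continuous_integrable (x - B) (x + B) cf)).
rewrite /line_int -RintegralB//.
apply: (@le_trans _ _ (C * wt p x / (1 + B / 2) * Iq)).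
  apply: line_int_bound.
    by have := integrableB measurableT fi fDi; apply: eq_integrable => // u _; rewrite /= EFinB.
  move=> u; rewrite patchE; case: ifPn => [_|].
    rewrite subrr normr0 !mulr_ge0 ?wt_ge0// invr_ge0; lra.
  rewrite notin_setE/= in_itv/= => uD; rewrite subr0.
  have xu : B < `|u - x|.
    rewrite ltNge; apply/negP; rewrite ler_norml => /andP[h1 h2]; apply: uD.
    by apply/andP; split; lra.
  have B2 : 0 < 1 + B / 2 by lra.
  rewrite mulrAC ler_pdivlMr//.
  have [xB2|xB2] := leP `|x| (B / 2); last first.
    rewrite [leRHS]mulrAC; apply: ler_pM; [by []|lra|exact: fq|].
    by apply: le_trans (wt_geD1 p1 x); lra.
  have uB : B / 2 < `|u| by have := ler_normB u x; lra.
  apply: (@le_trans _ _ (C * q u * (q u * (1 + B / 2)))).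
    rewrite (_ : _ * (q u * _) = C * q u ^+ 2 * 1 * (1 + B / 2)); last by ring.
    by rewrite ler_wpM2r ?(ltW B2)// normrM; apply: ler_pM.
  rewrite mulrAC ler_wpM2r// ler_wpM2l//.
  apply: (le_trans _ (wt_ge1 p1 x)).
  rewrite /q mulrC ler_pdivrMr ?mul1r; last by rewrite ltr_pwDl// sqr_ge0.
  rewrite lerD2l -[u ^+ 2]real_normK ?num_real//.
  apply: (le_trans (ltW uB)); rewrite expr2 ler_peMr//.
  by apply/ltW/(lt_trans _ uB); rewrite /B; lra.
rewrite [leLHS]mulrAC ler_pdivrMr; last by rewrite /B; lra.
rewrite [leLHS]mulrAC [leRHS]mulrAC ler_wpM2r ?wt_ge0//.
have -> : 1 + B / 2 = 2 + K / e by rewrite /B; field; rewrite gt_eqF.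
rewrite mulrDr (mulrCA e) divff ?gt_eqF// mulr1.
by apply: (@le_trans _ _ K); [rewrite lerDl|rewrite lerDr mulr_ge0// ltW].
Qed.

End Convolution.

(** With [A] and [B] the transforms of [G] at the frequency [a], the convolutions
    with the cosine and the sine are the coordinates of (A, B) rotated by the
    angle [- a * x]; a linear combination of them is [cos (a * x)]. *)
Lemma wdense_cos {R : realType} (rho : R -> R) (p : R) : 1 < p ->
  continuous rho ->
  (forall e, 0 < e -> exists2 C, 0 <= C & forall x, `|rho x| <= e * wt p x + C) ->
  (~ exists q : {poly R}, forall x, rho x = q.[x]) ->
  wdense rho p cos.
Proof.
move=> p1 cr gr nr.
have [G [C [dG cG G0 C0 GC]]] := decaying_ridge_limit p1 cr gr nr.
have [a [a0 AB]] : exists a, a != 0 /\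
    (cos_transform G a != 0 \/ sin_transform G a != 0).
  apply: contrapT => nA; move/eqP: G0; apply.
  apply: (orthogonal_zero cG C0 GC) => a a0; apply: contrapT => /eqP h; apply: nA; exists a; split=> //.
  - by left.
  - by right.
set A := cos_transform G a in AB; set B := sin_transform G a in AB.
have psiL (f : R -> R) : (forall s t, `|f s - f t| <= `|s - t|) ->
    forall s t, `|f (a * s) - f (a * t)| <= `|a| * `|s - t|.
  by move=> fL s t; apply: (le_trans (fL _ _)); rewrite -mulrBr normrM.
have d1 := wdense_convolution p1 dG cG C0 GC (normr_ge0 a) (psiL _ (@cos_lipschitz R)) (fun s => cos_max (a * s)).
have d2 := wdense_convolution p1 dG cG C0 GC (normr_ge0 a) (psiL _ (@sin_lipschitz R)) (fun s => sin_max (a * s)).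
have ic := integrable_mul_bounded cG C0 GC (@continuous_cosM R a) (fun x => cos_max (a * x)).
have ii := integrable_mul_bounded cG C0 GC (@continuous_sinM R a) (fun x => sin_max (a * x)).
have E1 x : line_int (fun u => G u * cos (a * (u - x))) = cos (a * x) * A + sin (a * x) * B.
  rewrite -line_int_lin//; congr line_int; apply/funext => u.
  by rewrite mulrBr cosB; ring.
have E2 x : line_int (fun u => G u * sin (a * (u - x))) = cos (a * x) * B + - sin (a * x) * A.
  rewrite -line_int_lin//; congr line_int; apply/funext => u.
  by rewrite mulrBr sinB; ring.
have D0 : A ^+ 2 + B ^+ 2 != 0.
  rewrite paddr_eq0 ?sqr_ge0// !sqrf_eq0 negb_and.
  by case: AB => ->; rewrite ?orbT.
have := wdense_add (wdense_scale (A / (A ^+ 2 + B ^+ 2)) d1)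
   (wdense_scale (B / (A ^+ 2 + B ^+ 2)) d2).
move=> /(wdense_affine p1 a^-1 0); congr (wdense rho p _).
apply/funext => x; rewrite E1 E2 addr0 mulrA mulfV// mul1r.
by field.
Qed.

(** * Weighted Hoelder norms *)

Section EuclideanNorm.
Context {R : realType} {d : nat}.
Implicit Types x y : 'rV[R]_d.

Lemma enorm_ge0 x : 0 <= enorm x. Proof. exact: sqrtr_ge0. Qed.

Lemma enormN x : enorm (- x) = enorm x.
Proof. by rewrite /enorm; under eq_bigr do rewrite mxE sqrrN. Qed.

Lemma enormB x y : enorm (x - y) = enorm (y - x).
Proof. by rewrite -enormN opprB. Qed.

Lemma coord_le_norm x i : `|x ord0 i| <= `|x|.
Proof.
rewrite [leRHS]/Num.norm/= mx_normrE.
exact: (le_bigmax _ (fun ij => `|x ij.1 ij.2|) (ord0, i)).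
Qed.

(** The Euclidean and the maximum norm are compared once and for all here; the
    triangle inequality is only ever used for the latter. *)
Lemma norm_le_enorm x : `|x| <= enorm x.
Proof.
rewrite [leLHS]/Num.norm/= mx_normrE; apply/bigmax_leP; split; first exact: enorm_ge0.
move=> [j i] _ /=; rewrite (ord1 j) -sqrtr_sqr; apply: ler_wsqrtr.
by rewrite (bigD1 i)//= lerDl sumr_ge0// => k _; exact: sqr_ge0.
Qed.

Lemma enorm_le_norm x : enorm x <= d%:R * `|x|.
Proof.
rewrite -[leRHS]ger0_norm ?mulr_ge0// -sqrtr_sqr ler_sqrt ?sqr_ge0//.
apply: (@le_trans _ _ (d%:R * `|x| ^+ 2)).
  rewrite mulr_natl -[X in _ *+ X]card_ord -sumr_const; apply: ler_sum => i _.
  by rewrite -real_normK ?num_real// ler_pXn2r ?nnegrE// coord_le_norm.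
rewrite exprMn ler_wpM2r ?sqr_ge0// -natrX ler_nat.
by case: (d) => // n; rewrite leq_pmulr.
Qed.

Lemma enorm_gt0 x y : x != y -> 0 < enorm (x - y).
Proof.
move=> xy; apply: lt_le_trans (norm_le_enorm _).
by rewrite normr_gt0 subr_eq0.
Qed.

Lemma compact_ball (r : R) : compact [set x : 'rV[R]_d | `|x| <= r].
Proof.
apply: bounded_closed_compact.
  exists r; split; first exact: num_real.
  by move=> s rs x /= /le_trans; apply; exact: ltW.
have -> : [set x : 'rV[R]_d | `|x| <= r] = Num.norm @^-1` [set t | t <= r] by [].
apply: closed_comp; last exact: closed_le.
by move=> x _; exact: norm_continuous.
Qed.

End EuclideanNorm.

Section WeightedHoelder.
Context {R : realType} {d : nat}.
Implicit Types (x y : 'rV[R]_d) (k f g : 'rV[R]_d -> R) (a r : R).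

Lemma weight_gt0 k x : weight k -> 0 < k x. Proof. by case. Qed.

(** As a harmonic mean, [kbar] is monotone in both weights, which is how it is
    compared between different weights below. *)
Lemma kbarE k x y : weight k -> kbar k x y = 2 / ((k x)^-1 + (k y)^-1).
Proof.
move=> wk; rewrite /kbar; field.
have kx := weight_gt0 x wk; have ky := weight_gt0 y wk.
by rewrite !gt_eqF// addr_gt0.
Qed.

Lemma continuous_weightV k : weight k -> continuous (fun x => (k x)^-1).
Proof.
move=> [ck k0 _] x; apply: (cvgV (F := nbhs x)); last exact: ck.
by rewrite gt_eqF.
Qed.

Lemma kbar_gt0 k x y : weight k -> 0 < kbar k x y.
Proof. by move=> wk; rewrite kbarE// divr_gt0// addr_gt0// invr_gt0 weight_gt0. Qed.

Lemma kbar_ge0 k x y : weight k -> 0 <= kbar k x y.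
Proof. by move=> wk; rewrite ltW// kbar_gt0. Qed.

Lemma kbar_lel k x y : weight k -> kbar k x y <= 2 * k x.
Proof.
move=> wk; have kx := weight_gt0 x wk; have ky := weight_gt0 y wk.
rewrite /kbar ler_pdivrMr ?addr_gt0//.
by have := mulr_gt0 kx kx; lra.
Qed.

Lemma kbarC k x y : kbar k x y = kbar k y x.
Proof. by rewrite /kbar [2 * _ * _]mulrAC [k x + _]addrC. Qed.

Lemma kbar_ler k x y : weight k -> kbar k x y <= 2 * k y.
Proof. by move=> wk; rewrite kbarC; exact: kbar_lel. Qed.

Lemma kbar_mono k k' c x y : weight k -> weight k' -> 0 <= c ->
  (forall x, k' x <= c * k x) -> kbar k' x y <= c * kbar k x y.
Proof.
move=> wk wk' c0 kk.
have [c0'|c0'] := eqVneq c 0.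
  by have := kk x; rewrite c0' mul0r leNgt weight_gt0.
have cp : 0 < c by rewrite lt_neqAle eq_sym c0'.
have iv z : (k z)^-1 <= c * (k' z)^-1.
  rewrite -[leLHS]mul1r ler_pdivrMr ?weight_gt0// mulrAC ler_pdivlMr ?weight_gt0//.
  by rewrite mul1r.
rewrite !kbarE// mulrCA ler_wpM2l// ler_pdivlMr ?addr_gt0 ?invr_gt0 ?weight_gt0//.
rewrite mulrC ler_pdivrMr ?addr_gt0 ?invr_gt0 ?weight_gt0//.
by rewrite mulrDr lerD.
Qed.

Lemma kbar_ge_min k x y : weight k -> Num.min (k x) (k y) <= kbar k x y.
Proof.
move=> wk; have kx := weight_gt0 x wk; have ky := weight_gt0 y wk.
rewrite /kbar ler_pdivlMr ?addr_gt0//.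
case: (leP (k x) (k y)) => [h|/ltW h].
  by have := ler_wpM2l (ltW kx) h; lra.
by have := ler_wpM2l (ltW ky) h; lra.
Qed.

(** The bound [r] on the Hoelder norm as two families of real inequalities.  The
    quotient is cleared, so that the diagonal needs no exception. *)
Definition hle a k f r := (forall x, `|f x| * k x <= r) /\
  (forall x y, `|f x - f y| * kbar k x y <= r * enorm (x - y) `^ a).

Lemma hle_ge0 a k f r : weight k -> hle a k f r -> 0 <= r.
Proof.
move=> wk [H _]; apply: le_trans (H 0); rewrite mulr_ge0//.
by rewrite ltW// weight_gt0.
Qed.

Lemma hnorm_le a k f r : weight k -> (hnorm a k f <= r%:E)%E <-> hle a k f r.
Proof.
move=> wk; rewrite /hnorm /wnorm ge_max; split.
  move=> /andP[/ereal_supP H1 /ereal_supP H2]; split=> [x|x y].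
    by have := H1 _ (imageT _ x); rewrite lee_fin.
  have [->|xy] := eqVneq x y.
    rewrite !subrr normr0 mul0r mulr_ge0 ?powR_ge0//.
    have := H1 _ (imageT _ x); rewrite lee_fin; apply: le_trans.
    by rewrite mulr_ge0// ltW// weight_gt0.
  have : ((holder_quotient a k f x y)%:E <= r%:E)%E by apply: H2; exists (x, y).
  by rewrite lee_fin /holder_quotient mulrAC ler_pdivrMr ?powR_gt0 ?enorm_gt0.
move=> [H1 H2]; apply/andP; split; apply/ereal_supP.
  by move=> _ [x _ <-]; rewrite lee_fin.
move=> _ [[x y] /= xy <-]; rewrite lee_fin /holder_quotient.
by rewrite mulrAC ler_pdivrMr ?powR_gt0 ?enorm_gt0.
Qed.

End WeightedHoelder.

Section HoelderCalculus.
Context {R : realType} {d : nat}.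
Implicit Types (x y : 'rV[R]_d) (k f g : 'rV[R]_d -> R) (a r s c e M : R).

Lemma hle_le a k f r s : r <= s -> hle a k f r -> hle a k f s.
Proof.
move=> rs [H1 H2]; split=> [x|x y]; first exact: le_trans (H1 x) rs.
by apply: (le_trans (H2 x y)); rewrite ler_wpM2r ?powR_ge0.
Qed.

Lemma hle0 a k : weight k -> hle a k (fun=> 0) 0.
Proof. by move=> wk; split=> *; rewrite ?subrr normr0 !mul0r. Qed.

Lemma hle_add a k f g r s : weight k -> hle a k f r -> hle a k g s ->
  hle a k (fun x => f x + g x) (r + s).
Proof.
move=> wk [f1 f2] [g1 g2]; split=> [x|x y].
  apply: (@le_trans _ _ ((`|f x| + `|g x|) * k x)).
    by rewrite ler_wpM2r ?ler_normD// ltW// weight_gt0.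
  by rewrite mulrDl lerD.
apply: (@le_trans _ _ ((`|f x - f y| + `|g x - g y|) * kbar k x y)).
  by rewrite ler_wpM2r ?kbar_ge0// opprD addrACA ler_normD.
by rewrite !mulrDl lerD.
Qed.

Lemma hle_scale a k f r c : hle a k f r ->
  hle a k (fun x => c * f x) (`|c| * r).
Proof.
move=> [f1 f2]; split=> [x|x y].
  by rewrite normrM -mulrA ler_wpM2l.
by rewrite -mulrBr normrM -!mulrA ler_wpM2l.
Qed.

Lemma hle_sub a k f g r s : weight k -> hle a k f r -> hle a k g s ->
  hle a k (f \- g) (r + s).
Proof.
move=> wk hf /(hle_scale (-1)); rewrite normrN1 mul1r => hg.
by have := hle_add wk hf hg; congr hle; apply/funext => x /=; rewrite mulN1r.
Qed.

Lemma hle_sum a k (J : finType) (y : J -> 'rV[R]_d -> R) (c r : J -> R) :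
  weight k -> (forall j, hle a k (y j) (r j)) ->
  hle a k (fun x => \sum_j c j * y j x) (\sum_j `|c j| * r j).
Proof.
move=> wk H; elim: (index_enum J) => [|j s IH].
  by rewrite big_nil; under eq_fun do rewrite big_nil; exact: hle0.
rewrite big_cons; under eq_fun do rewrite big_cons.
by apply: hle_add => //; exact: hle_scale.
Qed.

(** The crude bound for distant points, where [kbar] is at most twice each of the
    two weights. *)
Lemma hle_diff_le k f (m m' : R) x y : weight k -> `|f x| * k x <= m ->
  `|f y| * k y <= m' -> `|f x - f y| * kbar k x y <= 2 * (m + m').
Proof.
move=> wk fx fy.
apply: (@le_trans _ _ ((`|f x| + `|f y|) * kbar k x y)).
  by rewrite ler_wpM2r ?kbar_ge0// ler_normB.
rewrite mulrDl mulrDr lerD//.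
  apply: (@le_trans _ _ (`|f x| * (2 * k x))); first by rewrite ler_wpM2l// kbar_lel.
  by rewrite mulrCA ler_wpM2l.
apply: (@le_trans _ _ (`|f y| * (2 * k y))); first by rewrite ler_wpM2l// kbar_ler.
by rewrite mulrCA ler_wpM2l.
Qed.

(** For close points the larger exponent is stronger; distant points are
    covered by [hle_diff_le]. *)
Lemma hle_embed a a' k k' c f r : weight k -> weight k' -> 0 <= a' -> a' <= a ->
  0 <= c -> (forall x, k' x <= c * k x) -> hle a k f r -> hle a' k' f (4 * c * r).
Proof.
move=> wk wk' a0 aa c0 kk hf; have r0 := hle_ge0 wk hf; case: hf => f1 f2.
have H1 x : `|f x| * k' x <= c * r.
  apply: (@le_trans _ _ (`|f x| * (c * k x))); first by rewrite ler_wpM2l.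
  by rewrite mulrCA ler_wpM2l.
have cr0 : 0 <= c * r by exact: mulr_ge0.
split=> [x|x y]; first by apply: (le_trans (H1 x)); rewrite -mulrA ler_peMl// ler1n.
have [->|xy] := eqVneq x y.
  by rewrite !subrr normr0 mul0r !mulr_ge0 ?powR_ge0.
have t0 := enorm_gt0 xy.
have [t1|/ltW t1] := leP (enorm (x - y)) 1.
  apply: (@le_trans _ _ (`|f x - f y| * (c * kbar k x y))).
    by rewrite ler_wpM2l// kbar_mono.
  rewrite mulrCA; apply: (@le_trans _ _ (c * (r * enorm (x - y) `^ a))).
    by rewrite ler_wpM2l.
  rewrite mulrA; apply: ler_pM => //; rewrite ?powR_ge0//; first by rewrite -mulrA ler_peMl// ler1n.
  by apply: ger_powR => //; rewrite t0.
apply: (le_trans (hle_diff_le wk' (H1 x) (H1 y))).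
rewrite (_ : 2 * _ = 4 * c * r * 1); last by ring.
rewrite ler_wpM2l//; first by rewrite -mulrA mulr_ge0.
by rewrite -(powRr0 (enorm (x - y))); apply: ler_powR.
Qed.

Lemma powR_small a e : 0 < a -> 0 < e ->
  exists2 s, 0 < s & forall t, 0 <= t -> t <= s -> t `^ a <= e.
Proof.
move=> a0 e0; exists (e `^ a^-1); first exact: powR_gt0.
move=> t t0 ts; have -> : e = (e `^ a^-1) `^ a.
  by rewrite -powRrM mulVf ?gt_eqF// powRr1// ltW.
by apply: ge0_ler_powR => //; rewrite ?nnegrE ?powR_ge0// ltW.
Qed.

(** Interpolation.  Outside a large ball the ratio of the weights makes the weaker
    weighted values small.  In the Hoelder quotient, close points gain a power
    [a - a'] of their distance, and for the others small values suffice. *)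
Lemma hle_interpolate a a' k k' c (M e : R) : weight k -> weight k' ->
  0 <= a' -> a' < a -> 0 <= c -> (forall x, k' x <= c * k x) ->
  weight_ll k' k -> 0 < e -> exists r s, 0 < s /\
    forall f, hle a k f M -> (forall x, enorm x <= r -> `|f x| <= s) ->
      hle a' k' f e.
Proof.
move=> wk wk' a0 aa c0 kk ll e0.
have [M0|M0] := ltP M 0.
  exists 0, 1; split=> // f hf; have := hle_ge0 wk hf.
  by rewrite leNgt M0.
have M1 : 0 < M + 1 by rewrite ltr_wpDl.
have cM0 : 0 <= c * M by exact: mulr_ge0.
have aa0 : 0 < a - a' by rewrite subr_gt0.
have e1 : 0 < e / (c * M + 1) by rewrite divr_gt0// ltr_wpDl.
have [s s0 sP] := powR_small aa0 e1.
pose e2 := Num.min e (e / 4 * s `^ a').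
have e20 : 0 < e2 by rewrite lt_min e0 mulr_gt0 ?divr_gt0 ?powR_gt0.
have e3 : 0 < e2 / (M + 1) by rewrite divr_gt0.
move/cvgrPdist_le : (ll) => /(_ _ e3)[r rP].
have [K Kp Kk] : exists2 K, 0 < K & forall x, k' x <= K.
  have [_ k0 [K KP]] := wk'; exists K => //.
  exact: lt_le_trans (k0 0) (KP 0).
exists r, (e2 / K); split; first by rewrite divr_gt0.
move=> f [f1 f2] fs.
have H1 x : `|f x| * k' x <= e2.
  have [xr|xr] := leP (enorm x) r.
    apply: (@le_trans _ _ (e2 / K * K)); last by rewrite divfK ?gt_eqF.
    apply: ler_pM => //; first by rewrite ltW// weight_gt0.
    exact: fs.
  have := rP _ xr; rewrite /= sub0r normrN ger0_norm; last first.
    by rewrite divr_ge0// ltW// weight_gt0.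
  rewrite ler_pdivrMr ?weight_gt0// => h.
  apply: (@le_trans _ _ (`|f x| * (e2 / (M + 1) * k x))); first by rewrite ler_wpM2l.
  rewrite mulrCA mulrAC ler_pdivrMr// ler_wpM2l ?(ltW e20)//.
  by apply: (le_trans (f1 x)); rewrite lerDl.
split=> [x|x y]; first by apply: (le_trans (H1 x)); rewrite /e2 ge_min lexx.
have [->|xy] := eqVneq x y.
  by rewrite !subrr normr0 mul0r !mulr_ge0 ?powR_ge0// ltW.
have t0 := enorm_gt0 xy.
have [ts|/ltW ts] := leP (enorm (x - y)) s.
  apply: (@le_trans _ _ (`|f x - f y| * (c * kbar k x y))).
    by rewrite ler_wpM2l// kbar_mono.
  rewrite mulrCA; apply: (@le_trans _ _ (c * (M * enorm (x - y) `^ a))).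
    by rewrite ler_wpM2l.
  rewrite -[in enorm (x - y) `^ a](subrK a' a) powRD; last by apply/implyP => _; rewrite gt_eqF.
  rewrite !mulrA ler_wpM2r ?powR_ge0//.
  apply: (@le_trans _ _ (c * M * (e / (c * M + 1)))).
    by rewrite ler_wpM2l// sP// ltW.
  by apply: mul_frac_le => //; exact: ltW.
apply: (le_trans (hle_diff_le wk' (H1 x) (H1 y))).
apply: (@le_trans _ _ (e * s `^ a')).
  have : e2 <= e / 4 * s `^ a' by rewrite /e2 ge_min lexx orbT.
  lra.
rewrite ler_wpM2l ?(ltW e0)//; apply: ge0_ler_powR => //; rewrite nnegrE ltW//.
Qed.

Lemma hle_equicontinuous a k (M e : R) x : weight k -> 0 < a -> 0 < e ->
  \forall y \near x, forall f, hle a k f M -> `|f x - f y| <= e.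
Proof.
move=> wk a0 e0; have kx := weight_gt0 x wk.
have [M0|M0] := ltP M 0.
  by near=> y => f hf; have := hle_ge0 wk hf; rewrite leNgt M0.
have M1 : 0 < M + 1 by rewrite ltr_wpDl.
have k20 : 0 < k x / 2 by rewrite divr_gt0.
have e1 : 0 < e * (k x / 2) / (M + 1) by rewrite divr_gt0// mulr_gt0.
have [s s0 sP] := powR_small a0 e1.
have [ck _ _] := wk; have /cvgrPdist_le/(_ _ k20) kn := ck x.
have d1 : 0 < d%:R + 1 :> R by rewrite ltr_wpDl.
have sd : 0 < s / (d%:R + 1) by rewrite divr_gt0.
near=> y => f [f1 f2].
have ky : k x / 2 <= k y.
  have : `|k x - k y| <= k x / 2 by near: y.
  by move=> /(le_trans (ler_norm _)); lra.
have kb : k x / 2 <= kbar k x y.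
  apply: le_trans (kbar_ge_min x y wk); rewrite le_min ky andbT.
  lra.
have xy : enorm (x - y) <= s.
  apply: (le_trans (enorm_le_norm _)).
  have : `|x - y| < s / (d%:R + 1).
    by near: y; apply/nbhs_ballP; exists (s / (d%:R + 1)) => // z; rewrite -ball_normE.
  move=> /ltW h; apply: (@le_trans _ _ ((d%:R + 1) * (s / (d%:R + 1)))).
    by apply: ler_pM => //; rewrite lerDl.
  by rewrite mulrC divfK ?gt_eqF.
rewrite -(ler_pM2r k20); apply: (@le_trans _ _ (`|f x - f y| * kbar k x y)).
  by rewrite ler_wpM2l.
apply: (le_trans (f2 x y)); apply: (@le_trans _ _ (M * (e * (k x / 2) / (M + 1)))).
  by rewrite ler_wpM2l// sP// enorm_ge0.
rewrite mulrA ler_pdivrMr// mulrC; apply: ler_wpM2l; last by rewrite lerDl.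
by apply: mulr_ge0; exact: ltW.
Unshelve. all: by end_near. Qed.

Lemma hle_continuous a k f M : weight k -> 0 < a -> hle a k f M -> continuous f.
Proof.
move=> wk a0 hf x; apply: (iffRL (cvgrPdist_le (F := nbhs x) f (f x))) => e e0.
near=> y; suff : forall f, hle a k f M -> `|f x - f y| <= e by exact.
by near: y; exact: hle_equicontinuous.
Unshelve. all: by end_near. Qed.

End HoelderCalculus.

Section HoelderCompactness.
Context {R : realType} {d : nat}.
Local Notation space := {ptws 'rV[R]_d -> R}.
Implicit Types (x y : 'rV[R]_d) (k f g : 'rV[R]_d -> R) (a r s c e M : R).

Lemma ptws_eval_near (f0 : space) x e : 0 < e ->
  \forall f \near f0, `|f x - f0 x| <= e.
Proof.
move=> e0; have cx : (fun f : space => f x) @ nbhs f0 --> f0 x.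
  exact: (@proj_continuous _ (fun=> R) x f0).
move/cvgrPdist_le : cx => /(_ _ e0); apply: filterS => f.
by rewrite distrC.
Qed.

(** By equicontinuity, pointwise convergence is uniform on compact sets. *)
Lemma ptws_near_ball a k M r e (f0 : space) : weight k -> 0 < a -> 0 < e ->
  hle a k f0 M -> \forall f \near f0, hle a k f M ->
    forall x, enorm x <= r -> `|f x - f0 x| <= e.
Proof.
move=> wk a0 e0 hf0.
have e30 : 0 < e / 3 by rewrite divr_gt0.
have /compact_near_coveringP ncK := @compact_ball R d r.
have : \forall f \near f0, [set x : 'rV[R]_d | `|x| <= r] `<=`
    (fun x => hle a k f M -> `|f x - f0 x| <= e).
  apply: (ncK space (nbhs f0) (fun f x => hle a k f M -> `|f x - f0 x| <= e) (nbhs_filter f0)) => x _.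
  have eqx := hle_equicontinuous M x wk a0 e30.
  exists ([set y | forall f, hle a k f M -> `|f x - f y| <= e / 3],
          [set f : space | `|f x - f0 x| <= e / 3]) => /=.
    by split; [exact: eqx|exact: ptws_eval_near].
  move=> [y f] /= [yP fx] hf.
  have h1 := yP _ hf; have h2 := yP _ hf0.
  have -> : f y - f0 y = - (f x - f y) + (f x - f0 x) + (f0 x - f0 y) by ring.
  apply: (le_trans (ler_normD _ _)); have := ler_normD (- (f x - f y)) (f x - f0 x).
  rewrite normrN; lra.
apply: (@filterS _ _ (nbhs_filter f0)) => f fP hf x xr; apply: fP => //=.
exact: le_trans (norm_le_enorm x) xr.
Qed.

(** A closed subset of a product of compact intervals. *)
Lemma compact_hle a k M : weight k -> compact [set f : space | hle a k f M].
Proof.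
move=> wk.
pose Q x := [set` `[- (M / k x), M / k x]%R] : set R.
have cQ : compact [set f : space | forall x, Q x (f x)].
  by apply: (@tychonoff _ (fun=> R)) => x; exact: segment_compact.
apply: subclosed_compact cQ _.
  have -> : [set f : space | hle a k f M] =
      [set f | forall x, `|f x| * k x <= M] `&`
      [set f | forall z : 'rV[R]_d * 'rV[R]_d,
        `|f z.1 - f z.2| * kbar k z.1 z.2 <= M * enorm (z.1 - z.2) `^ a].
    apply/seteqP; split=> f /= [H1 H2]; split=> //.
    by move=> x y; exact: (H2 (x, y)).
  have cev x : continuous (fun f : space => f x).
    by move=> f; exact: (@proj_continuous _ (fun=> R) x f).
  apply: closedI.
    have -> : [set f : space | forall x, `|f x| * k x <= M] =
        \bigcap_x ((fun f : space => `|f x| * k x) @^-1` [set t | t <= M]).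
      by apply/seteqP; split=> f H x; [move=> _; exact: H|exact: (H x I)].
    apply: closed_bigI => x _; apply: closed_comp; last exact: closed_le.
    move=> f _; exact: (cvgMr_tmp (cvg_norm (cev x f))).
  have -> : [set f : space | forall z : 'rV[R]_d * 'rV[R]_d,
        `|f z.1 - f z.2| * kbar k z.1 z.2 <= M * enorm (z.1 - z.2) `^ a] =
      \bigcap_z ((fun f : space => `|f z.1 - f z.2| * kbar k z.1 z.2) @^-1`
        [set t | t <= M * enorm (z.1 - z.2) `^ a]).
    by apply/seteqP; split=> f H x; [move=> _; exact: H|exact: (H x I)].
  apply: closed_bigI => z _; apply: closed_comp; last exact: closed_le.
  move=> f _; exact: (cvgMr_tmp (cvg_norm (cvgB (cev z.1 f) (cev z.2 f)))).
move=> f [H1 _] x; rewrite /Q /= in_itv/= -ler_norml.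
by rewrite ler_pdivlMr ?weight_gt0.
Qed.

(** Far away the ratio of the weights is below 1, and on the remaining ball the
    positive continuous weight [k] is bounded away from 0. *)
Lemma ll_lesssim k k' : weight k -> weight k' -> weight_ll k' k ->
  exists2 c, 0 <= c & forall x, k' x <= c * k x.
Proof.
move=> wk wk' /cvgrPdist_le/(_ _ ltr01)[r rP].
have [_ k'0 [K KP]] := wk'; have [_ k0 _] := wk.
have [B B0 BP] := compact_bound (@compact_ball R d r) (continuous_weightV wk).
exists (1 + `|K| * B); first by rewrite addr_ge0// mulr_ge0.
move=> x; have [xr|xr] := leP (enorm x) r.
  have h : (k x)^-1 <= B.
    apply: le_trans (ler_norm _) _; apply: BP.
    exact: le_trans (norm_le_enorm x) xr.
  have h1 : 1 <= B * k x by rewrite -ler_pdivrMr// mul1r.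
  apply: (le_trans (KP x)); apply: (le_trans (ler_norm _)).
  rewrite mulrDl mul1r; apply: (@le_trans _ _ (`|K| * B * k x)).
    by rewrite -mulrA ler_peMr.
  by rewrite lerDr ltW.
have := rP _ xr; rewrite /= sub0r normrN ger0_norm; last by rewrite divr_ge0// ltW.
rewrite ler_pdivrMr// mul1r => /le_trans; apply.
by rewrite ler_peMl ?(ltW (k0 x))// lerDl mulr_ge0.
Qed.

End HoelderCompactness.

Section HoelderSpaces.
Context {R : realType} {d : nat}.
Implicit Types (x y : 'rV[R]_d) (k f g : 'rV[R]_d -> R) (a r s c e M : R).

Definition hn a k f : R := fine (hnorm a k f).

Lemma hnorm_ge0 a k f : weight k -> (0 <= hnorm a k f)%E.
Proof.
move=> wk; rewrite /hnorm le_max; apply/orP; left.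
apply: (@le_trans _ _ (`|f 0| * k 0)%:E).
  by rewrite lee_fin mulr_ge0// ltW// weight_gt0.
by apply: ereal_sup_ubound; exists 0.
Qed.

Lemma hnE a k f : weight k -> Ca a k f -> hnorm a k f = (hn a k f)%:E.
Proof.
move=> wk [h _]; rewrite /hn fineK// ge0_fin_numE//.
exact: hnorm_ge0.
Qed.

Lemma Ca_hle a k f : weight k -> Ca a k f -> hle a k f (hn a k f).
Proof. by move=> wk cf; apply/hnorm_le => //; rewrite -hnE. Qed.

Lemma hn_ge0 a k f : weight k -> 0 <= hn a k f.
Proof. by move=> wk; rewrite /hn fine_ge0// hnorm_ge0. Qed.

Lemma hle_hn a k f r : weight k -> hle a k f r -> hn a k f <= r.
Proof.
move=> wk hf; have := hle_ge0 wk hf => r0.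
move/(hnorm_le _ _ _ wk) : hf => hf; rewrite /hn -lee_fin fineK//.
rewrite ge0_fin_numE ?hnorm_ge0//; apply: le_lt_trans hf _; exact: ltry.
Qed.

Lemma hle_Ca a k f r : weight k -> (a = 0 -> continuous f) -> hle a k f r -> Ca a k f.
Proof.
move=> wk cf hf; split=> //; apply: (@le_lt_trans _ _ r%:E); last exact: ltry.
exact/hnorm_le.
Qed.

Lemma hle_Ca_pos a k f r : weight k -> 0 < a -> hle a k f r -> Ca a k f.
Proof. by move=> wk a0; apply: hle_Ca => // a00; move: a0; rewrite a00 ltxx. Qed.

Lemma Ca_Ck a k k' c f : weight k -> weight k' -> 0 < a -> 0 <= c ->
  (forall x, k' x <= c * k x) -> Ca a k f -> Ck k' f.
Proof.
move=> wk wk' a0 c0 kk cf; have hf := Ca_hle wk cf.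
split; first exact: hle_continuous hf.
apply: (@le_lt_trans _ _ (c * hn a k f)%:E); last exact: ltry.
apply/ereal_supP => _ [x _ <-]; rewrite lee_fin.
have [f1 _] := hf; apply: (@le_trans _ _ (`|f x| * (c * k x))); first by rewrite ler_wpM2l.
by rewrite mulrCA ler_wpM2l.
Qed.

Lemma Ca_embed a a' k k' f : weight k -> weight k' -> weight_ll k' k ->
  0 <= a' -> a' < a -> Ca a k f -> Ca a' k' f.
Proof.
move=> wk wk' ll a0 aa cf; have [c c0 cP] := ll_lesssim wk wk' ll.
have hf := Ca_hle wk cf.
apply: (hle_Ca wk' _ (hle_embed wk wk' a0 (ltW aa) c0 cP hf)) => _.
by apply: (hle_continuous wk _ hf); exact: le_lt_trans aa.
Qed.

(** A function of the stronger space lies in the little space of the weaker one: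
    the ratio of the weights tends to 0, and so does the gained power of the
    distance. *)
Lemma Ca_little a a' k k' f : (0 < d)%N -> weight k -> weight k' ->
  weight_ll k' k -> 0 <= a' -> a' < a -> Ca a k f -> little_ca a' k' f.
Proof.
move=> d0 wk wk' ll a0 aa cf; have hf := Ca_hle wk cf.
have [c c0 cP] := ll_lesssim wk wk' ll.
set M := hn a k f in hf; have M0 : 0 <= M := hn_ge0 _ _ wk.
have M1 : 0 < M + 1 by rewrite ltr_wpDl.
have aa0 : 0 < a - a' by rewrite subr_gt0.
split; first exact: Ca_embed cf.
  apply/cvgrPdist_le => e e0.
  have e1 : 0 < e / (M + 1) by rewrite divr_gt0.
  move/cvgrPdist_le : (ll) => /(_ _ e1)[r rP].
  exists r => x xr; rewrite sub0r normrN normrM normr_id (ger0_norm (ltW (weight_gt0 x wk'))).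
  have := rP _ xr; rewrite /= sub0r normrN ger0_norm; last first.
    by rewrite divr_ge0// ltW// weight_gt0.
  rewrite ler_pdivrMr ?weight_gt0// => h.
  apply: (@le_trans _ _ (`|f x| * (e / (M + 1) * k x))); first by rewrite ler_wpM2l.
  rewrite mulrCA mulrAC ler_pdivrMr// ler_wpM2l ?(ltW e0)//.
  by have [f1 _] := hf; apply: (le_trans (f1 x)); rewrite lerDl.
have up : (fun t : R => (c * M * t `^ (a - a'))%:E) t @[t --> 0^'+] --> 0%E.
  have up0 : c * M * t `^ (a - a') @[t --> 0^'+] --> c * M * 0.
    by apply: cvgMl_tmp; exact: powR_cvg0.
  rewrite mulr0 in up0; apply/fine_cvgP; split; last exact: up0.
  by near=> t.
apply: squeeze_cvge; [|exact: cvg_cst|exact: up].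
near=> t; have t0 : 0 < t by near: t; exact: nbhs_right_gt.
apply/andP; split.
  have dd : 0 < d%:R + 1 :> R by rewrite ltr_wpDl.
  pose x : 'rV[R]_d := const_mx (t / 2 / (d%:R + 1)).
  have x0 : x != 0.
    apply/eqP => /matrixP/(_ ord0 (Ordinal d0)); rewrite !mxE => /eqP.
    by rewrite gt_eqF// divr_gt0// divr_gt0.
  apply: (@le_trans _ _ (holder_quotient a' k' f x 0)%:E).
    by rewrite lee_fin mulr_ge0 ?kbar_ge0// divr_ge0 ?powR_ge0.
  apply: ereal_sup_ubound; exists (x, 0) => //=; split=> //.
  rewrite subr0; apply: (le_lt_trans (enorm_le_norm x)).
  have xn : `|x| <= t / 2 / (d%:R + 1).
    rewrite [leLHS]/Num.norm/= mx_normrE; apply/bigmax_leP; split.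
      by rewrite !divr_ge0// ltW.
    by move=> i _; rewrite mxE ger0_norm// !divr_ge0// ltW.
  apply: (@le_lt_trans _ _ ((d%:R + 1) * (t / 2 / (d%:R + 1)))).
    by apply: ler_pM => //; rewrite lerDl.
  by rewrite mulrC divfK ?gt_eqF// ltr_pdivrMr// ltr_pMr// ltr1n.
apply/ereal_supP => _ [[x y] /= [xy xyt] <-]; rewrite lee_fin /holder_quotient.
have e0 := enorm_gt0 xy.
rewrite mulrAC ler_pdivrMr ?powR_gt0//.
apply: (@le_trans _ _ (`|f x - f y| * (c * kbar k x y))).
  by rewrite ler_wpM2l// kbar_mono.
have [_ f2] := hf; rewrite mulrCA; apply: (@le_trans _ _ (c * (M * enorm (x - y) `^ a))).
  by rewrite ler_wpM2l.
rewrite -[in enorm (x - y) `^ a](subrK a' a) [enorm (x - y) `^ _]powRD; last by apply/implyP => _; rewrite gt_eqF.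
rewrite !mulrA ler_wpM2r ?powR_ge0// ler_wpM2l ?mulr_ge0//.
by apply: ge0_ler_powR; rewrite ?nnegrE ltW.
Unshelve. all: by end_near. Qed.

End HoelderSpaces.

(** * Regularization with uniform Hoelder bounds *)

Section Clip.
Context {R : realType}.
Implicit Types a b s t : R.

Definition clip a b s : R := Num.max a (Num.min b s).

Lemma clip_lipschitz a b s t : `|clip a b s - clip a b t| <= `|s - t|.
Proof.
suff H s' t' : clip a b s' <= clip a b t' + `|s' - t'|.
  rewrite ler_norml lerBlDl H andbT lerNl opprB lerBlDl distrC; exact: H.
have D0 := normr_ge0 (s' - t'); have D1 := ler_norm (s' - t').
have h1 : Num.min b s' <= b by rewrite ge_min lexx.
have h2 : Num.min b s' <= s' by rewrite ge_min lexx orbT.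
have Hm : Num.min b s' - `|s' - t'| <= Num.min b t'.
  by rewrite le_min; apply/andP; split; lra.
have H1 : a <= clip a b t' by rewrite /clip le_max lexx.
have H2 : Num.min b t' <= clip a b t' by rewrite /clip le_max lexx orbT.
by rewrite [clip a b s']/clip ge_max; apply/andP; split; lra.
Qed.

Lemma clip_itv a b s : a <= b -> a <= clip a b s <= b.
Proof. by move=> ab; rewrite /clip le_max lexx ge_max ab ge_min lexx. Qed.

Lemma clip_id a b s : a <= s <= b -> clip a b s = s.
Proof. by move=> /andP[as_ sb]; rewrite /clip min_r// max_r. Qed.

End Clip.

Section Cutoff.
Context {R : realType} {d : nat}.
Implicit Types (x y : 'rV[R]_d) (r : R).

Definition cutoff r x : R := clip 0 1 (r + 1 - `|x|).

Lemma cutoff_ge0 r x : 0 <= cutoff r x.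
Proof. by have /andP[] := clip_itv (r + 1 - `|x|) (@ler01 R). Qed.

Lemma cutoff_le1 r x : cutoff r x <= 1.
Proof. by have /andP[] := clip_itv (r + 1 - `|x|) (@ler01 R). Qed.

Lemma cutoff1 r x : `|x| <= r -> cutoff r x = 1.
Proof.
move=> xr; have h : 1 <= r + 1 - `|x| by lra.
by rewrite /cutoff /clip min_l// max_r.
Qed.

Lemma cutoff0 r x : r + 1 <= `|x| -> cutoff r x = 0.
Proof.
move=> xr; have h : r + 1 - `|x| <= 0 by lra.
by rewrite /cutoff /clip min_r ?max_l//; lra.
Qed.

Lemma cutoff_lipschitz r x y : `|cutoff r x - cutoff r y| <= `|x - y|.
Proof.
apply: (le_trans (clip_lipschitz _ _ _ _)).
by rewrite opprD addrACA subrr add0r opprK addrC distrC ler_dist_dist.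
Qed.

Lemma cutoff_holder r a x y : 0 < a <= 1 ->
  `|cutoff r x - cutoff r y| <= enorm (x - y) `^ a.
Proof.
move=> /andP[a0 a1]; have [->|xy] := eqVneq x y.
  by rewrite subrr normr0 powR_ge0.
have t0 := enorm_gt0 xy.
have [t1|/ltW t1] := leP (enorm (x - y)) 1.
  apply: (le_trans (cutoff_lipschitz _ _ _)); apply: (le_trans (norm_le_enorm _)).
  by apply: ger1_powR => //; rewrite t0.
apply: (@le_trans _ _ 1).
  have := cutoff_ge0 r x; have := cutoff_ge0 r y.
  have := cutoff_le1 r x; have := cutoff_le1 r y => ? ? ? ?.
  by rewrite ler_norml; apply/andP; split; lra.
by rewrite -(powRr0 (enorm (x - y))) ler_powR// ltW.
Qed.

Lemma continuous_cutoff r : continuous (cutoff r).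
Proof.
by apply: (lipschitz_continuous ler01) => x y; rewrite mul1r cutoff_lipschitz.
Qed.

End Cutoff.

Section InfConvolution.
Context {R : realType} {d : nat}.
Variables (g : 'rV[R]_d -> R) (B n : R).
Hypothesis gB : forall x, `|g x| <= B.
Hypothesis n0 : 0 < n.
Implicit Types x y : 'rV[R]_d.

(** The largest minorant of [g] that is [n]-Lipschitz for the maximum norm. *)
Definition infconv x : R := inf (range (fun y => g y + n * `|x - y|)).

Let lb x : has_inf (range (fun y => g y + n * `|x - y|)).
Proof.
split; first by exists (g x + n * `|x - x|); exists x.
exists (- B) => _ [y _ <-]; have := gB y; rewrite ler_norml => /andP[h _].
by apply: (le_trans h); rewrite lerDl mulr_ge0// ltW.
Qed.

Lemma infconv_le x y : infconv x <= g y + n * `|x - y|.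
Proof. by apply: inf_lbound; [case: (lb x)|exists y]. Qed.

Lemma infconv_le_self x : infconv x <= g x.
Proof. by apply: (le_trans (infconv_le x x)); rewrite subrr normr0 mulr0 addr0. Qed.

Lemma infconv_near e x : 0 < e -> exists y, g y + n * `|x - y| < infconv x + e.
Proof.
by move=> e0; have [_ [y _ <-] h] := inf_adherent e0 (lb x); exists y.
Qed.

(** Since [g] is bounded, a distant competitor is too expensive. *)
Lemma infconv_local e x : 0 < e -> e <= 1 -> exists2 y,
  g y + n * `|x - y| < infconv x + e & `|x - y| <= (2 * B + 1) / n.
Proof.
move=> e0 e1; have [y yP] := infconv_near x e0; exists y => //.
rewrite ler_pdivlMr// mulrC.
have := infconv_le_self x; have := gB x; have := gB y.
rewrite !ler_norml => /andP[? ?] /andP[? ?] ?; lra.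
Qed.

Lemma infconv_bound x : `|infconv x| <= B.
Proof.
have := gB x; rewrite !ler_norml => /andP[_ h]; apply/andP; split; last first.
  exact: le_trans (infconv_le_self x) h.
apply/ler_addgt0Pr => e e0; have [y yP] := infconv_near x e0.
have := gB y; rewrite ler_norml => /andP[h' _].
by apply: le_trans (ltW yP); apply: (le_trans h'); rewrite lerDl mulr_ge0// ltW.
Qed.

Lemma infconv_lipschitz x y : `|infconv x - infconv y| <= n * enorm (x - y).
Proof.
wlog suff : x y / infconv x - infconv y <= n * enorm (x - y).
  move=> W; rewrite ler_norml W andbT lerNl opprB enormB; exact: W.
rewrite lerBlDr; apply/ler_addgt0Pr => e e0; have [z zP] := infconv_near y e0.
apply: (le_trans (infconv_le x z)).
have := ler_wpM2l (ltW n0) (ler_distD y x z).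
have := ler_wpM2l (ltW n0) (norm_le_enorm (x - y)).
by rewrite mulrDr; lra.
Qed.

(** A translate of the competitor for [x'] competes for [x]: inf-convolution does
    not increase the modulus of translations, so it keeps Hoelder bounds. *)
Lemma infconv_diff (x x' z : 'rV[R]_d) e : g z + n * `|x' - z| < infconv x' + e ->
  infconv x - infconv x' <= g (z + (x - x')) - g z + e.
Proof.
move=> zP; have := infconv_le x (z + (x - x')).
have -> : x - (z + (x - x')) = x' - z by rewrite opprD opprB addrC -addrA subrK addrC.
lra.
Qed.

End InfConvolution.

Section Regularization.
Context {R : realType} {d : nat}.
Variables (k g : 'rV[R]_d -> R) (a M : R).
Hypothesis wk : weight k.
Hypothesis a01 : 0 < a <= 1.
Hypothesis hg : hle a k g M.
Implicit Types (x y : 'rV[R]_d) (r : R).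

Let v x := (k x)^-1.
Let v0 x : 0 < v x. Proof. by rewrite invr_gt0 weight_gt0. Qed.
Let M0 : 0 <= M. Proof. exact: hle_ge0 hg. Qed.

Let gM x : `|g x| <= M * v x.
Proof. by case: hg => h _; rewrite ler_pdivlMr ?weight_gt0. Qed.

Let kbarV x y : kbar k x y = 2 / (v x + v y). Proof. exact: kbarE. Qed.

Let gdiff x y : `|g x - g y| <= M * enorm (x - y) `^ a * ((v x + v y) / 2).
Proof.
case: hg => _ /(_ x y); rewrite kbarV mulrA ler_pdivrMr ?addr_gt0// => h.
by rewrite mulrA ler_pdivlMr.
Qed.

Let cv : continuous v. Proof. exact: continuous_weightV. Qed.

(** The function [g0 r] is cut off at radius [r].  To keep its pointwise bounds
    under small shifts, [v = 1 / k] is cut off one unit further out: [v1 r] is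
    uniformly continuous and equals [v] wherever [g0 r] does not vanish. *)
Let g0 r x := cutoff r x * g x.
Let v1 r x := cutoff (r + 1) x * v x.

Let v1_le r x : v1 r x <= v x.
Proof. by rewrite /v1 ler_piMl ?cutoff_le1// ltW. Qed.

Let v1_ge0 r x : 0 <= v1 r x.
Proof. by rewrite mulr_ge0 ?cutoff_ge0// ltW. Qed.

Let g0_bound r x : `|g0 r x| <= M * v1 r x.
Proof.
have [xr|/ltW xr] := leP `|x| (r + 1).
  rewrite /v1 cutoff1// mul1r; apply: le_trans (gM x).
  by rewrite normrM ger0_norm ?cutoff_ge0// ler_piMl// cutoff_le1.
by rewrite /g0 cutoff0// mul0r normr0 mulr_ge0.
Qed.

Let g0_diff r x y : `|g0 r x - g0 r y| <=
  3 * M * enorm (x - y) `^ a * ((v1 r x + v1 r y) / 2).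
Proof.
wlog yx : x y / `|y| <= `|x|.
  move=> W; have [/W//|/ltW/W] := leP `|y| `|x|.
  by rewrite distrC enormB [v1 r y + _]addrC.
set t := enorm (x - y) `^ a; have t0 : 0 <= t by exact: powR_ge0.
have Mt : 0 <= M * t by exact: mulr_ge0.
have [yr|/ltW yr] := leP (r + 1) `|y|.
  have xr : r + 1 <= `|x| by exact: le_trans yx.
  rewrite /g0 !cutoff0// !mul0r subrr normr0.
  by rewrite mulr_ge0 ?divr_ge0 ?addr_ge0// -mulrA mulr_ge0.
have ey : v1 r y = v y by rewrite /v1 cutoff1// mul1r.
have E1 : `|g y| * `|cutoff r x - cutoff r y| <= M * t * v y.
  rewrite mulrAC; apply: ler_pM => //; exact: cutoff_holder.
have vy := v0 y; have vx := v0 x.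
have [xr|/ltW xr] := leP `|x| (r + 1); last first.
  rewrite /g0 (cutoff0 xr) mul0r sub0r normrN.
  have -> : cutoff r y = - (cutoff r x - cutoff r y) by rewrite (cutoff0 xr) sub0r opprK.
  rewrite normrM normrN mulrC ey; apply: (le_trans E1).
  have := mulr_ge0 Mt (v1_ge0 r x); have := mulr_ge0 Mt (ltW vy); lra.
have ex : v1 r x = v x by rewrite /v1 cutoff1// mul1r.
have -> : g0 r x - g0 r y = cutoff r x * (g x - g y) + g y * (cutoff r x - cutoff r y).
  by rewrite /g0; ring.
apply: (le_trans (ler_normD _ _)); rewrite !normrM (ger0_norm (cutoff_ge0 _ _)).
have E2 : cutoff r x * `|g x - g y| <= M * t * ((v x + v y) / 2).
  by apply: le_trans (gdiff x y); rewrite ler_piMl// cutoff_le1.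
rewrite ex ey; have := mulr_ge0 Mt (ltW vx); have := mulr_ge0 Mt (ltW vy).
lra.
Qed.

Let v_bounded r : exists2 V, 0 <= V & forall x, v1 r x <= V.
Proof.
have [B B0 BP] := compact_bound (@compact_ball R d (r + 2)) cv.
exists B => // x; have [xr|/ltW xr] := leP `|x| (r + 2).
  by apply: (le_trans (v1_le r x)); apply: (le_trans (ler_norm _)); exact: BP.
by rewrite /v1 cutoff0 ?mul0r//; lra.
Qed.

Let v1_uniform r s : 0 < s ->
  exists2 e, 0 < e & forall x y, `|x - y| <= e -> `|v1 r x - v1 r y| <= s.
Proof.
move=> s0; have cv1 : continuous (v1 r).
  move=> x; apply: (cvgM (F := nbhs x)); [exact: continuous_cutoff|exact: cv].
have [e e0 eP] := compact_uniform (@compact_ball R d (r + 2)) cv1 s0.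
exists e => // x y xy; have [xr|/ltW xr] := leP `|x| (r + 2); first exact: eP.
have [yr|/ltW yr] := leP `|y| (r + 2).
  by rewrite distrC; apply: eP => //; rewrite distrC.
by rewrite /v1 !cutoff0 ?mul0r ?subrr ?normr0 ?(ltW s0)//; lra.
Qed.

(** Bounded Lipschitz approximation, uniform on a ball, that loses only a fixed
    factor in the Hoelder norm.  Cutting off costs a factor 3.  Inf-convolution
    with a steep cone then moves points by at most [eta], over which [v1 r]
    varies by at most a lower bound of [v]; this costs another factor 2. *)
Lemma regularization r e : 0 < e -> exists f B n,
  [/\ hle a k f (6 * M), forall x, enorm x <= r -> `|f x - g x| <= e,
      0 <= B /\ forall x, `|f x| <= B &
      0 <= n /\ forall x y, `|f x - f y| <= n * enorm (x - y)].
Proof.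
move=> e0; have [V V0 VP] := v_bounded r.
have [_ k0 [K KP]] := wk.
have K0 : 0 < K by exact: lt_le_trans (k0 0) (KP 0).
have vK x : K^-1 <= v x by rewrite /v lef_pV2 ?posrE.
have K10 : 0 < K^-1 by rewrite invr_gt0.
have [s s0 sP] := v1_uniform r K10.
have [a0 a1] := andP a01.
have C0 : 0 < 3 * M * V + 1 by rewrite ltr_wpDl// -mulrA mulr_ge0// mulr_ge0.
have e1 : 0 < e / 2 / (3 * M * V + 1) by rewrite !divr_gt0.
have [s' s'0 s'P] := powR_small a0 e1.
have d0 : 0 < d%:R + 1 :> R by rewrite ltr_wpDl.
pose eta := Num.min s (s' / (d%:R + 1)).
have eta0 : 0 < eta by rewrite lt_min s0 divr_gt0.
pose B := M * V.
have B0 : 0 <= B by exact: mulr_ge0.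
have gB x : `|g0 r x| <= B by apply: (le_trans (g0_bound r x)); exact: ler_wpM2l.
have B1 : 0 < 2 * B + 1 by rewrite ltr_wpDl// mulr_ge0.
pose n := (2 * B + 1) / eta.
have n0 : 0 < n by rewrite divr_gt0.
have ne : (2 * B + 1) / n = eta.
  by rewrite /n invf_div mulrCA divff ?mulr1// gt_eqF.
have loc z : 0 < z -> forall x, exists2 y,
    g0 r y + n * `|x - y| < infconv (g0 r) n x + z & `|x - y| <= eta.
  move=> z0 x; have z1 : 0 < Num.min z 1 by rewrite lt_min z0 ltr01.
  have [||y yP ye] := @infconv_local _ _ (g0 r) B n gB n0 (Num.min z 1) x; rewrite ?ge_min ?lexx ?orbT//.
  exists y; last by rewrite -ne.
  by apply: (lt_le_trans yP); rewrite lerD2l ge_min lexx.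
have v12 x y : `|x - y| <= eta -> v1 r y <= 2 * v x.
  move=> xy; have : `|x - y| <= s by apply: (le_trans xy); rewrite ge_min lexx.
  rewrite distrC => /sP/(le_trans (ler_norm _)).
  have := vK x; have := v1_le r x; lra.
exists (infconv (g0 r) n), B, n; split.
- split=> [x|x y].
    rewrite -ler_pdivlMr ?weight_gt0// -/(v x) ler_norml.
    have Mv : 0 <= M * v x by rewrite mulr_ge0// ltW.
    apply/andP; split; last first.
      apply: (le_trans (infconv_le_self gB n0 x)); apply: (le_trans (ler_norm _)).
      apply: (le_trans (g0_bound r x)).
      have := ler_wpM2l M0 (v1_le r x); lra.
    apply/ler_addgt0Pr => z z0; have [y yP xy] := loc z z0 x.
    have := ler_wpM2l M0 (v12 _ _ xy).
    have := g0_bound r y; rewrite ler_norml => /andP[h _].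
    have := mulr_ge0 (ltW n0) (normr_ge0 (x - y)); lra.
  rewrite kbarV mulrA ler_pdivrMr ?addr_gt0//.
  suff H : forall x y, infconv (g0 r) n x - infconv (g0 r) n y <=
      3 * M * enorm (x - y) `^ a * (v x + v y).
    have H1 := H x y; have := H y x; rewrite enormB [v y + _]addrC => H2.
    have : `|infconv (g0 r) n x - infconv (g0 r) n y| <= 3 * M * enorm (x - y) `^ a * (v x + v y).
      by rewrite ler_norml H1 andbT; lra.
    lra.
  move=> {}x {}y.
  apply/ler_addgt0Pr => z z0; have [w wP yw] := loc z z0 y.
  apply: (le_trans (infconv_diff gB n0 x wP)).
  rewrite lerD2r; apply: (le_trans (ler_norm _)); apply: (le_trans (g0_diff r _ _)).
  rewrite [_ + (x - y) - _]addrC addKr.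
  have xw : `|x - (w + (x - y))| <= eta.
    by rewrite (_ : _ - _ = y - w)// opprD opprB addrC -addrA subrK addrC.
  apply: ler_wpM2l; first by rewrite mulr_ge0 ?powR_ge0// mulr_ge0.
  have := v12 _ _ xw; have := v12 _ _ yw; lra.
- move=> x xr; have xr' := le_trans (norm_le_enorm x) xr.
  have gx : g0 r x = g x by rewrite /g0 cutoff1// mul1r.
  rewrite distrC ger0_norm ?subr_ge0 -?gx; last exact: infconv_le_self.
  have e20 : 0 < e / 2 by rewrite divr_gt0.
  have [y yP xy] := loc _ e20 x.
  have nxy := mulr_ge0 (ltW n0) (normr_ge0 (x - y)).
  have D : g0 r x - g0 r y <= e / 2.
    apply: (le_trans (ler_norm _)); apply: (le_trans (g0_diff r _ _)).
    apply: (@le_trans _ _ (3 * M * (e / 2 / (3 * M * V + 1)) * V)).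
      apply: ler_pM.
      - by rewrite mulr_ge0 ?powR_ge0// mulr_ge0.
      - by rewrite divr_ge0// addr_ge0.
      - rewrite ler_wpM2l ?mulr_ge0//; apply: s'P; first exact: enorm_ge0.
        apply: (le_trans (enorm_le_norm _)).
        apply: (@le_trans _ _ ((d%:R + 1) * (s' / (d%:R + 1)))).
          apply: ler_pM => //; first by rewrite lerDl.
          by apply: (le_trans xy); rewrite ge_min lexx orbT.
        by rewrite mulrC divfK ?gt_eqF.
      - have := VP x; have := VP y; lra.
    rewrite (_ : 3 * M * (e / 2 / (3 * M * V + 1)) * V = (e / 2 * (3 * M * V)) / (3 * M * V + 1)); last first.
      by field; rewrite gt_eqF.
    by rewrite ler_pdivrMr// ler_wpM2l ?(ltW e20)// lerDl.
  lra.
- split=> // x; exact: infconv_bound.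
- split=> [|x y]; first exact: ltW.
  exact: infconv_lipschitz gB n0 x y.
Qed.

End Regularization.

(** * Ridge networks with values in a function space *)

Section Networks.
Context {R : realType} {d : nat}.
Local Notation fn := ('rV[R]_d -> R).
Variables (H : set (fn -> R)) (rho : R -> R) (L : set fn).
Hypothesis L0 : L (fun=> 0).
Hypothesis LZ : forall (a : R) f, L f -> L (fun x => a * f x).

Definition network (Phi : fn -> fn) := exists s : seq ((fn -> R) * fn),
  (forall hy, List.In hy s -> H hy.1 /\ L hy.2) /\
  forall f x, Phi f x = \sum_(hy <- s) hy.2 x * rho (hy.1 f).

(** Output functions are scaled to absorb the coefficients of ridge functions. *)
Lemma network_sum (J : finType) (v : J -> fn -> R) (y : J -> fn) :
  (forall j, ridge_span rho H (v j)) -> (forall j, L (y j)) ->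
  network (fun f x => \sum_j v j f * y j x).
Proof.
move=> rv Ly.
have one j : network (fun f x => v j f * y j x).
  elim: (rv j) => [|a h w Hh _ [s [sHL sE]]].
    by exists [::]; split=> // f x; rewrite big_nil mul0r.
  exists ((h, fun x => a * y j x) :: s); split.
    by move=> hy /= [<-|/sHL//]; split=> //=; exact: LZ.
  by move=> f x; rewrite big_cons -sE/=; ring.
elim: (index_enum J) => [|j s [s1 [H1 E1]]].
  by exists [::]; split=> // f x; rewrite !big_nil.
have [s2 [H2 E2]] := one j; exists (s2 ++ s1); split.
  by move=> hy /(List.in_app_or _ _ _)[/H2|/H1].
by move=> f x; rewrite big_cons big_cat/= E1 E2.
Qed.

(** A zero summand is appended, because the sum in [chernoff_neural] is not empty. *)
Lemma network_chernoff alpha kappa kappa0 Phi : weight kappa -> 0 < alpha ->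
  H (fun=> 0) -> L `<=` Ca alpha kappa -> network Phi ->
  chernoff_neural alpha kappa kappa0 H rho L Phi.
Proof.
move=> wk a0 H0 Lsub [s [sHL sE]].
pose z : (fn -> R) * fn := (fun=> 0, fun=> 0).
have zHL i : H (nth z s i).1 /\ L (nth z s i).2.
  elim: s sHL {sE} i => [|hy s IH] sHL [|i] //=.
    by apply: sHL; left.
  by apply: IH => hy' hs; apply: sHL; right.
have E f x : Phi f x =
    \sum_(m < (size s).+1) (nth z s m).2 x * rho ((nth z s m).1 f).
  rewrite sE big_ord_recr/= [X in _ + X * _](_ : _ = 0) ?mul0r ?addr0.
    by rewrite (big_nth z) big_mkord.
  by rewrite nth_default.
split.
  move=> f _; have -> : Phi f =
      (fun x => \sum_(m < (size s).+1) rho ((nth z s m).1 f) * (nth z s m).2 x).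
    by apply/funext => x; rewrite E; apply: eq_bigr => m _; rewrite mulrC.
  apply: (hle_Ca_pos wk a0); apply: hle_sum => // m.
  by apply: Ca_hle => //; apply: Lsub; case: (zHL m).
exists (size s).+1, (fun m => (nth z s m).1), (fun m => (nth z s m).2).
by split=> // [m|m]; case: (zHL m).
Qed.

End Networks.

(** * Approximation of one step of the scheme *)

Lemma near_minimizer {R : realType} {T : Type} (C : set T) (N : T -> R) :
  C !=set0 -> (forall x, 0 <= N x) ->
  exists2 x, C x & forall y, C y -> N x <= N y + 1.
Proof.
move=> [x0 Cx0] N0.
have hi : has_inf (N @` C).
  by split; [exists (N x0), x0|exists 0 => _ [x _ <-]].
have [_ [x Cx <-] h] := inf_adherent ltr01 hi.
exists x => // y Cy; apply: (le_trans (ltW h)); rewrite lerD2r.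
by apply: inf_lbound; [case: hi|exists y].
Qed.

(** On balls of the stronger space the topology of pointwise convergence, for
    which they are compact, is finer than the weaker norm. *)
Lemma ptws_near_hle {R : realType} {d : nat} (a b : R)
    (k kb : 'rV[R]_d -> R) (M e : R) (f0 : {ptws 'rV[R]_d -> R}) :
  weight k -> weight kb -> weight_ll k kb -> 0 <= a -> a < b -> 0 < e ->
  hle b kb f0 M -> \forall f \near f0, hle b kb f M -> hle a k (f \- f0) e.
Proof.
move=> wk wkb ll a0 ab e0 hf0; have b0 : 0 < b by exact: le_lt_trans ab.
have [c c0 cP] := ll_lesssim wkb wk ll.
have [r [s [s0 sP]]] := hle_interpolate (M + M) wkb wk a0 ab c0 cP ll e0.
have := ptws_near_ball r wkb b0 s0 hf0.
apply: (@filterS _ _ (nbhs_filter f0)) => f fP hf.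
by apply: sP; [exact: hle_sub|exact: fP].
Qed.

(** Bounded Lipschitz functions lie in every Hoelder space of the scale: the
    Lipschitz bound serves close points, boundedness the others. *)
Lemma hle_lipschitz {R : realType} {d : nat} (a : R) (k f : 'rV[R]_d -> R)
    (K B m : R) :
  weight k -> (forall x, k x <= K) -> 0 <= a <= 1 -> 0 <= B ->
  (forall x, `|f x| <= B) -> 0 <= m ->
  (forall x y, `|f x - f y| <= m * enorm (x - y)) ->
  hle a k f (2 * m * K + 4 * B * K).
Proof.
move=> wk kK /andP[a0 a1] B0 fB m0 fm.
have K0 : 0 <= K by apply: le_trans (kK 0); rewrite ltW// weight_gt0.
have mK := mulr_ge0 m0 K0; have BK := mulr_ge0 B0 K0.
have fK x : `|f x| * k x <= B * K.
  by apply: ler_pM => //; rewrite ltW// weight_gt0.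
split=> [x|x y]; first by apply: (le_trans (fK x)); lra.
have [->|xy] := eqVneq x y.
  by rewrite !subrr normr0 mul0r mulr_ge0 ?powR_ge0//; lra.
have t0 := enorm_gt0 xy; have kb0 := kbar_ge0 x y wk.
have kbK : kbar k x y <= 2 * K.
  by apply: (le_trans (kbar_lel x y wk)); rewrite ler_wpM2l.
have [t1|/ltW t1] := leP (enorm (x - y)) 1.
  apply: (@le_trans _ _ (m * enorm (x - y) * (2 * K))); first by apply: ler_pM.
  have := @ger1_powR R (enorm (x - y)) a; rewrite t0 t1 => /(_ isT a1) h.
  rewrite (_ : m * _ * _ = 2 * m * K * enorm (x - y)); last by ring.
  apply: ler_pM => //; last by lra.
  by rewrite -mulrA mulr_ge0.
  exact: ltW.
have t2 : 1 <= enorm (x - y) `^ a.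
  by rewrite -[X in X <= _](powRr0 (enorm (x - y))) ler_powR.
apply: (le_trans (hle_diff_le wk (fK x) (fK y))).
rewrite -[leLHS]mulr1; apply: ler_pM => //; last by lra.
by rewrite mulr_ge0// addr_ge0.
Qed.

Section OneStep.
Context {R : realType} {d : nat}.
Local Notation fn := ('rV[R]_d -> R).
Local Notation space := {ptws 'rV[R]_d -> R}.
Variables (alpha p omega : R) (kappa kappa0 : fn) (KK : set fn)
  (h : nat -> R) (I : nat -> fn -> fn) (H : set (fn -> R)) (rho : R -> R)
  (L : set fn).
Hypothesis hd : (0 < d)%N.
Hypothesis alpha1 : alpha <= 1.
Hypothesis hp : 1 < p.
Hypothesis wkappa : weight kappa.
Hypothesis wkappa0 : weight kappa0.
Hypothesis hext : extension_conditions alpha kappa kappa0 KK omega h I.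
Hypothesis harch : architecture_conditions alpha p kappa kappa0 KK H rho L.

Variables (a b : R) (k kb : fn).
Hypothesis a0 : 0 <= a.
Hypothesis ab : a < b.
Hypothesis ba : b < alpha.
Hypothesis Kk : KK k.
Hypothesis Kkb : KK kb.
Hypothesis llk : weight_ll k kb.
Hypothesis llkb : weight_ll kb kappa.
Hypothesis llka : weight_ll k kappa.

Let b0 : 0 < b. Proof. exact: le_lt_trans ab. Qed.
Let wk : weight k. Proof. by case: (ext_weights hext Kk). Qed.
Let wkb : weight kb. Proof. by case: (ext_weights hext Kkb). Qed.

Local Notation N := (hn b kb).

Let N0 f : 0 <= N f. Proof. exact: hn_ge0. Qed.

Lemma arch_features : feature_space H.
Proof.
split; [exact: (ar_add harch)|exact: (ar_scale harch)|exact: (ar_const harch)].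
Qed.

(** The little space need not contain [g] itself, but it contains its
    regularizations, whose norm is controlled; density in the norm of (b, kb)
    then preserves this control. *)
Lemma approx_by_L (g : fn) (M e : R) : hle b kb g M -> 0 < e -> exists y,
  [/\ L y, hle b kb y (6 * M + 1) & hle a k (y \- g) e].
Proof.
move=> hg e0; have M0 := hle_ge0 wkb hg.
have [c c0 cP] := ll_lesssim wkb wk llk.
have e20 : 0 < e / 2 by rewrite divr_gt0.
have [r [s [s0 sP]]] := hle_interpolate (6 * M + M) wkb wk a0 ab c0 cP llk e20.
have b1 : 0 < b <= 1 by rewrite b0 (le_trans (ltW ba)).
have [f [B [m [hf fg [B0 fB] [m0 fm]]]]] := regularization wkb b1 hg r s0.
have c1 : 0 < 4 * c + 1 by rewrite ltr_wpDl// mulr_ge0.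
pose e1 := Num.min 1 (e / 2 / (4 * c + 1)).
have e10 : 0 < e1 by rewrite lt_min ltr01 divr_gt0.
have fCa : Ca alpha kappa f.
  have [_ _ [K KP]] := wkappa; have alpha0 : 0 < alpha by exact: lt_trans ba.
  apply: (hle_Ca_pos wkappa alpha0 (hle_lipschitz (a := alpha) wkappa KP _ B0 fB m0 fm)).
  by rewrite (ltW alpha0).
have fl : little_ca b kb f by exact: Ca_little (ltW b0) ba fCa.
have [y Ly fy] := ar_L_dense harch (ltW b0) ba Kkb llkb fl e10.
have hfy : hle b kb (f \- y) e1 by apply/hnorm_le => //; exact: ltW.
have hyf : hle b kb (fun x => -1 * (f \- y) x) e1.
  by have := hle_scale (-1) hfy; rewrite normrN1 mul1r.
exists y; split=> //.
  have -> : y = (fun x => f x + -1 * (f \- y) x).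
    by apply/funext => x /=; ring.
  apply: hle_le (hle_add wkb hf hyf).
  by rewrite lerD2l ge_min lexx.
have -> : y \- g = (fun x => (f \- g) x + -1 * (f \- y) x).
  by apply/funext => x /=; ring.
rewrite [e]splitr; apply: hle_add => //.
  by apply: sP; [exact: hle_sub|exact: fg].
apply: hle_le (hle_embed wkb wk a0 (ltW ab) c0 cP hyf).
apply: (@le_trans _ _ (4 * c * (e / 2 / (4 * c + 1)))).
  by rewrite ler_wpM2l ?mulr_ge0// ge_min lexx orbT.
by apply: mul_frac_le; [exact: mulr_ge0|exact: ltW].
Qed.

Lemma hn_feature_bound h1 : H h1 -> exists2 C, 0 <= C &
  forall f, Ca b kb f -> 1 + `|h1 f| <= C * (1 + N f).
Proof.
move=> Hh; have := ar_growth harch a0 ab (ltW ba) Kk Kkb llk Hh.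
set S := ereal_sup _ => Sfin.
have SP f : Ca b kb f -> (((1 + `|h1 f|) / (1 + N f))%:E <= S)%E.
  by move=> cf; apply: ereal_sup_ubound; exists f.
have zCa : Ca b kb (fun=> 0) by exact: hle_Ca_pos (hle0 b wkb).
have Sge := SP _ zCa.
have Sn : S \is a fin_num.
  rewrite ge0_fin_numE//; apply: le_trans Sge; rewrite lee_fin.
  by rewrite divr_ge0// addr_ge0.
exists (fine S).
  rewrite -lee_fin fineK//; apply: le_trans Sge; rewrite lee_fin.
  by rewrite divr_ge0// addr_ge0.
move=> f cf; rewrite -ler_pdivrMr ?ltr_pwDl//.
by rewrite -lee_fin fineK// SP.
Qed.

(** The one-dimensional approximation of [cos] is composed with each feature,
    whose linear growth turns the weight on the line into a power of the norm. *)
Lemma trig_to_activation (w : fn -> R) (e : R) : ridge_span cos H w -> 0 < e ->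
  exists2 v, ridge_span rho H v &
    forall f, Ca b kb f -> `|w f - v f| <= e * (1 + N f) `^ p.
Proof.
move=> rw; have grho e' : 0 < e' -> exists2 C, 0 <= C &
    forall x, `|rho x| <= e' * wt p x + C.
  move=> e'0; have := ar_rho_growth harch.
  move/cvgrPdist_le => /(_ _ e'0)[r rP].
  have [B B0 BP] := compact_bound (@segment_compact R (- r) r) (ar_rho_continuous harch).
  exists B => // x; have [xr|xr] := leP `|x| r.
    have : `|rho x| <= B by apply: BP; rewrite /= in_itv/= -ler_norml.
    move/le_trans; apply.
    by rewrite lerDr mulr_ge0 ?wt_ge0// ltW.
  have := rP _ xr; rewrite /= sub0r normrN normrM normr_id normfV.
  rewrite (ger0_norm (powR_ge0 _ _)) ler_pdivrMr; last by rewrite powR_gt0// ltr_pwDl.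
  by move/le_trans; apply; rewrite lerDl.
have cosd := wdense_cos hp (ar_rho_continuous harch) grho (ar_rho_nonpoly harch).
elim: rw e => [|c h1 {}w Hh _ IH] e e0.
  exists (fun=> 0); first exact: ridge_zero.
  by move=> f _; rewrite subrr normr0 mulr_ge0 ?powR_ge0// ltW.
have e20 : 0 < e / 2 by rewrite divr_gt0.
have [v rv vP] := IH _ e20.
have [C C0 CP] := hn_feature_bound Hh.
have K0 : 0 < `|c| * C `^ p + 1 by rewrite ltr_wpDl// mulr_ge0// powR_ge0.
have e1 : 0 < e / 2 / (`|c| * C `^ p + 1) by rewrite divr_gt0.
have [u ru uP] := cosd _ e1.
exists (fun f => c * u (h1 f) + v f).
  apply: ridge_add => //; apply: ridge_scale.
  elim: ru {uP} => [|a' g u' [s [t ->]] _ IHu]; first exact: ridge_zero.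
  apply: (@ridge_step _ _ rho H a' (fun f => s * h1 f + t) (fun f => u' (h1 f))) => //.
  have HH := arch_features; apply: (fs_add HH); last exact: fs_const.
  exact: (fs_scale HH).
move=> f cf; rewrite opprD addrACA -mulrBr [e]splitr mulrDl.
apply: (le_trans (ler_normD _ _)); rewrite lerD ?vP// normrM.
apply: (@le_trans _ _ (`|c| * (e / 2 / (`|c| * C `^ p + 1) * (C `^ p * (1 + N f) `^ p)))).
  rewrite ler_wpM2l//; apply: (le_trans (uP _)); rewrite ler_wpM2l ?(ltW e1)//.
  rewrite -powRM ?addr_ge0//; apply: ge0_ler_powR; rewrite ?nnegrE ?mulr_ge0 ?addr_ge0 ?CP//.
  exact/ltW/(lt_trans ltr01).
rewrite (_ : `|c| * _ = (`|c| * C `^ p) / (`|c| * C `^ p + 1) * (e / 2 * (1 + N f) `^ p)); last first.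
  by field; rewrite gt_eqF.
rewrite ler_piMl//; first by rewrite mulr_ge0 ?powR_ge0// ltW.
by rewrite ler_pdivrMr// mul1r lerDl.
Qed.

Section FixedStep.
Variable n : nat.
Let E := expR (omega * h n).

Let E0 : 0 < E. Proof. exact: expR_gt0. Qed.

Let growth f : Ca b kb f -> hle b kb (I n f) (E * N f).
Proof.
move=> cf; apply/hnorm_le => //; rewrite EFinM -hnE//.
exact: (ext_growth hext n b0 (ltW ba) Kkb cf).
Qed.

Lemma step_Ca f : Ca b kb f -> Ca b kb (I n f).
Proof. by move=> cf; apply: hle_Ca_pos (growth cf). Qed.

Lemma Ca_weaken f : Ca b kb f -> Ca a k f.
Proof. exact: Ca_embed. Qed.

Lemma step_lipschitz : exists2 c, 0 <= c & forall f g e, Ca b kb f -> Ca b kb g ->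
  hle a k (f \- g) e -> hle a k (I n f \- I n g) (c * e).
Proof.
have aal : a < alpha by exact: lt_trans ba.
have [c c0 cP] := ext_lipschitz hext n a0 aal Kk llka.
exists c => // f g e cf cg fg; apply/hnorm_le => //.
apply: (le_trans (cP f g (Ca_weaken cf) (Ca_weaken cg))).
by rewrite EFinM lee_wpmul2l// hnorm_le.
Qed.

(** The second bound is what makes iteration possible: its constant does not
    depend on [e]. *)
Lemma one_step_partition e : 0 < e -> exists (J : finType) (w : J -> fn -> R)
    (y : J -> fn),
  [/\ forall j, ridge_span cos H (w j), forall j, L (y j),
      forall f, Ca b kb f ->
        hle a k (I n f \- (fun x => \sum_j w j f * y j x)) (e * (1 + N f) `^ p) &
      forall f, Ca b kb f ->
        hle b kb (fun x => \sum_j w j f * y j x) ((6 * E + 3) * (1 + N f))].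
Proof.
move=> e0; have [cI cI0 cIP] := step_lipschitz.
have [c c0 cP] := ll_lesssim wkb wk llk.
have E00 := ltW E0.
pose C1 := 4 * c * (7 * E + 1).
have C10 : 0 <= C1 by rewrite !mulr_ge0// addr_ge0// mulr_ge0.
have q0 : 0 < p - 1 by rewrite subr_gt0.
(* beyond the radius [r], order [p] absorbs the linear error bound with slope [C1] *)
pose r := (C1 / e) `^ (p - 1)^-1.
have r0 : 0 <= r by exact: powR_ge0.
have rP t : r <= t -> C1 * (1 + t) <= e * (1 + t) `^ p.
  move=> rt; have t0 : 0 <= t by exact: le_trans rt.
  rewrite -mulr_powRB1 ?addr_ge0 ?(lt_trans ltr01 hp)// mulrCA [leLHS]mulrC.
  rewrite ler_wpM2l ?addr_ge0// mulrC -ler_pdivrMr//.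
  have -> : C1 / e = r `^ (p - 1).
    by rewrite /r -powRrM mulVf ?gt_eqF// powRr1// divr_ge0// ltW.
  apply: ge0_ler_powR; [exact: ltW|by rewrite nnegrE|by rewrite nnegrE addr_ge0|].
  by apply: (le_trans rt); rewrite lerDr.
pose A := [set f : space | hle b kb f r].
have ACa f : A f -> Ca b kb f by move=> hf; exact: hle_Ca_pos hf.
have AN f : A f -> N f <= r by move=> hf; exact: hle_hn hf.
pose e1 := e / 4; have e10 : 0 < e1 by rewrite divr_gt0.
pose e2 := e1 / (cI + 1).
have e20 : 0 < e2 by rewrite divr_gt0// ltr_wpDl.
(* [D2] bounds the outputs [y j] in the stronger norm, [D] all errors in the
   weaker norm on the ball, and [eta] is the mass allowed to be misplaced *)
pose D2 := 6 * E * r + 1.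
have D20 : 0 < D2 by rewrite ltr_wpDl// mulr_ge0// mulr_ge0.
pose D := 4 * c * (E * r) + 4 * c * D2.
have D0 : 0 <= D by rewrite addr_ge0// mulr_ge0 ?mulr_ge0// ltW.
pose eta := Num.min (e / 2 / (D + 1)) (D2)^-1.
have eta0 : 0 < eta by rewrite lt_min invr_gt0 D20 andbT !divr_gt0// ltr_wpDl.
have cptA : compact A by exact: compact_hle.
have near_A f e' : A f -> 0 < e' -> \forall g \near (f : space), A g -> hle a k (g \- f) e'.
  by move=> Af e'0; exact: ptws_near_hle.
have Hcont : forall h1, H h1 -> forall f, A f -> forall e' : R, 0 < e' ->
    \forall g \near (f : space), A g -> `|h1 g - h1 f| < e'.
  move=> h1 Hh f Af e' e'0.
  have [dl dl0 dlP] := ar_continuous harch a0 ab (ltW ba) Kk Kkb llk Hh (ACa _ Af) e'0.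
  have dl20 : 0 < dl / 2 by rewrite divr_gt0.
  apply: (@filterS _ _ (nbhs_filter f) _ _ _ (near_A f _ Af dl20)) => g gP Ag.
  apply: dlP; first exact: ACa.
  apply: (@le_lt_trans _ _ (dl / 2)%:E); first by apply/hnorm_le => //; exact: gP.
  by rewrite lte_fin ltr_pdivrMr// ltr_pMr// ltr1n.
have Hsep : forall f g, A f -> A g -> f <> g -> exists2 h1, H h1 & h1 f <> h1 g.
  have [_ [s s0 sP] _] := ext_weights hext Kkb.
  move=> f g Af Ag fg; apply: (ar_separates harch) => //.
  - exact: (Ca_Ck wkb wkappa0 b0 s0 sP (ACa _ Af)).
  - exact: (Ca_Ck wkb wkappa0 b0 s0 sP (ACa _ Ag)).
have Ud : forall f, A f -> \forall g \near (f : space) & g' \near (f : space),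
    A g -> A g' -> hle a k (g \- g') e2.
  move=> f Af; have e220 : 0 < e2 / 2 by rewrite divr_gt0.
  have nf := near_A f _ Af e220.
  exists ([set g | A g -> hle a k (g \- f) (e2 / 2)],
          [set g | A g -> hle a k (g \- f) (e2 / 2)]) => //=.
  move=> [g g'] /= [gf g'f] Ag Ag'; rewrite [e2]splitr.
  have -> : g \- g' = ((g \- f) \- (g' \- f)) :> fn by apply/funext => x /=; ring.
  by apply: hle_sub; [exact: wk|exact: gf|exact: g'f].
have [J [w [C [[tw w0 w1] CA CU Cm]]]] :=
  @fuzzy_partition R space H A (fun g g' => hle a k (g \- g') e2)
    arch_features cptA Hcont Hsep Ud eta eta0.
(* an almost minimal norm in the cell bounds the output by the norm of any [f] there *)
have ychoice j : exists y, [/\ L y, hle b kb y D2 &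
    forall f, C j f -> hle a k (I n f \- y) (2 * e1) /\
      hle b kb y (6 * (E * (N f + 1)) + 1)].
  have [Cj|Cj] := pselect (C j !=set0); last first.
    exists (fun=> 0); split.
    - by case: (ar_L_subspace harch (ltW b0) ba Kkb llkb).
    - by apply: hle_le (hle0 b wkb); exact: ltW.
    - by move=> f Cf; exfalso; apply: Cj; exists f.
  have [fj Cfj fjN] := near_minimizer Cj N0.
  have Afj := CA _ _ Cfj; have cfj := ACa _ Afj.
  have [y [Ly hy ya]] := approx_by_L (growth cfj) e10.
  exists y; split=> //.
    apply: hle_le hy; rewrite /D2 lerD2r -mulrA ler_pM2l// ler_pM2l//.
    exact: AN.
  move=> f Cf; split.
    have -> : I n f \- y = ((I n f \- I n fj) \- (y \- I n fj)).
      by apply/funext => x /=; ring.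
    rewrite mulr_natl mulr2n; apply: hle_sub => //.
    apply: hle_le (cIP _ _ _ (ACa _ (CA _ _ Cf)) cfj (CU _ _ _ Cf Cfj)).
    by rewrite /e2; apply: mul_frac_le => //; exact: ltW.
  apply: hle_le hy; rewrite lerD2r ler_pM2l// ler_pM2l//.
  exact: fjN.
have [y yP] := choice ychoice.
have Ly j : L (y j) by case: (yP j).
have yD2 j : hle b kb (y j) D2 by case: (yP j).
exists J, w, y; split=> // f cf.
- have N1 : 1 <= (1 + N f) `^ p.
    by rewrite -[X in X <= _](powRr0 (1 + N f)) ler_powR ?lerDl ?(ltW (lt_trans ltr01 hp)).
  have ee : e <= e * (1 + N f) `^ p by rewrite ler_peMr// ltW.
  have [fr|/ltW fr] := leP (N f) r; last first.
    apply: (hle_le (rP _ fr)).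
    have hS : hle b kb (fun x => \sum_j w j f * y j x) D2.
      apply: hle_le (hle_sum (r := fun=> D2) (fun j => w j f) wkb yD2).
      under eq_bigr do rewrite (ger0_norm (w0 _ _)).
      by rewrite -mulr_suml w1 mul1r.
    have := hle_sub wkb (growth cf) hS => hD.
    apply: hle_le (hle_embed wkb wk a0 (ltW ab) c0 cP hD).
    rewrite /C1 -!mulrA ler_wpM2l// ler_wpM2l// /D2.
    have := ler_wpM2l E00 fr; have := N0 f; nra.
  have Af : A f by apply: hle_le fr (Ca_hle wkb cf).
  have -> : I n f \- (fun x => \sum_j w j f * y j x) =
      (fun x => \sum_j w j f * (I n f \- y j) x).
    apply/funext => x /=; under [RHS]eq_bigr do rewrite mulrBr.
    by rewrite sumrB -mulr_suml w1 mul1r.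
  pose rj j := if `[< C j f >] then 2 * e1 else D.
  have hj j : hle a k (I n f \- y j) (rj j).
    rewrite /rj; case: asboolP => [Cf|_]; first by case: (yP j) => _ _ /(_ _ Cf)[].
    apply: hle_sub => //; last exact: (hle_embed wkb wk a0 (ltW ab) c0 cP (yD2 j)).
    apply: hle_le (hle_embed wkb wk a0 (ltW ab) c0 cP (growth cf)).
    by rewrite ler_wpM2l ?mulr_ge0// ler_pM2l// AN.
  apply: hle_le (hle_sum (fun j => w j f) wk hj); apply: le_trans ee.
  apply: (@le_trans _ _ (\sum_j (2 * e1 * w j f + D * (if ~~ `[< C j f >] then w j f else 0)))).
    apply: ler_sum => j _; rewrite (ger0_norm (w0 _ _)) /rj; case: ifP => _ /=.
      by rewrite mulr0 addr0 mulrC.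
    by rewrite mulrC lerDr mulr_ge0// mulr_ge0// ltW.
  rewrite big_split/= -!mulr_sumr w1 mulr1 -big_mkcond/=.
  apply: (@le_trans _ _ (2 * e1 + D * (e / 2 / (D + 1)))).
    rewrite lerD2l ler_wpM2l//; apply: (le_trans (Cm f Af)).
    by rewrite ge_min lexx.
  have : D * (e / 2 / (D + 1)) <= e / 2.
    by apply: mul_frac_le; rewrite ?divr_ge0// ltW.
  rewrite /e1; lra.
- have [fr|/ltW fr] := leP (N f) r; last first.
    apply: hle_le (hle_sum (r := fun=> D2) (fun j => w j f) wkb yD2).
    under eq_bigr do rewrite (ger0_norm (w0 _ _)).
    rewrite -mulr_suml w1 mul1r /D2.
    have := ler_wpM2l E00 fr; have := N0 f; have := mulr_ge0 E00 (N0 f); lra.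
  have Af : A f by apply: hle_le fr (Ca_hle wkb cf).
  pose rj j := if `[< C j f >] then 6 * (E * (N f + 1)) + 1 else D2.
  have hj j : hle b kb (y j) (rj j).
    by rewrite /rj; case: asboolP => [Cf|_] //; case: (yP j) => _ _ /(_ _ Cf)[].
  apply: hle_le (hle_sum (fun j => w j f) wkb hj).
  have Q0 : 0 <= 6 * (E * (N f + 1)) + 1.
    by have := mulr_ge0 E00 (N0 f); lra.
  apply: (@le_trans _ _ (\sum_j ((6 * (E * (N f + 1)) + 1) * w j f + D2 * (if ~~ `[< C j f >] then w j f else 0)))).
    apply: ler_sum => j _; rewrite (ger0_norm (w0 _ _)) /rj; case: ifP => _ /=.
      by rewrite mulr0 addr0 mulrC.
    by rewrite [w j f * D2]mulrC lerDr mulr_ge0.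
  rewrite big_split/= -!mulr_sumr w1 mulr1 -big_mkcond/=.
  have : D2 * (\sum_(i | ~~ `[< C i f >]) w i f) <= 1.
    apply: (@le_trans _ _ (D2 * D2^-1)); last by rewrite divff// gt_eqF.
    rewrite ler_pM2l//; apply: (le_trans (Cm f Af)).
    by rewrite ge_min lexx orbT.
  by have := mulr_ge0 E00 (N0 f); have := N0 f; lra.
Qed.

(** The trigonometric weights are replaced with an accuracy that is chosen after
    the finitely many outputs, against their norms.  Both bounds survive, with a
    growth of order [p]. *)
Lemma one_step_network : exists2 C2, 0 <= C2 & forall e, 0 < e -> exists Phi,
  network H rho L Phi /\ forall f, Ca b kb f ->
    hle a k (I n f \- Phi f) (e * (1 + N f) `^ p) /\
    hle b kb (Phi f) (C2 * (1 + N f) `^ p).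
Proof.
have E00 := ltW E0; exists (6 * E + 4); first by rewrite addr_ge0// mulr_ge0.
move=> e e0; have e20 : 0 < e / 2 by rewrite divr_gt0.
have [J [w [y [tw Ly yA yB]]]] := one_step_partition e20.
have yCa j : Ca b kb (y j).
  by apply: (Ca_embed wkappa wkb llkb (ltW b0) ba); exact: (ar_L_sub harch).
pose Ya j := hn a k (y j); pose Yb j := N (y j).
have Ya0 j : 0 <= Ya j by exact: hn_ge0.
have Yb0 j : 0 <= Yb j by exact: hn_ge0.
pose S := \sum_j Ya j + \sum_j Yb j.
have Sa0 : 0 <= \sum_j Ya j by exact: sumr_ge0.
have Sb0 : 0 <= \sum_j Yb j by exact: sumr_ge0.
have S1 : 0 < S + 1 by rewrite ltr_wpDl// addr_ge0.
pose e1 := Num.min (e / 2) 1 / (S + 1).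
have e10 : 0 < e1 by rewrite divr_gt0// lt_min e20 ltr01.
have := fun j => trig_to_activation (tw j) e10.
move=> /(_ _)/cid2 vv; pose v j := s2val (vv j).
have vr j : ridge_span rho H (v j) := s2valP (vv j).
have vP j f : Ca b kb f -> `|w j f - v j f| <= e1 * (1 + N f) `^ p.
  by move=> cf; exact: (s2valP' (vv j)).
have [L0 LZ] : L (fun=> 0) /\ forall (c : R) f, L f -> L (fun x => c * f x).
  by case: (ar_L_subspace harch (ltW b0) ba Kkb llkb).
have smallS q (r : R) : q <= S + 1 -> 0 <= q -> Num.min (e / 2) 1 <= r -> e1 * q <= r.
  move=> qS q0' mr; apply: le_trans mr; rewrite /e1 mulrAC ler_pdivrMr//.
  by rewrite ler_wpM2l// le_min ltW// ler01.
exists (fun f x => \sum_j v j f * y j x); split; first exact: network_sum.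
move=> f cf; set W := (1 + N f) `^ p.
have W0 : 0 <= W by exact: powR_ge0.
have W1 : 1 + N f <= W by rewrite le1r_powR ?lerDl// ltW.
have dsum (Y : J -> R) (a' : R) k' : weight k' ->
    (forall j, 0 <= Y j) -> (forall j, hle a' k' (y j) (Y j)) ->
    hle a' k' (fun x => \sum_j (w j f - v j f) * y j x) (e1 * (\sum_j Y j) * W).
  move=> wk' Y0 yY; apply: hle_le (hle_sum (fun j => w j f - v j f) wk' yY).
  rewrite mulrAC [leRHS]mulr_sumr; apply: ler_sum => j _.
  by rewrite ler_wpM2r// vP.
have hA := dsum Ya a k wk Ya0 (fun j => Ca_hle wk (Ca_weaken (yCa j))).
have hB := dsum Yb b kb wkb Yb0 (fun j => Ca_hle wkb (yCa j)).
split.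
  have -> : I n f \- (fun x => \sum_j v j f * y j x) =
     (fun x => (I n f \- (fun x => \sum_j w j f * y j x)) x +
               \sum_j (w j f - v j f) * y j x).
    apply/funext => x /=; under [X in _ = _ + X]eq_bigr do rewrite mulrBl.
    by rewrite sumrB addrA subrK.
  apply: hle_le (hle_add wk (yA _ cf) hA); rewrite -/W -mulrDl ler_wpM2r//.
  rewrite [leRHS]splitr lerD2l; apply: smallS => //; last by rewrite ge_min lexx.
  by rewrite /S; lra.
have -> : (fun x => \sum_j v j f * y j x) =
   (fun x => \sum_j w j f * y j x) \- (fun x => \sum_j (w j f - v j f) * y j x).
  apply/funext => x /=; under [X in _ = _ - X]eq_bigr do rewrite mulrBl.
  by rewrite sumrB subKr.
apply: hle_le (hle_sub wkb (yB _ cf) hB).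
have h1 : e1 * (\sum_j Yb j) <= 1.
  by apply: smallS => //; [rewrite /S; lra|rewrite ge_min lexx orbT].
have := ler_wpM2r W0 h1; have C30 : 0 <= 6 * E + 3 by rewrite addr_ge0// mulr_ge0.
have := ler_wpM2l C30 W1; lra.
Qed.

(** The error after [m + 1] steps is the error after [m] steps, enlarged by the
    Lipschitz constant of [I n], plus the error of one step at the [m]-th iterate
    of the network.  The norm of that iterate is bounded by [B m] times a power of
    order [p ^+ m], with [B m] independent of [e]. *)
Lemma iterated_network : exists (D : nat -> R), (forall m, 0 <= D m) /\
  forall e, 0 < e -> exists Phi, network H rho L Phi /\
    forall f m, Ca b kb f ->
      hle a k (iter m (I n) f \- iter m Phi f) (e * D m * (1 + N f) `^ (p ^+ m)).
Proof.
have [cI cI0 cIP] := step_lipschitz.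
have [C2 C20 CP] := one_step_network.
have p00 : 0 <= p by exact/ltW/(lt_trans ltr01).
pose B := fix B m := if m is m'.+1 then (1 + C2) * (B m') `^ p else 1.
pose D := fix D m := if m is m'.+1 then cI * D m' + (B m') `^ p else 0.
have B0 m : 0 <= B m by case: m => [|m] //=; rewrite mulr_ge0 ?powR_ge0// addr_ge0.
have D0 m : 0 <= D m.
  by elim: m => [|m IH] //=; rewrite addr_ge0 ?powR_ge0// mulr_ge0.
exists D; split=> // e e0; have [Phi [nP PhiP]] := CP _ e0.
exists Phi; split=> // f m cf.
have base1 : 1 <= 1 + N f by rewrite lerDl.
have pm m' : 1 <= (1 + N f) `^ (p ^+ m').
  by rewrite -[X in X <= _](powRr0 (1 + N f)) ler_powR// exprn_ge0.
have powS m' : (1 + N f) `^ (p ^+ m'.+1) = ((1 + N f) `^ (p ^+ m')) `^ p.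
  by rewrite exprSr powRrM.
suff : [/\ Ca b kb (iter m (I n) f), Ca b kb (iter m Phi f),
    1 + N (iter m Phi f) <= B m * (1 + N f) `^ (p ^+ m) &
    hle a k (iter m (I n) f \- iter m Phi f) (e * D m * (1 + N f) `^ (p ^+ m))] by case.
elim: m => [|m [cI' cPhi NB hD]].
  split=> //.
    by rewrite expr0 powRr1 ?addr_ge0// (_ : B 0%N = 1)// mul1r.
  rewrite (_ : D 0%N = 0)// mulr0 mul0r (_ : _ \- _ = fun=> 0); first exact: hle0.
  by apply/funext => x /=; rewrite subrr.
have [P1 P2] := PhiP _ cPhi.
set W := (1 + N f) `^ (p ^+ m) in NB hD *.
have W1 : 1 <= W by exact: pm.
have NBp : (1 + N (iter m Phi f)) `^ p <= (B m) `^ p * W `^ p.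
  rewrite -powRM//; last exact: le_trans W1.
  apply: ge0_ler_powR => //; rewrite nnegrE ?addr_ge0// mulr_ge0//.
  exact: le_trans W1.
have Wp : W <= W `^ p by rewrite le1r_powR// ltW.
have cPhi' : Ca b kb (iter m.+1 Phi f) by exact: hle_Ca_pos P2.
split; [exact: step_Ca|exact: cPhi'| |].
- rewrite powS -/W (_ : B m.+1 = (1 + C2) * (B m) `^ p)// -mulrA; have h2' := hle_hn wkb P2.
  apply: (@le_trans _ _ ((1 + C2) * (1 + N (iter m Phi f)) `^ p)).
    rewrite mulrDl mul1r; apply: lerD; last exact: h2'.
    by rewrite -[X in X <= _](powRr0 (1 + N (iter m Phi f))) ler_powR// lerDl.
  by rewrite ler_wpM2l// addr_ge0.
- have -> : iter m.+1 (I n) f \- iter m.+1 Phi f =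
     (fun x => (I n (iter m (I n) f) \- I n (iter m Phi f)) x +
               (I n (iter m Phi f) \- Phi (iter m Phi f)) x).
    by apply/funext => x /=; ring.
  apply: hle_le (hle_add wk (cIP _ _ _ cI' cPhi hD) P1).
  rewrite powS -/W (_ : D m.+1 = cI * D m + (B m) `^ p)// mulrDr mulrDl; apply: lerD.
    rewrite (_ : cI * (e * D m * W) = e * (cI * D m) * W); last by ring.
    by rewrite ler_wpM2l// mulr_ge0 ?(ltW e0)// mulr_ge0.
  by rewrite -mulrA ler_pM2l.
Qed.

End FixedStep.

End OneStep.

(** * Approximation of the scheme *)

(** For fixed [n] only finitely many numbers of steps occur up to time [T], and the
    accuracy of one step is divided by the sum of their constants. *)
Lemma scheme_approximation {R : realType} {d : nat} (alpha p omega : R)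
    (kappa kappa0 : 'rV[R]_d -> R) (KK : set ('rV[R]_d -> R)) (h : nat -> R)
    (I : nat -> ('rV[R]_d -> R) -> ('rV[R]_d -> R))
    (H : set (('rV[R]_d -> R) -> R)) (rho : R -> R) (L : set ('rV[R]_d -> R))
    (a : R) (k : 'rV[R]_d -> R) (T : R) (n : nat) (eps : R) :
  (0 < d)%N -> 0 < alpha <= 1 -> 1 < p ->
  standing_setting kappa kappa0 h I ->
  extension_conditions alpha kappa kappa0 KK omega h I ->
  architecture_conditions alpha p kappa kappa0 KK H rho L ->
  0 <= a < alpha -> KK k -> weight_ll k kappa -> 0 < eps ->
  exists Phi, chernoff_neural alpha kappa kappa0 H rho L Phi /\
    forall t f, 0 <= t <= T -> Ca alpha kappa f ->
      hle a k (steps h (I n) n t f \- steps h Phi n t f)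
        ((1 + hn alpha kappa f) `^ (p ^+ ksteps (h n) t) * eps).
Proof.
move=> hd /andP[alpha0 alpha1] hp hs hext harch /andP[a0 aal] Kk llk eps0.
have wkappa := ss_kappa hs; have wkappa0 := ss_kappa0 hs.
have [kb [Kkb lla llb]] := ext_dense hext Kk (ext_kappa hext) llk.
have [wkb _ [c c0 cP]] := ext_weights hext Kkb.
pose b := (a + alpha) / 2.
have ab : a < b by rewrite /b; lra.
have ba : b < alpha by rewrite /b; lra.
have b0 : 0 <= b by exact/ltW/(le_lt_trans a0).
have [D [D0 DP]] := iterated_network hd alpha1 hp wkappa wkappa0 hext harch
  a0 ab ba Kk Kkb lla llb llk n.
have p0 : 0 <= p by exact/ltW/(lt_trans ltr01).
have [C C0 CE] : exists2 C, 0 < C & C = 1 + 4 * c.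
  by eexists; last by []; rewrite ltr_pwDl// mulr_ge0.
pose K := ksteps (h n) T.
pose S := \sum_(m < K.+1) D m * C `^ (p ^+ m).
have S0 : 0 <= S by apply: sumr_ge0 => m _; rewrite mulr_ge0// powR_ge0.
have e0 : 0 < eps / (S + 1) by rewrite divr_gt0// ltr_wpDl.
have [Phi [nPhi PhiP]] := DP _ e0.
have [_ L0 _ LZ] := ar_L_subspace harch a0 aal Kk llk.
exists Phi; split.
  apply: network_chernoff => //; first exact: (ar_const harch).
  exact: (ar_L_sub harch).
move=> t f /andP[t0 tT] cf.
have cfb : Ca b kb f by exact: (Ca_embed wkappa wkb llb b0 ba).
pose m := ksteps (h n) t.
have mK : (m < K.+1)%N.
  rewrite ltnS /m /K /ksteps; apply: le_truncn.
  by rewrite ler_pM2r// invr_gt0 (ss_h_gt0 hs).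
apply: hle_le (PhiP f m cfb).
have N0 := hn_ge0 b f wkb; have N1 := hn_ge0 alpha f wkappa.
have NC : 1 + hn b kb f <= C * (1 + hn alpha kappa f).
  have := hle_hn wkb (hle_embed wkappa wkb b0 (ltW ba) c0 cP (Ca_hle wkappa cf)).
  by rewrite CE; lra.
have pm0 : 0 <= p ^+ m by rewrite exprn_ge0.
apply: (@le_trans _ _ (eps / (S + 1) * D m * (C `^ (p ^+ m) * (1 + hn alpha kappa f) `^ (p ^+ m)))).
  apply: ler_wpM2l; first by apply: mulr_ge0 => //; exact: ltW.
  rewrite -powRM ?(ltW C0) ?addr_ge0//.
  apply: ge0_ler_powR; [exact: pm0|by rewrite nnegrE addr_ge0| |exact: NC].
  by rewrite nnegrE; apply: mulr_ge0; [exact: ltW|exact: addr_ge0].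
rewrite (_ : _ / _ * _ * _ = (1 + hn alpha kappa f) `^ (p ^+ m) * (eps * ((D m * C `^ (p ^+ m)) / (S + 1)))); last by ring.
apply: ler_wpM2l; first exact: powR_ge0.
rewrite ler_piMr ?(ltW eps0)// ler_pdivrMr ?ltr_wpDl// mul1r.
apply: (@le_trans _ _ S); last by rewrite lerDl.
rewrite /S (bigD1 (Ordinal mK))//= lerDl.
by apply: sumr_ge0 => i _; rewrite mulr_ge0// powR_ge0.
Qed.

(** * Trigonometric polynomials are smooth *)

Section SmoothTrig.
Context {R : realType} {d : nat}.
Implicit Types (x y v : 'rV[R]_d).

Definition affine_form : set ('rV[R]_d -> R) :=
  [set f | exists v c, f = fun x => \sum_(i < d) v ord0 i * x ord0 i + c].

Lemma affine_form_features : feature_space affine_form.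
Proof.
split.
- move=> _ _ [v [c ->]] [w [e ->]]; exists (v + w), (c + e); apply/funext => x.
  by rewrite addrACA -big_split/=; congr (_ + _); apply: eq_bigr => i _; rewrite mxE mulrDl.
- move=> a _ [v [c ->]]; exists (a *: v), (a * c); apply/funext => x.
  by rewrite mulrDr mulr_sumr; congr (_ + _); apply: eq_bigr => i _; rewrite mxE mulrA.
- move=> a; exists 0, a; apply/funext => x.
  by rewrite big1 ?add0r// => i _; rewrite mxE mul0r.
Qed.

Lemma affine_form_shift v c x i (s : R) :
  \sum_(j < d) v ord0 j * (s *: delta_mx ord0 i + x : 'rV[R]_d) ord0 j + c =
  (\sum_(j < d) v ord0 j * x ord0 j + c) + s * v ord0 i.
Proof.
rewrite addrAC; congr (_ + _).
under eq_bigr do rewrite !mxE mulrDr; rewrite big_split/= addrC; congr (_ + _).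
rewrite (bigD1 i)//= big1 ?addr0 => [|j ji]; first by rewrite eqxx mulr1 mulrC.
by rewrite (negbTE ji) !mulr0.
Qed.

Lemma affine_form_lipschitz f : affine_form f ->
  exists2 m, 0 <= m & forall x y, `|f x - f y| <= m * `|x - y|.
Proof.
move=> [v [c ->]]; exists (\sum_(i < d) `|v ord0 i|); first exact: sumr_ge0.
move=> x y; rewrite opprD addrACA subrr addr0 -sumrB mulr_suml.
apply: (le_trans (ler_norm_sum _ _ _)); apply: ler_sum => i _.
rewrite -mulrBr normrM ler_wpM2l//.
by have := coord_le_norm (x - y) i; rewrite !mxE.
Qed.

Let trig := ridge_span cos affine_form.

Lemma trig_continuous w : trig w -> continuous w.
Proof.
elim=> [|a f {}w Hf _ cw]; first exact: cst_continuous.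
have [m m0 fm] := affine_form_lipschitz Hf.
have cc : continuous (fun x => cos (f x)).
  apply: (lipschitz_continuous m0) => x y.
  exact: le_trans (cos_lipschitz _ _) (fm x y).
move=> x; apply: (cvgD (F := nbhs x)); last exact: cw.
by apply: (cvgMl_tmp (F := nbhs x)); exact: cc.
Qed.

Lemma trig_bounded w : trig w -> exists c : R, forall x, `|w x| <= c.
Proof.
elim=> [|a f {}w Hf _ [c cw]]; first by exists 0 => x; rewrite normr0.
exists (`|a| + c) => x; apply: (le_trans (ler_normD _ _)); apply: lerD => //.
by rewrite normrM ler_piMr// cos_max.
Qed.

(** The derivative of a cosine is a cosine with shifted phase. *)
Lemma trig_partial w i : trig w -> exists2 w', trig w' &
  forall x, is_derive x (delta_mx ord0 i) w (w' x).
Proof.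
elim=> [|a f {}w Hf _ [w' tw' dw]].
  by exists (fun=> 0); [exact: ridge_zero|move=> x; exact: is_derive_cst].
have [v [c fE]] := Hf.
have Hf' : affine_form (fun x => f x + pi / 2).
  by apply: (fs_add affine_form_features) => //; exact: (fs_const affine_form_features).
exists (fun x => a * v ord0 i * cos (f x + pi / 2) + w' x).
  exact: (@ridge_step _ _ cos affine_form (a * v ord0 i) (fun x => f x + pi / 2)).
move=> x; pose phi (s : R) := cos (f x + s * v ord0 i).
have dphi : is_derive (0 : R) (1 : R) phi (v ord0 i * cos (f x + pi / 2)).
  have da : is_derive (0 : R) (1 : R) (fun s : R => f x + s * v ord0 i) (v ord0 i).
    have := is_deriveD (is_derive_cst (f x) (0 : R) 1) (is_deriveM (is_derive_id (0 : R) 1) (is_derive_cst (v ord0 i) (0 : R) 1)).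
    by move=> /is_derive_eq; apply; rewrite scaler0 add0r add0r /GRing.scale /= mulr1.
  have dc := is_derive_cos (f x + 0 * v ord0 i).
  have := @is_derive1_comp _ cos (fun s : R => f x + s * v ord0 i) 0 _ _ dc da.
  by move=> /is_derive_eq; apply; rewrite mul0r addr0 cosDpihalf mulrC.
have E : (fun s : R => s^-1 *: ((phi \o shift 0) (s *: (1 : R)) - phi 0)) =
    (fun s : R => s^-1 *: (((fun x => cos (f x)) \o shift x) (s *: (delta_mx ord0 i : 'rV[R]_d)) - cos (f x))).
  apply/funext => s; congr (_ *: (_ - _)); last by rewrite /phi mul0r addr0.
  rewrite /phi /= addr0 /GRing.scale/= mulr1 fE; congr cos.
  by rewrite affine_form_shift.
have dcf : is_derive x (delta_mx ord0 i) (fun x => cos (f x)) (v ord0 i * cos (f x + pi / 2)).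
  apply: DeriveDef; first by have [+ _] := dphi; rewrite /derivable E.
  by have [_ +] := dphi; rewrite /derive E.
have := is_deriveD (is_deriveZ a dcf) (dw x).
by move=> /is_derive_eq; apply; rewrite /GRing.scale/= mulrA.
Qed.

Lemma trig_smooth w : trig w -> Cb_smooth w.
Proof.
move=> tw s; have ts : trig (iter_partial s w).
  elim: s => [//|i s IH] /=; have [w' tw' dw] := trig_partial i IH.
  rewrite (_ : (fun x => _) = w')//; apply/funext => x.
  by have [_ ->] := dw x.
split; [exact: trig_continuous|move=> x i|exact: trig_bounded].
by have [w' _ dw] := trig_partial i ts; have [] := dw x.
Qed.

(** Coordinates separate points, so trigonometric polynomials are dense on [K];
    they are smooth, with all derivatives bounded. *)
Lemma smooth_approx (K : set 'rV[R]_d) (f : 'rV[R]_d -> R) (m e : R) :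
  compact K -> continuous f -> 0 <= m -> (forall x, `|f x| <= m) -> 0 < e ->
  exists2 g, Cb_smooth g /\ continuous g &
    (forall x, `|g x| <= m) /\ (forall x, K x -> `|f x - g x| <= e).
Proof.
move=> cK cf m0 fm e0.
have [||g tg gP] := @trig_approx R 'rV[R]_d affine_form K f m e affine_form_features cK _ _ cf m0 (fun x _ => fm x) e0.
- move=> h1 Hh x _ e' e'0; have [m' m'0 hm] := affine_form_lipschitz Hh.
  have /(_ x) := lipschitz_continuous m'0 hm.
  move=> /(iffLR (cvgrPdist_lt (F := nbhs x) h1 (h1 x)))/(_ _ e'0).
  by apply: (@filterS _ _ (nbhs_filter x)) => y; rewrite distrC.
- move=> x y _ _ xy.
  have [i xyi] : exists i, x ord0 i <> y ord0 i.
    apply: contrapT => /forallNP nxy; apply: xy; apply/rowP => i.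
    by apply: contrapT; exact: nxy.
  have cE z : \sum_(j < d) (delta_mx ord0 i : 'rV[R]_d) ord0 j * z ord0 j + 0 = z ord0 i.
    rewrite addr0 (bigD1 i)//= big1 ?addr0 => [|j ji]; first by rewrite mxE/= eqxx mul1r.
    by rewrite mxE/= (negbTE ji) mul0r.
  exists (fun x => \sum_(j < d) (delta_mx ord0 i : 'rV[R]_d) ord0 j * x ord0 j + 0).
    by exists (delta_mx ord0 i), 0.
  by rewrite !cE.
by exists g => //; split; [exact: trig_smooth|exact: trig_continuous].
Qed.

End SmoothTrig.

(** * Uniform convergence of the scheme *)

Section WeightedSup.
Context {R : realType} {d : nat}.
Implicit Types (k f g : 'rV[R]_d -> R) (K : set 'rV[R]_d).

Definition wle k f (r : R) := forall x, `|f x| * k x <= r.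

Lemma wnorm_le k f (r : R) : (wnorm k f <= r%:E)%E <-> wle k f r.
Proof.
split=> [/ereal_supP H x|H]; first by rewrite -lee_fin; apply: H; exists x.
by apply/ereal_supP => _ [x _ <-]; rewrite lee_fin.
Qed.

Lemma wle_Ck_ball k f r : continuous f -> wle k f r -> Ck_ball k r f.
Proof.
move=> cf /wnorm_le fr; split=> //; split=> //.
exact: (le_lt_trans fr (ltry _)).
Qed.

Lemma bounded_wle k f (c m : R) : (forall x, 0 < k x) -> (forall x, k x <= c) ->
  (forall x, `|f x| <= m) -> wle k f (m * c).
Proof. by move=> k0 kc fm x; apply: ler_pM => //; exact: ltW. Qed.

Lemma supnorm_le K f (e : R) : 0 <= e ->
  (supnorm_on K f <= e%:E)%E <-> (forall x, K x -> `|f x| <= e).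
Proof.
move=> e0; rewrite /supnorm_on ge_max lee_fin e0 /=.
split=> [/ereal_supP H x Kx|H]; first by rewrite -lee_fin; apply: H; exists x.
by apply/ereal_supP => _ [x Kx <-]; rewrite lee_fin; exact: H.
Qed.

Lemma wle_trans k f g1 g2 (r s : R) : (forall x, 0 < k x) ->
  wle k (f \- g1) r -> wle k (g1 \- g2) s -> wle k (f \- g2) (r + s).
Proof.
move=> k0 H1 H2 x; apply: (@le_trans _ _ ((`|f x - g1 x| + `|g1 x - g2 x|) * k x)).
  by rewrite ler_wpM2r ?(ltW (k0 x))//; exact: ler_distD.
by rewrite mulrDl lerD//; [exact: H1|exact: H2].
Qed.

Lemma smooth_Ck k f : weight k -> Cb_smooth f -> Ck k f.
Proof.
move=> [_ k0 [c kc]] /(_ [::]) [/= cf _ [m fm]].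
by have [] := wle_Ck_ball cf (bounded_wle k0 kc fm).
Qed.

End WeightedSup.

Section Convergence.
Context {R : realType} {d : nat}.
Local Notation fn := ('rV[R]_d -> R).
Local Notation space := {ptws 'rV[R]_d -> R}.
Variables (kappa kappa0 : fn) (omega : R) (h : nat -> R) (I : nat -> fn -> fn).
Hypothesis hs : standing_setting kappa kappa0 h I.
Hypothesis hch : chernoff_conditions kappa omega h I.
Implicit Types (f g : fn) (t T : R) (n : nat).

Local Notation u n t f := (steps h (I n) n t f).

Let wk : weight kappa. Proof. exact: ss_kappa hs. Qed.
Let k0 x : 0 < kappa x. Proof. exact: weight_gt0. Qed.
Let h0 n : 0 < h n. Proof. exact: ss_h_gt0 hs n. Qed.
Let om0 : 0 <= omega. Proof. exact: ch_omega hch. Qed.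

Lemma iter_Ck n m f : Ck kappa f -> Ck kappa (iter m (I n) f).
Proof. by move=> cf; elim: m => [|m IH] //=; exact: (ss_maps hs). Qed.

Lemma wle_step n f g r : Ck kappa f -> Ck kappa g -> wle kappa (f \- g) r ->
  wle kappa (I n f \- I n g) (expR (omega * h n) * r).
Proof.
move=> cf cg /wnorm_le fg; apply/wnorm_le.
apply: (le_trans (ch_lipschitz hch n cf cg)).
by rewrite EFinM lee_wpmul2l// lee_fin expR_ge0.
Qed.

Lemma ksteps_le n t : 0 <= t -> (ksteps (h n) t)%:R * h n <= t.
Proof. by move=> t0; rewrite ksteps_max. Qed.

Lemma ksteps_gt n t : 0 <= t -> t < (ksteps (h n) t)%:R * h n + h n.
Proof.
move=> t0; have := ksteps_max (h0 n) t0 (ksteps (h n) t).+1.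
by rewrite ltnn => /negbT; rewrite -ltNge -natr1 mulrDl mul1r.
Qed.

Lemma exp_steps n m T : m%:R * h n <= T -> expR (omega * h n) ^+ m <= expR (omega * T).
Proof.
move=> mT; rewrite -expRM_natr ler_expR -mulrA ler_wpM2l// mulrC.
exact: mT.
Qed.

(** Convergence of the difference quotients bounds them uniformly in [n], so one
    step moves [g] by at most a multiple of its length.  The Lipschitz property of
    the steps passes this on to later times. *)
Lemma smooth_time_regularity g T : Cb_smooth g -> exists2 C, 0 <= C &
  forall n s t, 0 <= s -> s <= t -> t <= T ->
    wle kappa (u n t g \- u n s g) (C * (t - s + h n)).
Proof.
move=> sg; have cg := smooth_Ck wk sg.
have [g' [_ _ bnd _]] := ch_generator hch sg.
set M := ereal_sup _ in bnd.
have MP n : (wnorm kappa (fun x => ((I n g x - g x) / h n)%R) <= M)%E.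
  by apply: ereal_sup_ubound; exists n.
have M0 : (0 <= M)%E.
  apply: le_trans (MP 0%N).
  apply: (@le_trans _ _ (`|(I 0%N g 0 - g 0) / h 0%N| * kappa 0)%R%:E).
    by rewrite lee_fin mulr_ge0// ltW.
  by apply: ereal_sup_ubound; exists 0.
pose C0 := fine M; have C00 : 0 <= C0 by exact: fine_ge0.
have one n : wle kappa (I n g \- g) (C0 * h n).
  have : wle kappa (fun x => (I n g x - g x) / h n) C0.
    by apply/wnorm_le; rewrite fineK// ge0_fin_numE.
  move=> H x; have := H x; rewrite normrM normfV (gtr0_norm (h0 n)).
  by rewrite mulrAC ler_pdivrMr.
pose C := expR (omega * T) * C0.
have C1 : 0 <= C by rewrite mulr_ge0// expR_ge0.
have inc n m : m%:R * h n <= T ->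
    wle kappa (iter m.+1 (I n) g \- iter m (I n) g) (C * h n).
  move=> mT; suff H : wle kappa (iter m.+1 (I n) g \- iter m (I n) g)
      (expR (omega * h n) ^+ m * (C0 * h n)).
    move=> x; apply: (le_trans (H x)); rewrite mulrA ler_pM2r// ler_wpM2r//.
    exact: exp_steps.
  elim: m {mT} => [|m IH]; first by rewrite expr0 mul1r; exact: one.
  by rewrite exprS -mulrA; exact: (wle_step n (iter_Ck n m.+1 cg) (iter_Ck n m cg) IH).
exists C => // n s t s0 st tT.
have t0 : 0 <= t by exact: le_trans st.
have kle : (ksteps (h n) s <= ksteps (h n) t)%N.
  by apply: le_truncn; rewrite ler_pM2r// invr_gt0.
have [j kj] : exists j, ksteps (h n) t = (ksteps (h n) s + j)%N.
  by exists (ksteps (h n) t - ksteps (h n) s)%N; rewrite subnKC.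
have tk := ksteps_le n t0; have sk := ksteps_gt n s0.
have H i : (i <= j)%N -> wle kappa
    (iter (ksteps (h n) s + i) (I n) g \- iter (ksteps (h n) s) (I n) g)
    (i%:R * (C * h n)).
  elim: i => [|i IH] ij.
    by rewrite addn0 mul0r => x /=; rewrite subrr normr0 mul0r.
  rewrite -natr1 mulrDl mul1r addrC; apply: wle_trans (IH (ltnW ij)) => //.
  rewrite addnS; apply: inc; apply: le_trans tT; apply: le_trans tk.
  by rewrite ler_pM2r// ler_nat kj leq_add2l ltnW.
have := H j (leqnn j); rewrite /steps -kj => Hj x; apply: (le_trans (Hj x)).
rewrite mulrCA ler_wpM2l//; move: tk sk; rewrite kj natrD mulrDl; lra.
Qed.

Lemma local_le e r T (K : set 'rV[R]_d) : 0 < e -> 0 <= r -> 0 <= T -> compact K ->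
  exists c K', [/\ 0 <= c, compact K' & forall t n f g s, 0 <= t <= T ->
    Ck_ball kappa r f -> Ck_ball kappa r g -> 0 <= s ->
    (forall x, K' x -> `|f x - g x| <= s) ->
    forall x, K x -> `|u n t f x - u n t g x| <= c * s + e].
Proof.
move=> e0 r0 T0 cK; have [c [K' [c0 cK' H]]] := ch_local hch e0 r0 T0 cK.
exists c, K'; split=> // t n f g s tT hf hg s0 fg.
have E0 : 0 <= c * s + e by rewrite addr_ge0 ?mulr_ge0// ltW.
apply/(supnorm_le K (u n t f \- u n t g) E0).
apply: (le_trans (H t n f g tT hf hg)).
rewrite EFinD EFinM; apply: leeD => //; apply: lee_wpmul2l => //.
exact/supnorm_le.
Qed.

(** Two approximations are chained.  The compact set that controls the error
    depends on the norm of the data, and the weighted norm of a smooth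
    approximation is only controlled through a bound of the data.  Hence [f] is
    first clipped at its maximum over a compact set, and the result, whose bound
    is known, is then approximated. *)
Lemma smooth_data_approx e r T (K : set 'rV[R]_d) f :
  0 < e -> 0 <= r -> 0 <= T -> compact K -> Ck_ball kappa r f ->
  exists2 g, Cb_smooth g & forall t n x, 0 <= t <= T -> K x ->
    `|u n t f x - u n t g x| <= e.
Proof.
move=> e0 r0 T0 cK fr; have e20 : 0 < e / 2 by rewrite divr_gt0.
have e40 : 0 < e / 2 / 2 by rewrite divr_gt0.
have [c1 [K1 [c10 cK1 H1]]] := local_le e20 r0 T0 cK.
have cf : continuous f by case: fr => -[].
have [m m0 fm] := compact_bound cK1 cf.
pose f1 x := clip (- m) m (f x).
have mm : - m <= m by rewrite ge0_cp.
have f1m x : `|f1 x| <= m by rewrite ler_norml clip_itv.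
have cf1 : continuous f1.
  move=> x; apply: (iffRL (cvgrPdist_le (F := nbhs x) f1 (f1 x))) => z z0.
  near=> y; apply: (le_trans (clip_lipschitz _ _ _ _)); near: y.
  exact: (iffLR (cvgrPdist_le (F := nbhs x) f (f x)) (cf x) z z0).
have fw : wle kappa f r by apply/wnorm_le; case: fr.
have f1r : Ck_ball kappa r f1.
  apply: wle_Ck_ball => // x; apply: le_trans (fw x).
  rewrite ler_wpM2r ?(ltW (k0 x))// -[f1 x]subr0 -[0 in leLHS](@clip_id _ (- m) m).
    by rewrite -[f x in leRHS]subr0 clip_lipschitz.
  by rewrite oppr_le0 m0.
have [_ _ [Kmax kK]] := wk.
have r20 : 0 <= m * Kmax by rewrite mulr_ge0// (le_trans _ (kK 0))// ltW.
have [c2 [K2 [c20 cK2 H2]]] := local_le e40 r20 T0 cK.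
have e3 : 0 < e / 2 / 2 / (c2 + 1) by rewrite divr_gt0// ltr_wpDl.
have [g [sg cg] [gm gf]] := smooth_approx cK2 cf1 m0 f1m e3.
exists g => // t n x tT Kx.
have E1 : `|u n t f x - u n t f1 x| <= e / 2.
  have -> : e / 2 = c1 * 0 + e / 2 by rewrite mulr0 add0r.
  apply: H1 => // y Ky; rewrite (_ : f1 y = f y) ?subrr ?normr0//.
  by apply: clip_id; rewrite -ler_norml fm.
have E2 : `|u n t f1 x - u n t g x| <= e / 2.
  apply: (@le_trans _ _ (c2 * (e / 2 / 2 / (c2 + 1)) + e / 2 / 2)).
    apply: H2 => //; [| |exact: ltW].
    - exact: wle_Ck_ball cf1 (bounded_wle k0 kK f1m).
    - exact: wle_Ck_ball cg (bounded_wle k0 kK gm).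
  by rewrite [leRHS]splitr lerD2r; apply: mul_frac_le => //; exact: ltW.
by rewrite [e]splitr; apply: (le_trans (ler_distD (u n t f1 x) _ _)); exact: lerD.
Unshelve. all: by end_near. Qed.

Variable alpha : R.
Hypothesis alpha0 : 0 < alpha.
Hypothesis growth : forall n f, Ca alpha kappa f ->
  (hnorm alpha kappa (I n f) <= (expR (omega * h n))%:E * hnorm alpha kappa f)%E.

Lemma scheme_hle n t T f r : 0 <= t <= T -> hle alpha kappa f r ->
  hle alpha kappa (u n t f) (expR (omega * T) * r).
Proof.
move=> /andP[t0 tT] hf; have r0 := hle_ge0 wk hf.
have H m : hle alpha kappa (iter m (I n) f) (expR (omega * h n) ^+ m * r).
  elim: m => [|m IH]; first by rewrite expr0 mul1r.
  apply/hnorm_le => //; apply: (le_trans (growth n (hle_Ca_pos wk alpha0 IH))).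
  rewrite exprS -mulrA EFinM; apply: lee_wpmul2l; first by rewrite lee_fin expR_ge0.
  exact/hnorm_le.
apply: hle_le (H (ksteps (h n) t)); rewrite ler_wpM2r//.
by apply: exp_steps; apply: (le_trans (ksteps_le n t0)).
Qed.

Lemma mixed_cvg_near (v : nat -> fn) f (K : set 'rV[R]_d) e :
  mixed_cvg kappa v f -> compact K -> 0 < e ->
  \forall n \near \oo, forall x, K x -> `|f x - v n x| <= e.
Proof.
move=> [_ _ _ H] cK e0; have /fine_cvgP[fin fc] := H K cK.
near=> n; apply/(supnorm_le K (f \- v n) (ltW e0)).
have fn' : supnorm_on K (f \- v n) \is a fin_num by near: n.
rewrite -(fineK fn') lee_fin; apply: le_trans (ler_norm _) _.
rewrite -normrN -[- _]sub0r; near: n.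
exact: (iffLR (cvgrPdist_le _ _) fc e e0).
Unshelve. all: by end_near. Qed.

Lemma compact_enorm (K : set 'rV[R]_d) : compact K ->
  exists r : R, forall x, K x -> enorm x <= r.
Proof.
move=> /compact_bounded[B [_ /(_ (B + 1))]]; rewrite ltrDl ltr01 => /(_ isT) BP.
exists (d%:R * (B + 1)) => x Kx; apply: (le_trans (enorm_le_norm x)).
by rewrite ler_wpM2l//; exact: BP.
Qed.

(** In the data by the local continuity of the scheme; in time because [f0] may
    be replaced by smooth data.  The time grid only resolves steps of length
    [h n], whence the condition on [n]. *)
Lemma scheme_equicontinuous e r T (K : set 'rV[R]_d) t0 (f0 : space) :
  0 < e -> 0 <= T -> compact K -> 0 <= t0 <= T -> hle alpha kappa f0 r ->
  exists (dl : R) (B : set space), [/\ 0 < dl, nbhs f0 B &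
    forall n t f, h n <= dl -> `|t - t0| <= dl -> 0 <= t <= T -> B f ->
      hle alpha kappa f r -> forall x, K x ->
      `|u n t f x - u n t0 f0 x| <= e].
Proof.
move=> e0 T0 cK t0T hf0; have r0 := hle_ge0 wk hf0.
have ball_f f : hle alpha kappa f r -> Ck_ball kappa r f.
  move=> hf; apply: wle_Ck_ball; first exact: hle_continuous hf.
  by case: hf.
pose e5 := e / 5; have e50 : 0 < e5 by rewrite divr_gt0.
have [c1 [K1 [c10 cK1 H1]]] := local_le e50 r0 T0 cK.
have [r1 r1P] := compact_enorm cK1.
have e1 : 0 < e5 / (c1 + 1) by rewrite divr_gt0// ltr_wpDl.
have [g sg gP] := smooth_data_approx e50 r0 T0 cK (ball_f _ hf0).
have [C C0 CP] := smooth_time_regularity T sg.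
have [V1 V10 VP] := compact_bound cK (continuous_weightV wk).
have kV x : K x -> (kappa x)^-1 <= V1.
  by move=> Kx; apply: le_trans (ler_norm _) _; exact: VP.
have CV : 0 < 2 * (C * V1) + 1 by rewrite ltr_wpDl// mulr_ge0// mulr_ge0.
pose dl := e5 / (2 * (C * V1) + 1).
have dl0 : 0 < dl by rewrite divr_gt0.
have time n s t : 0 <= s -> s <= t -> t <= T -> t - s <= dl -> h n <= dl ->
    forall x, K x -> `|u n t g x - u n s g x| <= e5.
  move=> s0 st tT ts hn x Kx; have := CP n s t s0 st tT x.
  rewrite -ler_pdivlMr// => H; apply: (le_trans H).
  apply: (@le_trans _ _ (C * (dl + dl) * V1)).
    apply: ler_pM => //; last exact: kV.
    - apply: mulr_ge0 => //; have := h0 n; lra.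
    - by rewrite invr_ge0 ltW.
    - by rewrite ler_wpM2l//; exact: lerD.
  rewrite (_ : C * (dl + dl) * V1 = e5 * (2 * (C * V1)) / (2 * (C * V1) + 1)); last first.
    by rewrite /dl; field; rewrite gt_eqF.
  by rewrite ler_pdivrMr// ler_wpM2l ?(ltW e50)// lerDl.
exists dl, [set f | hle alpha kappa f r -> forall x, enorm x <= r1 ->
  `|f x - f0 x| <= e5 / (c1 + 1)]; split=> //; first exact: ptws_near_ball.
move=> n t f hn tt tT Bf hf x Kx.
have D1 : `|u n t f x - u n t f0 x| <= 2 * e5.
  apply: (@le_trans _ _ (c1 * (e5 / (c1 + 1)) + e5)).
    apply: H1 => //; [exact: ball_f|exact: ball_f|exact: ltW|].
    by move=> y /r1P; exact: Bf.
  have : c1 * (e5 / (c1 + 1)) <= e5.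
    by apply: mul_frac_le => //; exact: ltW.
  lra.
have D2 := gP t n x tT Kx; have D4 := gP t0 n x t0T Kx.
have D3 : `|u n t g x - u n t0 g x| <= e5.
  move: tt tT t0T => + /andP[tge tle] /andP[t0ge t0le].
  rewrite ler_norml => /andP[tt1 tt2].
  have [h1|/ltW h1] := leP t0 t; first by apply: time => //; lra.
  by rewrite distrC; apply: time => //; lra.
have -> : u n t f x - u n t0 f0 x = (u n t f x - u n t f0 x) +
   (u n t f0 x - u n t g x) + (u n t g x - u n t0 g x) - (u n t0 f0 x - u n t0 g x).
  by ring.
apply: (le_trans (ler_normB _ _)).
have := ler_normD ((u n t f x - u n t f0 x) + (u n t f0 x - u n t g x)) (u n t g x - u n t0 g x).
have := ler_normD (u n t f x - u n t f0 x) (u n t f0 x - u n t g x).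
rewrite /e5 in D1 D2 D3 D4 *; lra.
Qed.

Variable S : R -> fn -> fn.
Hypothesis Slim : forall t f, 0 <= t -> Ck kappa f ->
  mixed_cvg kappa (fun n => u n t f) (S t f).

(** A covering of the compact set of all pairs (t, f).  Near a pair (t0, f0) the
    limit at (t, f) is compared with the scheme at a large index [m], and the
    schemes of indices [m] and [n] are moved to (t0, f0) by equicontinuity. *)
Lemma scheme_uniform_cvg e r T rad : 0 < e -> 0 <= T ->
  \forall n \near \oo, forall t f, 0 <= t <= T -> hle alpha kappa f r ->
    forall x, enorm x <= rad -> `|S t f x - u n t f x| <= e.
Proof.
move=> e0 T0; pose K := [set x : 'rV[R]_d | `|x| <= rad].
have cK : compact K by exact: compact_ball.
have Ckf f : hle alpha kappa f r -> Ck kappa f.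
  move=> hf; have [] // : Ck_ball kappa r f.
  by apply: wle_Ck_ball; [exact: hle_continuous hf|case: hf].
pose A := [set z : R * space | (0 <= z.1 <= T) /\ hle alpha kappa z.2 r].
have cA : compact A.
  have -> : A = `[0, T]%classic `*` [set f : space | hle alpha kappa f r].
    by apply/seteqP; split=> -[t f] /=; rewrite in_itv.
  by apply: compact_setX; [exact: segment_compact|exact: compact_hle].
pose P n (z : R * space) := A z -> forall x, K x ->
  `|S z.1 z.2 x - u n z.1 z.2 x| <= e.
have : \forall n \near \oo, A `<=` P n.
  move/compact_near_coveringP : cA; apply => -[t0 f0] [/= t0T hf0].
  pose e' := e / 13; have e'0 : 0 < e' by rewrite divr_gt0.
  pose e5 := 5 * e'; have e50 : 0 < e5 by rewrite mulr_gt0.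
  have [dl [B [dl0 Bf0 EQ]]] := scheme_equicontinuous e50 T0 cK t0T hf0.
  have hdl : \forall n \near \oo, h n <= dl.
    near=> n; rewrite -[h n]ger0_norm ?(ltW (h0 n))// -normrN -[- _]sub0r.
    near: n; exact: (iffLR (cvgrPdist_le _ _) (ss_h_cvg0 hs) dl dl0).
  have t00 : 0 <= t0 by case/andP: t0T.
  have n0 := mixed_cvg_near (Slim t00 (Ckf _ hf0)) cK e'0.
  have tball : \forall t \near t0, `|t - t0| <= dl.
    apply/nbhs_ballP; exists dl => // t; rewrite /ball/= distrC => ?.
    exact: ltW.
  exists ([set z : R * space | `|z.1 - t0| <= dl /\ B z.2],
    [set n | h n <= dl /\ forall x, K x -> `|S t0 f0 x - u n t0 f0 x| <= e']).
    split => /=; first by exists ([set t | `|t - t0| <= dl], B).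
    by apply: filterI.
  move=> [[t f] n] /= [[tt Bf] [hn nS]] [/= tT hf] x Kx.
  have t0' : 0 <= t by case/andP: tT.
  have m0 := mixed_cvg_near (Slim t0' (Ckf _ hf)) cK e'0.
  have [m [[hm mS] mS0]] : exists m, (h m <= dl /\
      forall x, K x -> `|S t f x - u m t f x| <= e') /\
      forall x, K x -> `|S t0 f0 x - u m t0 f0 x| <= e'.
    exact: (filter_ex (filterI (filterI hdl m0) n0)).
  have Em := EQ m t f hm tt tT Bf hf x Kx; have En := EQ n t f hn tt tT Bf hf x Kx.
  have S1 := mS x Kx; have S2 := mS0 x Kx; have S3 := nS x Kx.
  have -> : S t f x - u n t f x = (S t f x - u m t f x) + (u m t f x - u m t0 f0 x)
     - (S t0 f0 x - u m t0 f0 x) + (S t0 f0 x - u n t0 f0 x) - (u n t f x - u n t0 f0 x).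
    by ring.
  apply: (le_trans (ler_normB _ _)).
  have := ler_normD ((S t f x - u m t f x) + (u m t f x - u m t0 f0 x)
     - (S t0 f0 x - u m t0 f0 x)) (S t0 f0 x - u n t0 f0 x).
  have := ler_normB ((S t f x - u m t f x) + (u m t f x - u m t0 f0 x)) (S t0 f0 x - u m t0 f0 x).
  have := ler_normD (S t f x - u m t f x) (u m t f x - u m t0 f0 x).
  rewrite /e5 /e' in S1 S2 S3 Em En *; lra.
apply: filterS => n nP t f tT hf x xr.
apply: (nP (t, f)) => //=; exact: le_trans (norm_le_enorm x) xr.
Unshelve. all: by end_near. Qed.

(** The bound is given by pointwise inequalities, which pass to the limit. *)
Lemma semigroup_hle t T f r : 0 <= t <= T -> hle alpha kappa f r ->
  hle alpha kappa (S t f) (expR (omega * T) * r).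
Proof.
move=> tT hf; have r0 := hle_ge0 wk hf.
have T0 : 0 <= T by case/andP: tT => t0 /(le_trans t0).
have lim x y e : 0 < e -> exists g, hle alpha kappa g (expR (omega * T) * r) /\
    (`|S t f x - g x| <= e /\ `|S t f y - g y| <= e).
  move=> e0.
  have /filter_ex[n nP] := scheme_uniform_cvg r (Num.max (enorm x) (enorm y)) e0 T0.
  exists (u n t f); split; first exact: scheme_hle.
  by split; apply: nP => //; rewrite le_max lexx ?orbT.
split=> [x|x y]; apply/ler_addgt0Pr => e e0.
  have ek : 0 < e / kappa x by rewrite divr_gt0.
  have [g [[g1 _] [gx _]]] := lim x x _ ek.
  apply: (@le_trans _ _ ((`|g x| + e / kappa x) * kappa x)).
    rewrite ler_wpM2r ?(ltW (k0 x))// -[S t f x](subrK (g x)) addrC.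
    by apply: (le_trans (ler_normD _ _)); rewrite lerD2l.
  by rewrite mulrDl divfK ?gt_eqF// lerD2r.
have kb := kbar_gt0 x y wk.
have ek : 0 < e / kbar kappa x y / 2 by rewrite divr_gt0// divr_gt0.
have [g [[_ g2] [gx gy]]] := lim x y _ ek.
apply: (@le_trans _ _ ((`|g x - g y| + e / kbar kappa x y) * kbar kappa x y)).
  rewrite ler_wpM2r ?(ltW kb)//.
  have -> : S t f x - S t f y = (g x - g y) + (S t f x - g x) - (S t f y - g y) by ring.
  apply: (le_trans (ler_normB _ _)); have := ler_normD (g x - g y) (S t f x - g x).
  lra.
by rewrite mulrDl divfK ?gt_eqF// lerD2r.
Qed.

End Convergence.

(** * Approximation of the semigroup *)

(** The index [n] is fixed by uniform convergence; the accuracy of the network is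
    chosen afterwards, in terms of the largest power that occurs for this [n]. *)
Lemma semigroup_approximation {R : realType} {d : nat} (alpha p omega : R)
    (kappa kappa0 : 'rV[R]_d -> R) (KK : set ('rV[R]_d -> R)) (h : nat -> R)
    (I : nat -> ('rV[R]_d -> R) -> ('rV[R]_d -> R))
    (H : set (('rV[R]_d -> R) -> R)) (rho : R -> R) (L : set ('rV[R]_d -> R))
    (S : R -> ('rV[R]_d -> R) -> ('rV[R]_d -> R))
    (a r T : R) (k : 'rV[R]_d -> R) (eps : R) :
  (0 < d)%N -> 0 < alpha <= 1 -> 1 < p ->
  standing_setting kappa kappa0 h I ->
  chernoff_conditions kappa omega h I ->
  extension_conditions alpha kappa kappa0 KK omega h I ->
  architecture_conditions alpha p kappa kappa0 KK H rho L ->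
  (forall t f, 0 <= t -> Ck kappa f ->
     mixed_cvg kappa (fun n => steps h (I n) n t f) (S t f)) ->
  0 <= r -> 0 <= T -> 0 <= a < alpha -> KK k -> weight_ll k kappa -> 0 < eps ->
  exists n Phi, chernoff_neural alpha kappa kappa0 H rho L Phi /\
    forall t f, 0 <= t <= T -> hle alpha kappa f r ->
      hle a k (S t f \- steps h Phi n t f) eps.
Proof.
move=> hd alpha01 hp hs hc hext harch Slim r0 T0 a01 Kk llk eps0.
have wkappa := ss_kappa hs; have [wk _ _] := ext_weights hext Kk.
have /andP[alpha0 alpha1] := alpha01; have /andP[a0 aal] := a01.
have growth n f : Ca alpha kappa f -> _ :=
  ext_growth hext n alpha0 (lexx alpha) (ext_kappa hext).
have [c c0 cP] := ll_lesssim wkappa wk llk.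
pose M := expR (omega * T) * r.
have e20 : 0 < eps / 2 by rewrite divr_gt0.
have [rad [s [s0 sP]]] := hle_interpolate (M + M) wkappa wk a0 aal c0 cP llk e20.
have /filter_ex[n nP] := scheme_uniform_cvg hs hc alpha0 Slim r rad s0 T0.
pose q := (1 + r) `^ (p ^+ ksteps (h n) T).
have q0 : 0 < q by rewrite powR_gt0// ltr_pwDl.
have eq0 : 0 < eps / 2 / q by rewrite divr_gt0.
have [Phi [cnPhi PhiP]] :=
  scheme_approximation T n hd alpha01 hp hs hext harch a01 Kk llk eq0.
exists n, Phi; split=> // t f tT hf.
have cf : Ca alpha kappa f by exact: hle_Ca_pos hf.
have -> : S t f \- steps h Phi n t f =
    fun x => (S t f \- steps h (I n) n t f) x +
             (steps h (I n) n t f \- steps h Phi n t f) x.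
  by apply/funext => x /=; rewrite addrA subrK.
rewrite (splitr eps); apply: hle_add => //.
  apply: sP; last by move=> x; exact: nP.
  apply: hle_sub => //.
    exact: (semigroup_hle hs hc alpha0 growth Slim).
  exact: (scheme_hle hs hc alpha0 growth).
apply: hle_le (PhiP t f tT cf).
have /andP[t0 tT'] := tT.
have steps_le : (ksteps (h n) t <= ksteps (h n) T)%N.
  by rewrite /ksteps; apply: le_truncn; rewrite ler_pM2r// invr_gt0 (ss_h_gt0 hs).
have N0 := hn_ge0 alpha f wkappa; have Nr := hle_hn wkappa hf.
have p0 m : 0 <= p ^+ m by rewrite exprn_ge0// ltW// (lt_trans ltr01).
have hq : (1 + hn alpha kappa f) `^ (p ^+ ksteps (h n) t) <= q.
  apply: (@le_trans _ _ ((1 + r) `^ (p ^+ ksteps (h n) t))).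
    by apply: ge0_ler_powR; rewrite ?nnegrE ?addr_ge0 ?lerD2l.
  by apply: ler_powR; rewrite ?lerDl// ler_weXn2l// ltW.
apply: (le_trans (ler_wpM2r (ltW eq0) hq)).
by rewrite mulrC divfK// gt_eqF.
Qed.

Unset Implicit Arguments.

Theorem theorem3p6 (R : realType) (d : nat) (hd : (0 < d)%N)
    (alpha p omega : R) (halpha : 0 < alpha <= 1) (hp : 1 < p)
    (kappa kappa0 : 'rV[R]_d -> R) (KK : set ('rV[R]_d -> R))
    (h : nat -> R) (I : nat -> ('rV[R]_d -> R) -> ('rV[R]_d -> R))
    (H : set (('rV[R]_d -> R) -> R)) (rho : R -> R) (L : set ('rV[R]_d -> R))
    (hstanding : standing_setting kappa kappa0 h I)
    (hchernoff : chernoff_conditions kappa omega h I)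
    (hextension : extension_conditions alpha kappa kappa0 KK omega h I)
    (harchitecture : architecture_conditions alpha p kappa kappa0 KK H rho L) :
  (forall (alpha' : R) (kappa' : 'rV[R]_d -> R) (T : R) (n : nat) (eps : R),
     0 <= alpha' < alpha -> KK kappa' -> weight_ll kappa' kappa ->
     0 <= T -> 0 < eps ->
     exists Phi : ('rV[R]_d -> R) -> ('rV[R]_d -> R),
       chernoff_neural alpha kappa kappa0 H rho L Phi /\
       forall (t : R) (f : 'rV[R]_d -> R),
         0 <= t <= T -> Ca alpha kappa f ->
         (hnorm alpha' kappa' (steps h (I n) n t f \- steps h Phi n t f) <=
          (1 + hnorm alpha kappa f) `^ (p ^+ ksteps (h n) t) * eps%:E)%E)
  /\
  (forall S : R -> ('rV[R]_d -> R) -> ('rV[R]_d -> R),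
     (forall (t : R) (f : 'rV[R]_d -> R), 0 <= t -> Ck kappa f ->
        mixed_cvg kappa (fun n => steps h (I n) n t f) (S t f)) ->
     forall (r T alpha' : R) (kappa' : 'rV[R]_d -> R) (eps : R),
       0 <= r -> 0 <= T -> 0 <= alpha' < alpha ->
       KK kappa' -> weight_ll kappa' kappa -> 0 < eps ->
       exists (n : nat) (Phi : ('rV[R]_d -> R) -> ('rV[R]_d -> R)),
         chernoff_neural alpha kappa kappa0 H rho L Phi /\
         (ereal_sup [set ereal_sup
              [set hnorm alpha' kappa' (S t f \- steps h Phi n t f)
              | t in [set t : R | (0 <= t <= T)%R]]
            | f in Ca_ball alpha kappa r] < eps%:E)%E).
Proof.
have wkappa := ss_kappa hstanding.
split=> [alpha' kappa' T n eps ha Kk llk T0 eps0|].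
  have [wk _ _] := ext_weights hextension Kk.
  have [Phi [cnPhi PhiP]] := scheme_approximation T n hd halpha hp hstanding
    hextension harchitecture ha Kk llk eps0.
  exists Phi; split=> // t f tT cf.
  rewrite (hnE wkappa cf) -EFinD poweR_EFin -EFinM.
  by apply/(hnorm_le _ _ _ wk); exact: PhiP.
move=> S Slim r T alpha' kappa' eps r0 T0 ha Kk llk eps0.
have [wk _ _] := ext_weights hextension Kk.
have e20 : 0 < eps / 2 by rewrite divr_gt0.
have [n [Phi [cnPhi PhiP]]] := semigroup_approximation hd halpha hp hstanding
  hchernoff hextension harchitecture Slim r0 T0 ha Kk llk e20.
exists n, Phi; split=> //.
apply: (@le_lt_trans _ _ (eps / 2)%:E); last first.
  by rewrite lte_fin ltr_pdivrMr// ltr_pMr// ltr1n.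
apply: ge_ereal_sup => _ [f [_ fr] <-].
apply: ge_ereal_sup => _ [t tT <-].
by apply/(hnorm_le _ _ _ wk)/PhiP => //; exact/(hnorm_le _ _ _ wkappa).
Qed.
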